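(* The family $\{\mathscr{M}_K(\tau)\}$ of all renormalized Steiner-Minkowski polynomials corresponding to all solid compact convex sets $K\subset\mathbb{R}^n$ in all dimensions $n$, $1\le n<\infty$, is a normal family of analytic functions in the complex plane $\mathbb{C}$.
   Context: A compact convex set $K\subset\mathbb{R}^n$ is called solid if its interior is non-empty, equivalently $\mathrm{Vol}_n(K)>0$. Let $B$ denote the closed unit Euclidean ball of $\mathbb{R}^n$ centered at the origin. By Minkowski, for $t>0$ the function $M_K(t)=\mathrm{Vol}_n(K+tB)$ is a polynomial in $t$ of degree $n$ (the Steiner-Minkowski polynomial of $K$); it is then considered for all complex $t$. Its constant coefficient is $\mathrm{Vol}_n(K)$ and its linear coefficient is the surface area $\mathrm{Vol}_{n-1}(\partial K)$. For solid $K$ the shape factor is $\sigma_K=\mathrm{Vol}_{n-1}(\partial K)/\mathrm{Vol}_n(K)>0$. The renormalized Steiner-Minkowski polynomial $\mathscr{M}_K(\tau)$ is the polynomial in $\tau$ of degree $n$ defined by $M_K(t)=\mathrm{Vol}_n(K)\cdot\mathscr{M}_K(\sigma_K t)$, i.e. $\mathscr{M}_K(\tau)=M_K(\tau/\sigma_K)/\mathrm{Vol}_n(K)$. A family of entire functions is normal in $\mathbb{C}$ if every sequence of its members has a subsequence converging uniformly on compact subsets of $\mathbb{C}$. *)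

(* Defs.v *)
From HB Require Import structures.
From mathcomp Require Import all_boot all_order all_algebra.
From mathcomp Require Import all_classical all_reals all_analysis.
From mathcomp.real_closed Require Import complex.

Set Implicit Arguments.
Unset Strict Implicit.
Unset Printing Implicit Defensive.

Import Order.TTheory GRing.Theory Num.Theory.
Import numFieldNormedType.Exports.

Local Open Scope classical_set_scope.
Local Open Scope ring_scope.

(* The norm of 'rV[R]_n in the library is the sup norm (with the usual topology
   of R^n), so the Euclidean ball is written out. *)
Definition euclidean_ball (R : realType) (n : nat) : set 'rV[R]_n :=
  [set x | \sum_(i < n) (x ord0 i) ^+ 2 <= 1].

Arguments euclidean_ball R n : clear implicits.

(* A + tB *)
Definition parallel_set (R : realType) (n : nat) (A : set 'rV[R]_n) (t : R) :
    set 'rV[R]_n :=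
  [set x + t *: b | x in A & b in euclidean_ball R n].

(* n-dimensional Lebesgue measure, as the n-fold product of the Lebesgue measure
   of R: the measure of A is the integral of the measures of its sections.  It
   is only ever applied to compact sets, for which all the integrands are
   measurable. *)
Fixpoint vol (R : realType) (n : nat) : set 'rV[R]_n -> \bar R :=
  match n with
  | 0 => fun A => (\1_A (0 : 'rV[R]_0))%:E
  | m.+1 => fun A =>
      (\int[@lebesgue_measure R]_x
         vol [set v : 'rV[R]_m | A (row_mx (x%:M : 'rV[R]_1) v)])%E
  end.

Definition boundary (T : topologicalType) (A : set T) : set T :=
  closure A `\` interior A.

(* (n-1)-dimensional volume of a subset A of R^n, as Minkowski content:
   the limit of Vol_n(A + tB) / (2t) as t -> 0+.  The boundary of a convex body is
   compact and (n-1)-rectifiable, so this limit exists for it and is its surface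
   area.  For n = 1 this counts the points of a finite set. *)
Definition hypersurface_area (R : realType) (n : nat) (A : set 'rV[R]_n) :
    \bar R :=
  lim ((vol (parallel_set A t) * ((2 * t)^-1)%:E)%E @[t --> 0^'+]).

Definition solid_convex_body (R : realType) (n : nat) (K : set 'rV[R]_n) : Prop :=
  [/\ compact K, convex_set K & interior K !=set0].

(* The polynomial M_K, with M_K(t) = Vol_n(K + tB) for t > 0.  Uniqueness is
   clear; existence for compact convex K is Minkowski's theorem, so that the
   default value 0 is never used. *)
Definition steiner_poly (R : realType) (n : nat) (K : set 'rV[R]_n) : {poly R} :=
  xget 0 [set p : {poly R} |
            forall t : R, 0 < t -> (p.[t])%:E = vol (parallel_set K t)].

Definition shape_factor (R : realType) (n : nat) (K : set 'rV[R]_n) : R :=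
  fine (hypersurface_area (boundary K)) / fine (vol K).

(* M_K(tau / sigma_K) / Vol_n(K) *)
Definition renormalized_steiner_poly (R : realType) (n : nat)
    (K : set 'rV[R]_n) : {poly R} :=
  (fine (vol K))^-1 *: (steiner_poly K \Po ((shape_factor K)^-1 *: 'X)).

Definition complex_eval (R : realType) (p : {poly R}) : R[i] -> R[i] :=
  fun z => (map_poly (real_complex R) p).[z].

Definition renormalized_steiner_family (R : realType) : set (R[i] -> R[i]) :=
  [set f | exists (n : nat) (K : set 'rV[R]_n),
     [/\ (0 < n)%N, solid_convex_body K
       & f = complex_eval (renormalized_steiner_poly K)]].

Arguments renormalized_steiner_family R : clear implicits.

(* The topology and uniform structure of C are those of its norm, which is the
   modulus for C = R[i].  {family compact, _} is uniform convergence on compact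
   sets. *)
Definition normal_family (C : numClosedFieldType) (F : set (C -> C)) : Prop :=
  forall u : nat -> C -> C, (forall k, F (u k)) ->
  exists2 phi : nat -> nat, {homo phi : j k / (j < k)%N} &
    exists f : C -> C, {family compact, (fun k => u (phi k)) @ \oo --> f}.

(* Main.v *)
(** Let V(t) = Vol_n(K + tB), continued to t < 0 by the volumes of the inner
    parallel bodies {x | x + |t|B is contained in K}.  By the Brunn-Minkowski
    inequality, log V is concave near 0 and on the positive half-line.  Hence
    V'(0) exists, it is the Minkowski content of the boundary of K because
    (boundary K) + tB is squeezed between the differences K + tB minus the inner
    parallel bodies, and V(t) <= V(0) exp(sigma_K t), i.e. M_K(r) <= exp r for
    all r > 0, whatever K and n are.

    The coefficients of M_K are nonnegative: for a zonotope Z, the volume of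
    K + tZ is a polynomial in t with nonnegative coefficients, as adding a segment
    of length s in some direction adds s times the volume of a projection; and B is
    a limit of zonotopes.  The latter says that the Euclidean norm is
    approximated by sums of |<x, u>|; here the u are sums of randomly signed
    vectors of an orthogonal frame, and the central limit theorem (in Lindeberg's
    form) makes the mean of |<x, u>| asymptotically rotation invariant.

    So |M_K(z)| <= exp |z|, and Montel's theorem applies; with nonnegative
    coefficients it follows from the compactness of [0, e]^N, the tails of the
    power series being uniformly small on disks. *)
From HB Require Import structures.
Require Import Defs.
From mathcomp Require Import all_boot all_order all_algebra.
From mathcomp Require Import all_classical all_reals all_analysis.
From mathcomp.real_closed Require Import complex.
From mathcomp Require Import measurable_realfun.
From mathcomp Require Import ring lra.

Set Implicit Arguments.
Unset Strict Implicit.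
Unset Printing Implicit Defensive.
Import Order.TTheory GRing.Theory Num.Theory.
Import numFieldNormedType.Exports.
Local Open Scope classical_set_scope.
Local Open Scope ring_scope.

(** * Volume as a product measure *)

(** Brunn-Minkowski is used in the form Vol(A)^a Vol(B)^b <= Vol(C) because no exponent there
    depends on the dimension: this form passes from sections to bodies, and it gives one and the
    same bound exp r for every n. The slope of log V at 0 enters through its one-sided values: the
    Minkowski content of the boundary is governed by the mean of the outer and the inner rate, and
    the outer one, which controls V(t) for t > 0, is at most that mean.

    The central limit argument involves no limit law. Two unit vectors are compared directly: their
    blocks of coordinates have equal sums of squares, so exchanging one block for the other changes
    the mean only to third order, and the mean itself is made large compared with the total error.

    A zonotope yields a polynomial that is close to M_K in its values at positive t, so the signs of
    the coefficients have to be recovered from these values; convexity on the half-line does this at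
    t = 0. *)

Section lebesgue_tuple.
Variables (R : realType) (n : nat).
Local Notation T n := (n.-tuple (measurableTypeR R)).

Definition cons_pair (p : measurableTypeR R * T n) : T n.+1 := [tuple of p.1 :: p.2].

Lemma measurable_cons_pair : measurable_fun setT cons_pair.
Proof. exact: (@measurable_cons _ _ _ _ fst n snd). Qed.

Variable mu : {sigma_finite_measure set (T n) -> \bar R}.

Definition cons_measure : set (T n.+1) -> \bar R :=
  pushforward (@lebesgue_measure R \x mu)%E cons_pair.

Let cm0 : cons_measure set0 = 0%E.
Proof. by rewrite /cons_measure /pushforward preimage_set0 measure0. Qed.

Let cm_ge0 A : (0 <= cons_measure A)%E.
Proof. by rewrite /cons_measure /pushforward; apply: measure_ge0. Qed.

Let cm_sa : semi_sigma_additive cons_measure.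
Proof.
pose m : {measure set (T n.+1) -> \bar R} :=
  measure_function_pushforward__canonical__measure_function_Measure
     (@lebesgue_measure R \x mu)%E measurable_cons_pair.
exact: (@measure_semi_sigma_additive _ _ _ m).
Qed.

HB.instance Definition _ := isMeasure.Build _ _ _ cons_measure cm0 cm_ge0 cm_sa.

Definition tuple_tail (t : T n.+1) : T n := behead_tuple t.

Let cm_sf : sigma_finite setT cons_measure.
Proof.
have /sigma_finiteP[F [TF ndF Foo]] := sigma_finiteT (@lebesgue_measure R).
have /sigma_finiteP[G [TG ndG Goo]] := sigma_finiteT mu.
exists (fun k => [set t : T n.+1 | F k (thead t) /\ G k (tuple_tail t)]).
  apply/seteqP; split => [t _|t _ //].
  have : setT (thead t) by [].
  rewrite TF => -[i _ Fi].
  have : setT (tuple_tail t) by [].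
  rewrite TG => -[j _ Gj].
  exists (maxn i j) => //=; split.
    by move: (thead t) Fi; exact/subsetPset/ndF/leq_maxl.
  by move: (tuple_tail t) Gj; exact/subsetPset/ndG/leq_maxr.
move=> k; have [mF Ffin] := Foo k; have [mG Gfin] := Goo k; split.
  apply: measurableI.
    rewrite -[X in measurable X]setTI.
    exact: (@measurable_tnth _ (measurableTypeR R) n.+1 ord0).
  rewrite -[X in measurable X]setTI.
  exact: (@measurable_behead _ (measurableTypeR R) n).
rewrite /cons_measure /pushforward.
rewrite (_ : _ @^-1` _ = F k `*` G k); last first.
  apply/seteqP; split => -[x t] /=.
    by rewrite /cons_pair/= theadE => -[? ]; rewrite (_ : tuple_tail _ = t)//; apply/val_inj.
  by move=> [? ?]; rewrite theadE; split => //; rewrite (_ : tuple_tail _ = t)//; apply/val_inj.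
by rewrite product_measure1E// lte_mul_pinfty// ge0_fin_numE.
Qed.

HB.instance Definition _ := Measure_isSigmaFinite.Build _ _ _ cons_measure cm_sf.
End lebesgue_tuple.

(** The sigma-finite structure is kept in the type because the next product, and Tonelli for it,
    require it. *)
Fixpoint leb_tuple (R : realType) (n : nat) :
    {sigma_finite_measure set (n.-tuple (measurableTypeR R)) -> \bar R} :=
  match n with
  | 0 => (\d_ [tuple])
  | m.+1 => cons_measure (leb_tuple R m)
  end.

Section volume.
Variable R : realType.
Local Notation T n := (n.-tuple (measurableTypeR R)).
Local Notation leb := (@lebesgue_measure R).

Definition row_of_tuple n (t : T n) : 'rV[R]_n := \row_i tnth t i.

Definition cons_rV n (x : R) (v : 'rV[R]_n) : 'rV[R]_n.+1 := row_mx (x%:M : 'rV[R]_1) v.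

Definition section n (A : set 'rV[R]_n.+1) (x : R) : set 'rV[R]_n :=
  [set v | A (cons_rV x v)].

(** Row vectors carry the topology and tuples the sigma-algebra, so measurability is pulled back
    along [row_of_tuple]. *)
Definition borel n (A : set 'rV[R]_n) := measurable (@row_of_tuple n @^-1` A).

Lemma volS n (A : set 'rV[R]_n.+1) : vol A = (\int[leb]_x vol (section A x))%E.
Proof. by []. Qed.

Lemma cons_rV0 n x (v : 'rV[R]_n) : cons_rV x v ord0 ord0 = x.
Proof.
have -> : ord0 = lshift n (ord0 : 'I_1) by exact/val_inj.
by rewrite (row_mxEl (x%:M : 'M[R]_1) v) mxE eqxx mulr1n.
Qed.

Lemma cons_rVS n x (v : 'rV[R]_n) i : cons_rV x v ord0 (lift ord0 i) = v ord0 i.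
Proof.
have -> : lift ord0 i = rshift 1 i by exact/val_inj.
by rewrite (row_mxEr (x%:M : 'M[R]_1) v).
Qed.

Lemma row_of_cons_pair n p : row_of_tuple (@cons_pair R n p) = cons_rV p.1 (row_of_tuple p.2).
Proof.
apply/rowP => i; rewrite mxE; case: (unliftP ord0 i) => [j|] ->.
  by rewrite cons_rVS mxE /cons_pair tnthS.
by rewrite cons_rV0 /cons_pair tnth0.
Qed.

Lemma measurable_section_pair n (A : set 'rV[R]_n.+1) : borel A ->
  measurable ((@cons_pair R n) @^-1` (@row_of_tuple n.+1 @^-1` A)).
Proof.
move=> mA; rewrite -[X in measurable X]setTI; exact: measurable_cons_pair.
Qed.

Lemma row_of_section n (A : set 'rV[R]_n.+1) x :
  @row_of_tuple n @^-1` section A x =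
  xsection ((@cons_pair R n) @^-1` (@row_of_tuple n.+1 @^-1` A)) x.
Proof.
by apply/seteqP; split => t; rewrite /xsection/= inE /section/= row_of_cons_pair.
Qed.

Lemma borel_section n (A : set 'rV[R]_n.+1) x : borel A -> borel (section A x).
Proof.
move=> mA; rewrite /borel row_of_section.
by apply: measurable_xsection; apply: measurable_section_pair.
Qed.

(** The iterated integral [vol] is defined for any set but behaves as a measure on Borel sets;
    additivity, monotonicity and Tonelli all enter through this identification. *)
Lemma vol_leb_tuple n (A : set 'rV[R]_n) : borel A ->
  vol A = leb_tuple R n (@row_of_tuple n @^-1` A).
Proof.
elim: n A => [|n IH] A mA.
  rewrite /= diracE indicE; congr ((nat_of_bool _)%:R%:E).
  apply: (@asbool_equiv_eq (A 0) (A (row_of_tuple [tuple]))).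
  by rewrite (thinmx0 (row_of_tuple _)).
rewrite volS /= /cons_measure /pushforward /product_measure1.
apply: eq_integral => x _ /=.
by rewrite IH ?row_of_section//; exact: borel_section.
Qed.

Lemma measurable_vol_section n (A : set 'rV[R]_n.+1) : borel A ->
  measurable_fun setT (fun x => vol (section A x)).
Proof.
move=> mA; rewrite (_ : (fun x => _) = leb_tuple R n \o
  xsection ((@cons_pair R n) @^-1` (@row_of_tuple n.+1 @^-1` A))).
  by apply: measurable_fun_xsection; apply: measurable_section_pair.
apply/funext => x /=; rewrite vol_leb_tuple ?row_of_section//; exact: borel_section.
Qed.

Lemma vol_ge0 n (A : set 'rV[R]_n) : (0 <= vol A)%E.
Proof.
elim: n A => [|n IH] A /=; first by rewrite lee_fin indicE.
by apply: integral_ge0.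
Qed.

Lemma le_vol n (A B : set 'rV[R]_n) : borel A -> borel B -> A `<=` B ->
  (vol A <= vol B)%E.
Proof.
by move=> mA mB AB; rewrite !vol_leb_tuple// le_measure// ?inE// => t /AB.
Qed.

Lemma borelD n (A B : set 'rV[R]_n) : borel A -> borel B -> borel (A `\` B).
Proof. by move=> mA mB; rewrite /borel; exact: measurableD. Qed.

Lemma volD n (A B : set 'rV[R]_n) : borel A -> borel B -> B `<=` A ->
  vol A = (vol (A `\` B) + vol B)%E.
Proof.
move=> mA mB BA; rewrite !vol_leb_tuple//; last exact: borelD.
rewrite -measureU//.
- congr (leb_tuple R n _); apply/seteqP; split => t /=.
    by move=> At; have [Bt|nBt] := pselect (B (row_of_tuple t)); [right|left].
  by case=> [[]//|/BA].
- exact: borelD.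
- by apply/seteqP; split => t //= -[[_ ?] ?].
Qed.

Lemma rat_approx (x e : R) : 0 < e -> exists q : rat, `|ratr q - x| < e.
Proof.
move=> e0; have [|q] := @rat_in_itvoo R (x - e) (x + e); first by lra.
by rewrite in_itv/= => /andP[? ?]; exists q; rewrite ltr_norml; lra.
Qed.

(** An open set is the countable union of the sup-norm boxes with rational centre and radius 1/(k+1)
    that it contains. *)
Lemma borel_open n (A : set 'rV[R]_n) : open A -> borel A.
Proof.
move=> oA.
pose B (p : 'rV[rat]_n * nat) : set 'rV[R]_n :=
  [set v | forall i, `|ratr (p.1 ord0 i) - v ord0 i| < p.2.+1%:R^-1].
have mB p : borel (B p).
  rewrite /borel (_ : _ @^-1` _ = \bigcap_(i in [set: 'I_n])
     ((@tnth n R ^~ i) @^-1` ball (ratr (p.1 ord0 i) : R) (p.2.+1%:R^-1))).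
    apply: fin_bigcap_measurable => // i _; rewrite -[X in measurable X]setTI.
    apply: (@measurable_tnth _ (measurableTypeR R)) => //.
    exact: measurable_ball.
  apply/seteqP; split => t /= H i; last by rewrite mxE; exact: (H i I).
  by move=> _ /=; have := H i; rewrite mxE.
rewrite (_ : A = \bigcup_p (if `[<B p `<=` A>] then B p else set0)); last first.
  apply/seteqP; split => v; last first.
    by case=> p _; case: ifPn => // /asboolP; apply.
  move=> Av; have /nbhs_ballP [e /= e0 eA] := open_nbhs_nbhs (conj oA Av).
  (* The radius is below e / 2 and v lies in the box, so every point of the box is within e of v. *)
  pose k := Num.truncn (2 / e).
  have ke : k.+1%:R^-1 < e / 2.
    by rewrite invf_plt ?posrE ?divr_gt0// invf_div truncnS_gt.
  have k0 : (0 : R) < k.+1%:R^-1 by rewrite invr_gt0.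
  have /choice[q Hq] : forall i : 'I_n, exists q : rat, `|ratr q - v ord0 i| < k.+1%:R^-1.
    by move=> i; exact: rat_approx.
  exists (\row_i q i, k) => //=; rewrite asboolT.
    by move=> i /=; rewrite mxE.
  move=> w Bw; apply: eA; split=> // i j; rewrite ord1.
  have := Bw j; have := Hq j; rewrite /= mxE /ball /= => H1 H2.
  rewrite (_ : v 0 j - w 0 j = (v 0 j - ratr (q j)) + (ratr (q j) - w 0 j)); last by ring.
  rewrite (le_lt_trans (ler_normD _ _))//.
  by rewrite distrC [ltRHS]splitr (lt_trans (ltrD H1 H2) (ltrD ke ke)).
rewrite /borel preimage_bigcup.
apply: countable_bigcupT_measurable => [|p]; first exact: countableP.
case: ifP => _; first exact: mB.
by rewrite preimage_set0.
Qed.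

Lemma borel_closed n (A : set 'rV[R]_n) : closed A -> borel A.
Proof.
move=> cA; rewrite /borel -[X in measurable X]setCK; apply: measurableC.
apply: (borel_open (A := ~` A)); exact: closed_openC.
Qed.

Lemma borel_compact n (A : set 'rV[R]_n) : compact A -> borel A.
Proof.
by move=> cA; apply: borel_closed; apply: compact_closed => //; apply: norm_hausdorff.
Qed.

(** Both sides are measures in A that agree on half-open intervals. *)
Lemma lebesgue_shift (a : R) (A : set (measurableTypeR R)) : measurable A ->
  leb A = pushforward leb (fun x : measurableTypeR R => (x + a) : measurableTypeR R) A.
Proof.
move=> mA.
have mf : measurable_fun setT (fun x : measurableTypeR R => (x + a) : measurableTypeR R).
  exact: measurable_funD.
pose m : {measure set (measurableTypeR R) -> \bar R} :=
  measure_function_pushforward__canonical__measure_function_Measure leb mf.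
apply: (@lebesgue_measure_unique R m) => // _ [[b c]] _ <-.
rewrite /m/= /pushforward (_ : _ @^-1` _ = [set` `]b - a, c - a]]); last first.
  by apply/seteqP; split => x /=; rewrite !in_itv/= lerBrDr ltrBlDr.
by rewrite !lebesgue_measure_itv/= !lte_fin ltrD2r; case: ifP => // _; rewrite -!EFinB; congr EFin; ring.
Qed.

Lemma ge0_integral_shift (f : R -> \bar R) (a : R) :
  measurable_fun [set: measurableTypeR R] f -> (forall x, 0 <= f x)%E ->
  (\int[leb]_x f (x + a)%R = \int[leb]_x f x)%E.
Proof.
move=> mf f0.
have mp : measurable_fun setT (fun x : measurableTypeR R => (x + a) : measurableTypeR R).
  exact: measurable_funD.
rewrite -[LHS](@ge0_integral_pushforward _ _ _ _ R _ mp leb setT f)//.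
pose m : {measure set (measurableTypeR R) -> \bar R} :=
  measure_function_pushforward__canonical__measure_function_Measure leb mp.
apply: (@eq_measure_integral _ _ R setT leb m f).
by move=> A mA _; rewrite /= -lebesgue_shift.
Qed.

Lemma continuous_rV (T : topologicalType) n (f : T -> 'rV[R]_n) :
  (forall i, continuous (fun t => f t ord0 i)) -> continuous f.
Proof.
move=> fc t; apply/cvg_ballP => e e0.
have H : \forall t' \near t, forall i, ball (f t ord0 i) e (f t' ord0 i).
  apply: filter_forall => i; by move/cvg_ballP: (fc i t) => /(_ e e0).
near=> t'; split => // i j; rewrite ord1.
by move: j; near: t'.
Unshelve. all: by end_near. Qed.

Lemma continuous_cons_rV (T : topologicalType) n (f : T -> R) (g : T -> 'rV[R]_n) :
  continuous f -> continuous g -> continuous (fun t => cons_rV (f t) (g t)).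
Proof.
move=> cf cg; apply: continuous_rV => i.
case: (unliftP ord0 i) => [j|] ->.
  rewrite (_ : (fun t => _) = fun t => g t ord0 j); last by apply/funext => t; rewrite cons_rVS.
  by move=> t; exact: (continuous_comp (cg t) (@coord_continuous R 1 n ord0 j (g t))).
by rewrite (_ : (fun t => _) = f)//; apply/funext => t; rewrite cons_rV0.
Qed.

Lemma closed_section n (A : set 'rV[R]_n.+1) x : closed A -> closed (section A x).
Proof.
move=> cA; apply: (@preimage_closed _ _ (cons_rV x) A) => // v _.
apply: (@continuous_cons_rV 'rV[R]_n n (cst x) id); first exact: cst_continuous.
by move=> ?; exact: cvg_id.
Qed.

Lemma closed_shift n (A : set 'rV[R]_n) (w : 'rV[R]_n) : closed A -> closed [set v | A (v + w)].
Proof.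
move=> cA; apply: (@preimage_closed _ _ (fun v : 'rV[R]_n => v + w) A) => // v _.
exact: (cvgD cvg_id (cvg_cst w)).
Qed.

Lemma rV_cons n (w : 'rV[R]_n.+1) : exists x v, w = cons_rV x v.
Proof.
exists (w ord0 ord0), (\row_i w ord0 (lift ord0 i)); apply/rowP => i.
by case: (unliftP ord0 i) => [j|] ->; rewrite ?cons_rVS ?cons_rV0 ?mxE.
Qed.

Lemma cons_rVD n x y (v w : 'rV[R]_n) :
  cons_rV x v + cons_rV y w = cons_rV (x + y) (v + w).
Proof.
apply/rowP => i; rewrite mxE.
by case: (unliftP ord0 i) => [j|] ->; rewrite ?cons_rVS ?cons_rV0 ?mxE.
Qed.

Lemma cons_rVZ n a x (v : 'rV[R]_n) : a *: cons_rV x v = cons_rV (a * x) (a *: v).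
Proof.
apply/rowP => i; rewrite mxE.
by case: (unliftP ord0 i) => [j|] ->; rewrite ?cons_rVS ?cons_rV0 ?mxE.
Qed.

Lemma vol_shift n (A : set 'rV[R]_n) (w : 'rV[R]_n) : closed A -> vol [set v | A (v + w)] = vol A.
Proof.
elim: n A w => [|n IH] A w cA.
  by congr vol; apply/seteqP; split => v /=; rewrite [_ + _]thinmx0 [v]thinmx0.
have [x [v ->]] := rV_cons w; rewrite !volS.
rewrite -[RHS](@ge0_integral_shift _ x) => [|//|?]; last 2 first.
- by apply: measurable_vol_section; exact: borel_closed.
- exact: vol_ge0.
apply: eq_integral => y _; rewrite -[RHS](IH _ v); last exact: closed_section.
by congr vol; apply/seteqP; split => u; rewrite /section/= cons_rVD.
Qed.

(** A shear translates each section. Such shears turn any direction with nonzero first coordinate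
    into the first axis, which is the only change of variables in the proof besides translations. *)
Lemma vol_shear n (A : set 'rV[R]_n.+1) (w : 'rV[R]_n) : closed A ->
  vol [set v : 'rV[R]_n.+1 | A (v + v ord0 ord0 *: cons_rV 0 w)] = vol A.
Proof.
move=> cA; rewrite !volS; apply: eq_integral => x _.
rewrite -[RHS](vol_shift (x *: w)); last exact: closed_section.
congr vol; apply/seteqP; split => u; rewrite /section/= cons_rV0 cons_rVZ cons_rVD.
  by rewrite mulr0 addr0.
by rewrite mulr0 addr0.
Qed.

Lemma vol_le_box n (A : set 'rV[R]_n) (M : R) : 0 <= M -> borel A ->
  (forall v, A v -> forall i, `|v ord0 i| <= M) -> (vol A <= ((M *+ 2) ^+ n)%:E)%E.
Proof.
move=> M0; elim: n A => [|n IH] A mA AM.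
  by rewrite /= expr0 lee_fin indicE; case: (_ \in _).
rewrite volS; pose c : R := (M *+ 2) ^+ n.
have c0 : 0 <= c by rewrite exprn_ge0// mulrn_wge0.
apply: (@le_trans _ _ (\int[leb]_(x in `[(- M)%R, M]) c%:E)%E); last first.
  rewrite integral_cst//= lebesgue_measure_itv/= lte_fin.
  case: ifPn => MM; first by rewrite -EFinB -EFinM lee_fin exprSr opprK mulr2n.
  by rewrite mule0 lee_fin exprn_ge0// mulrn_wge0.
rewrite [leRHS]integral_mkcond; apply: ge0_le_integral => //.
- by move=> x _; exact: vol_ge0.
- exact: measurable_vol_section.
- apply/(measurable_restrictT _ _).1 => //.
- move=> x _; rewrite patchE; case: ifPn => xM.
    apply: IH; first exact: borel_section.
    by move=> v Av i; rewrite -(cons_rVS x v); apply: AM.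
  rewrite (_ : section A x = set0) ?vol_leb_tuple ?preimage_set0 ?measure0//.
    exact: (borel_closed closed0).
  apply/seteqP; split => // v /= Av; move/negP: xM; apply.
  by have := AM _ Av ord0; rewrite cons_rV0 inE/= in_itv/= ler_norml.
Qed.

Lemma compact_rV_bounded n (A : set 'rV[R]_n) : compact A ->
  exists2 M : R, 0 <= M & forall v, A v -> forall i, `|v ord0 i| <= M.
Proof.
move=> /compact_bounded[M [_ HM]]; exists (`|M| + 1); first by rewrite addr_ge0.
move=> v Av i; have /(_ _ v Av) := HM (`|M| + 1).
rewrite (le_lt_trans (ler_norm M)) ?ltrDl// => /(_ isT); apply: le_trans.
by rewrite [leRHS]/Num.Def.normr/= mx_normrE; apply/bigmax_geP; right; exists (ord0, i).
Qed.

Lemma vol_fin n (A : set 'rV[R]_n) : compact A -> (vol A) \is a fin_num.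
Proof.
move=> cA; have [M M0 HM] := compact_rV_bounded cA.
rewrite ge0_fin_numE ?vol_ge0// (le_lt_trans (vol_le_box M0 _ HM)) ?ltry//.
exact: borel_compact.
Qed.

End volume.

(** * Convex bodies and parallel sets *)

Section convex_bodies.
Variable R : realType.
Implicit Types (n : nat).

Definition dot n (x y : 'rV[R]_n) : R := \sum_i x ord0 i * y ord0 i.

Definition enorm n (x : 'rV[R]_n) : R := Num.sqrt (dot x x).

Lemma dotC n (x y : 'rV[R]_n) : dot x y = dot y x.
Proof. by apply: eq_bigr => i _; rewrite mulrC. Qed.

Lemma dotDl n (x y z : 'rV[R]_n) : dot (x + y) z = dot x z + dot y z.
Proof. by rewrite /dot -big_split; apply: eq_bigr => i _; rewrite mxE mulrDl. Qed.

Lemma dotDr n (x y z : 'rV[R]_n) : dot x (y + z) = dot x y + dot x z.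
Proof. by rewrite dotC dotDl !(dotC x). Qed.

Lemma dotZl n a (x y : 'rV[R]_n) : dot (a *: x) y = a * dot x y.
Proof. by rewrite /dot mulr_sumr; apply: eq_bigr => i _; rewrite mxE mulrA. Qed.

Lemma dotZr n a (x y : 'rV[R]_n) : dot x (a *: y) = a * dot x y.
Proof. by rewrite dotC dotZl dotC. Qed.

Lemma dotNl n (x y : 'rV[R]_n) : dot (- x) y = - dot x y.
Proof. by rewrite -scaleN1r dotZl mulN1r. Qed.

Lemma dotNr n (x y : 'rV[R]_n) : dot x (- y) = - dot x y.
Proof. by rewrite dotC dotNl dotC. Qed.

Lemma dot0l n (y : 'rV[R]_n) : dot 0 y = 0.
Proof. by rewrite -(scale0r 0) dotZl mul0r. Qed.

Lemma dot_ge0 n (x : 'rV[R]_n) : 0 <= dot x x.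
Proof. by apply: sumr_ge0 => i _; rewrite -expr2 sqr_ge0. Qed.

Lemma sqr_coord_le_dot n (x : 'rV[R]_n) i : x ord0 i ^+ 2 <= dot x x.
Proof.
rewrite /dot (bigD1 i)//= expr2 lerDl.
by apply: sumr_ge0 => j _; rewrite -expr2 sqr_ge0.
Qed.

Lemma dot_eq0 n (x : 'rV[R]_n) : (dot x x == 0) = (x == 0).
Proof.
apply/eqP/eqP => [x0|->]; last by rewrite dot0l.
apply/rowP => i; rewrite mxE; apply/eqP; rewrite -sqrf_eq0; apply/eqP/le_anti.
by rewrite sqr_ge0 andbT -x0 sqr_coord_le_dot.
Qed.

Lemma enorm_ge0 n (x : 'rV[R]_n) : 0 <= enorm x.
Proof. exact: sqrtr_ge0. Qed.

Lemma sqr_enorm n (x : 'rV[R]_n) : enorm x ^+ 2 = dot x x.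
Proof. by rewrite sqr_sqrtr// dot_ge0. Qed.

Lemma enorm_eq0 n (x : 'rV[R]_n) : (enorm x == 0) = (x == 0).
Proof. by rewrite -sqrf_eq0 sqr_enorm dot_eq0. Qed.

Lemma enorm0 n : enorm (0 : 'rV[R]_n) = 0.
Proof. by apply/eqP; rewrite enorm_eq0. Qed.

Lemma enormZ n a (x : 'rV[R]_n) : enorm (a *: x) = `|a| * enorm x.
Proof.
by rewrite /enorm dotZl dotZr mulrA -expr2 sqrtrM ?sqr_ge0// sqrtr_sqr.
Qed.

Lemma enormN n (x : 'rV[R]_n) : enorm (- x) = enorm x.
Proof. by rewrite -scaleN1r enormZ normrN normr1 mul1r. Qed.

Lemma coord_le_enorm n (x : 'rV[R]_n) i : `|x ord0 i| <= enorm x.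
Proof.
by rewrite -[leLHS]sqrtr_sqr ler_sqrt ?sqr_coord_le_dot// dot_ge0.
Qed.

(** Cauchy-Schwarz: expand the square of [enorm y *: x - enorm x *: y] and divide by the product of
    the norms. *)
Lemma dot_le n (x y : 'rV[R]_n) : dot x y <= enorm x * enorm y.
Proof.
have [->|x0] := eqVneq x 0; first by rewrite dot0l enorm0 mul0r.
have [->|y0] := eqVneq y 0; first by rewrite dotC dot0l enorm0 mulr0.
have px : 0 < enorm x by rewrite lt_neqAle eq_sym enorm_eq0 x0 enorm_ge0.
have py : 0 < enorm y by rewrite lt_neqAle eq_sym enorm_eq0 y0 enorm_ge0.
have := dot_ge0 (enorm y *: x - enorm x *: y).
rewrite dotDl !dotDr !dotNl !dotNr !dotZl !dotZr opprK (dotC y x) -!sqr_enorm.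
set a := enorm x; set b := enorm y; set c := dot x y => H.
have : 0 <= (a * b) * (a * b - c) by nra.
by rewrite pmulr_rge0 ?mulr_gt0// subr_ge0.
Qed.

Lemma enormD n (x y : 'rV[R]_n) : enorm (x + y) <= enorm x + enorm y.
Proof.
rewrite -(@ler_pXn2r _ 2) ?nnegrE ?addr_ge0 ?enorm_ge0// sqr_enorm dotDl !dotDr.
rewrite sqrrD -!sqr_enorm (dotC y x); have := dot_le x y; lra.
Qed.

Lemma euclidean_ballE n (x : 'rV[R]_n) : euclidean_ball R n x <-> enorm x <= 1.
Proof.
have -> : (enorm x <= 1) = (dot x x <= 1).
  by rewrite -(@ler_pXn2r _ 2) ?nnegrE ?enorm_ge0// expr1n sqr_enorm.
by rewrite /euclidean_ball/= /dot; under eq_bigr do rewrite expr2.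
Qed.

Definition cvx n (A : set 'rV[R]_n) := forall (a b : R) x y,
  0 <= a -> 0 <= b -> a + b = 1 -> A x -> A y -> A (a *: x + b *: y).

Lemma convex_set_cvx n (A : set 'rV[R]_n) : convex_set A -> cvx A.
Proof.
move=> cA a b x y a0 b0 ab Ax Ay.
have a01 : 0 <= a <= 1 by lra.
have /(_ (mem_set Ax) (mem_set Ay)) := cA x y (Itv01 a0 (andP a01).2).
have -> : b = 1 - a by lra.
by rewrite inE.
Qed.

Definition msum n (A B : set 'rV[R]_n) := [set x + y | x in A & y in B].

Lemma compact_image (m n : nat) (f : 'rV[R]_m -> 'rV[R]_n) (A : set 'rV[R]_m) :
  continuous f -> compact A -> compact (f @` A).
Proof.
by move=> cf cA; apply: continuous_compact => //; exact: continuous_subspaceT.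
Qed.

Lemma compact_msum n (A B : set 'rV[R]_n) : compact A -> compact B -> compact (msum A B).
Proof.
move=> cA cB; rewrite (_ : msum A B = (fun p : 'rV[R]_n * 'rV[R]_n => p.1 + p.2) @` (A `*` B)).
  apply: continuous_compact; last exact: compact_setX.
  by apply: continuous_subspaceT => p; apply: cvgD; [exact: cvg_fst|exact: cvg_snd].
apply/seteqP; split => z /=; first by move=> [x Ax [y By <-]]; exists (x, y).
by move=> [[x y] [/= Ax By] <-]; exists x => //; exists y.
Qed.

Lemma compact_scale n (a : R) (A : set 'rV[R]_n) : compact A -> compact (( *:%R a) @` A).
Proof. by move=> cA; apply: compact_image => // x; apply: scaler_continuous. Qed.

Lemma cvx_msum n (A B : set 'rV[R]_n) : cvx A -> cvx B -> cvx (msum A B).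
Proof.
move=> cA cB a b _ _ a0 b0 ab [x1 Ax1 [y1 By1 <-]] [x2 Ax2 [y2 By2 <-]].
exists (a *: x1 + b *: x2); first exact: cA.
by exists (a *: y1 + b *: y2); [exact: cB|rewrite !scalerDr addrACA].
Qed.

Lemma cvx_scale n c (A : set 'rV[R]_n) : cvx A -> cvx (( *:%R c) @` A).
Proof.
move=> cA a b _ _ a0 b0 ab [x Ax <-] [y Ay <-].
by exists (a *: x + b *: y); [exact: cA|rewrite scalerDr !scalerA !(mulrC c)].
Qed.

Lemma compact_box n (A : set 'rV[R]_n) (M : R) : closed A ->
  (forall v, A v -> forall i, `|v ord0 i| <= M) -> compact A.
Proof.
move=> cA HM; apply: bounded_closed_compact => //; exists `|M|; split => //.
move=> N MN v Av /=; rewrite [leLHS]/Num.Def.normr/= mx_normrE.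
apply: bigmax_le; first by rewrite (le_trans _ (ltW MN)).
move=> [i j] _; rewrite ord1 (le_trans (HM v Av j))//.
by rewrite (le_trans (ler_norm _))// ltW.
Qed.

Lemma compact_closedrV n (A : set 'rV[R]_n) : compact A -> closed A.
Proof. by apply: compact_closed; exact: norm_hausdorff. Qed.

Lemma compact_section n (A : set 'rV[R]_n.+1) x : compact A -> compact (section A x).
Proof.
move=> cA; have [M M0 HM] := compact_rV_bounded cA.
apply: (@compact_box _ _ M); first exact: (closed_section (compact_closedrV cA)).
by move=> v Av i; rewrite -(cons_rVS x v); apply: HM.
Qed.

Lemma cvx_section n (A : set 'rV[R]_n.+1) x : cvx A -> cvx (section A x).
Proof.
move=> cA a b u v a0 b0 ab Au Av; rewrite /section/=.
have := cA a b _ _ a0 b0 ab Au Av.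
by rewrite !cons_rVZ cons_rVD -mulrDl ab mul1r.
Qed.

Lemma continuous_sumR (T : topologicalType) n (f : 'I_n -> T -> R) :
  (forall i, continuous (f i)) -> continuous (fun t => \sum_i f i t).
Proof.
move=> cf; apply: (@continuous_big R 'I_n +%R 0 xpredT) => [|i _]; last exact: cf.
exact: add_continuous.
Qed.

Lemma continuous_sqr_dot n : continuous (fun x : 'rV[R]_n => dot x x).
Proof.
apply: continuous_sumR => i x.
exact: (cvgM (@coord_continuous R 1 n ord0 i x) (@coord_continuous R 1 n ord0 i x)).
Qed.

Lemma continuous_enorm n : continuous (@enorm n).
Proof.
move=> x; apply: (continuous_comp (@continuous_sqr_dot n x)).
exact: sqrt_continuous.
Qed.

Lemma compact_ball n : compact (euclidean_ball R n).
Proof.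
apply: (@compact_box _ _ 1).
  rewrite (_ : euclidean_ball R n = @enorm n @^-1` [set r | r <= 1]).
    by apply: preimage_closed; [move=> x _; exact: continuous_enorm|exact: closed_le].
  by apply/seteqP; split => x /=; rewrite euclidean_ballE.
by move=> v /euclidean_ballE v1 i; rewrite (le_trans (coord_le_enorm _ _)).
Qed.

Lemma cvx_ball n : cvx (euclidean_ball R n).
Proof.
move=> a b x y a0 b0 ab /euclidean_ballE x1 /euclidean_ballE y1.
apply/euclidean_ballE; rewrite (le_trans (enormD _ _))// !enormZ !ger0_norm//.
by rewrite -ab lerD// ler_piMr.
Qed.

Lemma parallel_setE n (A : set 'rV[R]_n) t :
  parallel_set A t = msum A (( *:%R t) @` euclidean_ball R n).
Proof.
apply/seteqP; split => z /=.
  by move=> [x Ax [b Bb <-]]; exists x => //; exists (t *: b) => //; exists b.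
by move=> [x Ax [_ [b Bb <-] <-]]; exists x => //; exists b.
Qed.

Lemma parallel_set_enorm n (A : set 'rV[R]_n) t z : 0 <= t ->
  parallel_set A t z <-> exists2 x, A x & enorm (z - x) <= t.
Proof.
move=> t0; split => [[x Ax [b /euclidean_ballE Bb <-]]|[x Ax zx]].
  exists x => //; rewrite addrAC subrr add0r enormZ ger0_norm//.
  by rewrite ler_piMr.
exists x => //; have [t00|tn0] := eqVneq t 0.
  exists 0; first by apply/euclidean_ballE; rewrite enorm0.
  have : enorm (z - x) == 0 by rewrite eq_le enorm_ge0 andbT -t00.
  by rewrite enorm_eq0 subr_eq0 => /eqP ->; rewrite scaler0 addr0.
exists (t^-1 *: (z - x)).
  apply/euclidean_ballE; rewrite enormZ ger0_norm ?invr_ge0//.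
  by rewrite mulrC ler_pdivrMr ?mul1r// lt_neqAle eq_sym tn0.
by rewrite scalerA divff// scale1r addrC subrK.
Qed.

Lemma compact_parallel n (A : set 'rV[R]_n) t : compact A -> compact (parallel_set A t).
Proof.
move=> cA; rewrite parallel_setE; apply: compact_msum => //.
exact: (compact_scale (@compact_ball n)).
Qed.

Lemma cvx_parallel n (A : set 'rV[R]_n) t : cvx A -> cvx (parallel_set A t).
Proof.
move=> cA; rewrite parallel_setE; apply: cvx_msum => //.
exact: (cvx_scale (@cvx_ball n)).
Qed.

End convex_bodies.

(** * The Brunn-Minkowski inequality *)

Section prekopa_line.
Variable R : realType.
Local Notation leb := (@lebesgue_measure R).
Implicit Types (F G H : R -> R).

Definition level F (s : R) : set (measurableTypeR R) := [set x | s <= F x].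

Let hypograph F : set (measurableTypeR R * measurableTypeR R) :=
  [set p | p.2 <= F p.1].

Let measurable_hypograph F : measurable_fun [set: measurableTypeR R] F ->
  measurable (hypograph F).
Proof.
move=> mF; rewrite -[X in measurable X]setTI.
rewrite (_ : hypograph F = (fun p : measurableTypeR R * measurableTypeR R =>
   (p.2 : R) <= F p.1) @^-1` [set true]); last first.
  by apply/seteqP; split => p.
apply: measurable_fun_ler => //.
exact: (measurableT_comp mF).
Qed.

Let hypograph_ysection F s : ysection (hypograph F) s = level F s.
Proof. by apply/seteqP; split => x; rewrite /ysection/= inE. Qed.

Lemma measurable_level F s : measurable_fun [set: measurableTypeR R] F ->
  measurable (level F s).
Proof.
move=> mF; rewrite -hypograph_ysection; apply: measurable_ysection.
exact: measurable_hypograph.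
Qed.

Lemma measurable_level_measure F : measurable_fun [set: measurableTypeR R] F ->
  measurable_fun [set: measurableTypeR R] (fun s => leb (level F s)).
Proof.
move=> mF; rewrite (_ : (fun _ => _) = leb \o ysection (hypograph F)).
  by apply: measurable_fun_ysection; exact: measurable_hypograph.
by apply/funext => s /=; rewrite hypograph_ysection.
Qed.

(** By Tonelli both sides are the area under the graph of F inside the strip 0 < s < 1. The cut at 1
    keeps only the levels below the supremum to which the functions of [prekopa_line] are
    normalized. *)
Lemma layer_cake F : measurable_fun [set: measurableTypeR R] F ->
  (forall x, 0 <= F x) ->
  (\int[leb]_x (Num.min (F x) 1)%:E = \int[leb]_(s in `]0%R, 1%R[) leb (level F s))%E.
Proof.
move=> mF F0.
pose E := hypograph F `&` (setT `*` [set` `]0%R, 1%R[]).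
have mE : measurable E.
  by apply: measurableI; [exact: measurable_hypograph|exact: measurableX].
have := @indic_fubini_tonelli _ _ _ _ R leb leb E mE.
rewrite indic_fubini_tonelli_FE// indic_fubini_tonelli_GE// => EE.
transitivity (\int[leb]_x (leb (xsection E x)))%E.
  apply: eq_integral => x _.
  have -> : xsection E x = [set` if F x < 1 then `]0, F x] else `]0, 1[].
    rewrite /xsection /E /hypograph.
    case: ifPn => F1; apply/seteqP; split => s; rewrite /= inE/= !in_itv/=.
    - by move=> [sF [_ /andP[s0 s1]]]; rewrite s0.
    - by move=> /andP[s0 s1]; split => //; split => //; rewrite s0 (le_lt_trans s1).
    - by move=> [_ []].
    - move=> /andP[s0 s1]; split; last by rewrite s0 s1.
      by rewrite (ltW (lt_le_trans s1 _))// leNgt.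
  rewrite minEle; case: ltP => F1; rewrite lebesgue_measure_itv/= lte_fin.
    rewrite ltW//; case: ltP => F00; first by rewrite -EFinB subr0.
    by congr EFin; apply/le_anti; rewrite F00 F0.
  rewrite ltr01 -EFinB subr0; case: leP => // F1'.
  by congr EFin; apply/le_anti; rewrite F1 F1'.
rewrite EE [RHS]integral_mkcond; apply: eq_integral => s _ /=.
rewrite patchE; case: ifPn => s01.
  congr leb; apply/seteqP; split => x; rewrite /ysection/= inE/=; first by case.
  by move=> sFx; split => //; split => //; exact: set_mem s01.
rewrite (_ : ysection E s = set0) ?measure0//.
apply/seteqP; split => // x; rewrite /ysection/= inE/= => -[_ [_ ?]].
by move/negP: s01; apply; exact: mem_set.
Qed.

Definition convex_line (A : set R) := forall a b x y, 0 <= a -> 0 <= b -> a + b = 1 ->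
  A x -> A y -> A (a * x + b * y).

(** A and B are no longer than the intervals between their infima and suprema, while C contains the
    open interval whose end points are the combinations of these infima and suprema. *)
Lemma brunn_minkowski_line (A B C : set (measurableTypeR R)) (a b M : R) :
  0 < a -> 0 < b -> a + b = 1 ->
  measurable A -> measurable B -> measurable C ->
  A !=set0 -> B !=set0 -> convex_line A -> convex_line B ->
  (forall x, A x -> `|x| <= M) -> (forall x, B x -> `|x| <= M) ->
  (forall x y, A x -> B y -> C (a * x + b * y)) ->
  (a%:E * leb A + b%:E * leb B <= leb C)%E.
Proof.
move=> a0 b0 ab mA mB mC A0 B0 cA cB AM BM ABC.
have hs (D : set R) : D !=set0 -> (forall x, D x -> `|x| <= M) -> has_sup D /\ has_inf D.
  move=> D0 DM; split; split => //.
    by exists M => x /DM; rewrite ler_norml => /andP[].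
  by exists (- M) => x /DM; rewrite ler_norml => /andP[].
have le_len (D : set (measurableTypeR R)) : measurable D -> D !=set0 ->
    (forall x, D x -> `|x| <= M) -> (leb D <= (sup D - inf D)%:E)%E.
  move=> mD D0 DM; have [sD iD] := hs D D0 DM.
  have DI : D `<=` [set` `[inf D, sup D]].
    move=> x Dx /=; rewrite in_itv/=; apply/andP; split.
      by apply: ge_inf => //; case: iD.
    by apply: ub_le_sup => //; case: sD.
  have /le_trans : (leb D <= leb [set` `[inf D, sup D]])%E by rewrite le_measure ?inE.
  apply.
  rewrite lebesgue_measure_itv/= lte_fin; case: ltP => //.
  by have [x Dx] := D0; have := DI _ Dx; rewrite /= in_itv/= => /andP[/le_trans H /H]; rewrite lee_fin subr_ge0.
have [sA iA] := hs A A0 AM; have [sB iB] := hs B B0 BM.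
pose lo := a * inf A + b * inf B; pose hi := a * sup A + b * sup B.
apply: (@le_trans _ _ (hi - lo)%:E).
  apply: (@le_trans _ _ (a%:E * (sup A - inf A)%:E + b%:E * (sup B - inf B)%:E)%E).
    have a0' : (0 <= a%:E)%E by rewrite lee_fin ltW.
    have b0' : (0 <= b%:E)%E by rewrite lee_fin ltW.
    by apply: leeD; apply: lee_wpmul2l => //; apply: le_len.
  by rewrite -!EFinM -EFinD lee_fin /hi /lo; lra.
(* z lies between a combination z1 of points near the infima and a combination z2 of points near the
   suprema. The weights u and t that express z by z1 and z2 are then used inside A and inside B. *)
have ICz (z : R) : lo < z -> z < hi -> C z.
  move=> zlo zhi.
  pose e1 := z - lo; pose e2 := hi - z.
  have e10 : 0 < e1 by rewrite subr_gt0.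
  have e20 : 0 < e2 by rewrite subr_gt0.
  have [x1 Ax1 hx1] := inf_adherent e10 iA.
  have [y1 By1 hy1] := inf_adherent e10 iB.
  have [x2 Ax2 hx2] := sup_adherent e20 sA.
  have [y2 By2 hy2] := sup_adherent e20 sB.
  pose z1 := a * x1 + b * y1; pose z2 := a * x2 + b * y2.
  have z1z : z1 < z.
    have : a * x1 < a * (inf A + e1) by rewrite ltr_pM2l.
    have : b * y1 < b * (inf B + e1) by rewrite ltr_pM2l.
    have : a * e1 + b * e1 = e1 by rewrite -mulrDl ab mul1r.
    by rewrite /z1 /e1 /lo; lra.
  have z2z : z < z2.
    have : a * (sup A - e2) < a * x2 by rewrite ltr_pM2l.
    have : b * (sup B - e2) < b * y2 by rewrite ltr_pM2l.
    have : a * e2 + b * e2 = e2 by rewrite -mulrDl ab mul1r.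
    by rewrite /z2 /e2 /hi; lra.
  have d0 : 0 < z2 - z1 by lra.
  pose t := (z - z1) / (z2 - z1); pose u := (z2 - z) / (z2 - z1).
  have t0 : 0 <= t by rewrite divr_ge0//; lra.
  have u0 : 0 <= u by rewrite divr_ge0//; lra.
  have ut : u + t = 1 by rewrite /u /t; field; rewrite gt_eqF.
  have -> : z = a * (u * x1 + t * x2) + b * (u * y1 + t * y2).
    have -> : a * (u * x1 + t * x2) + b * (u * y1 + t * y2) = u * z1 + t * z2.
      by rewrite /z1 /z2; ring.
    by rewrite /u /t; field; rewrite gt_eqF.
  by apply: ABC; [exact: cA|exact: cB].
have IC : [set` `]lo, hi[] `<=` C.
  by move=> z; rewrite /= in_itv/= => /andP[zlo zhi]; apply: ICz.
apply: (@le_trans _ _ (leb [set` `]lo, hi[])); last by rewrite le_measure ?inE.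
rewrite lebesgue_measure_itv/= lte_fin; case: ltP => //.
by rewrite lee_fin subr_le0.
Qed.

(** The level set of H at height s contains the combinations of those of F and G, so the inequality
    on the line can be integrated over 0 < s < 1. The suprema of F and G being 1, the two level sets
    are nonempty for all these s, and an arithmetic mean of the integrals results. *)
Lemma prekopa_line F G H (a b M : R) : 0 < a -> 0 < b -> a + b = 1 ->
  measurable_fun [set: measurableTypeR R] F ->
  measurable_fun [set: measurableTypeR R] G ->
  measurable_fun [set: measurableTypeR R] H ->
  (forall x, 0 <= F x <= 1) -> (forall x, 0 <= G x <= 1) -> (forall x, 0 <= H x) ->
  (forall s : R, s < 1 -> exists x, s < F x) -> (forall s : R, s < 1 -> exists x, s < G x) ->
  (forall s : R, 0 < s -> convex_line (level F s)) ->
  (forall s : R, 0 < s -> convex_line (level G s)) ->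
  (forall x, F x != 0 -> `|x| <= M) -> (forall x, G x != 0 -> `|x| <= M) ->
  (forall x y, Num.min (F x) (G y) <= H (a * x + b * y)) ->
  (a%:E * \int[leb]_x (F x)%:E + b%:E * \int[leb]_x (G x)%:E <=
   \int[leb]_x (H x)%:E)%E.
Proof.
move=> a0 b0 ab mF mG mH F01 G01 H0 F1 G1 cF cG FM GM FGH.
have lc (K : R -> R) : measurable_fun [set: measurableTypeR R] K -> (forall x, 0 <= K x <= 1) ->
    (\int[leb]_x (K x)%:E = \int[leb]_(s in `]0%R, 1%R[) leb (level K s))%E.
  move=> mK K01; rewrite -layer_cake//; last by move=> x; case/andP: (K01 x).
  by apply: eq_integral => x _; rewrite min_l//; case/andP: (K01 x).
rewrite (lc F)// (lc G)//.
apply: (@le_trans _ _ (\int[leb]_(s in `]0%R, 1%R[) leb (level H s))%E); last first.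
  rewrite -layer_cake//; apply: ge0_le_integral => //.
  - by move=> x _; rewrite lee_fin le_min H0 ler01.
  - by apply/measurable_EFinP; apply: measurable_minr.
  - by apply/measurable_EFinP.
  - by move=> x _; rewrite lee_fin ge_min lexx.
have ml (K : R -> R) : measurable_fun [set: measurableTypeR R] K ->
    measurable_fun ([set` `]0%R, 1%R[] : set (measurableTypeR R)) (fun s => leb (level K s)).
  by move=> mK; apply: measurable_funTS; exact: measurable_level_measure.
have a0' : (0 <= a%:E)%E by rewrite lee_fin ltW.
have b0' : (0 <= b%:E)%E by rewrite lee_fin ltW.
rewrite -!ge0_integralZl//; try exact: ml.
rewrite -ge0_integralD//; last 4 first.
- by move=> s _; rewrite mule_ge0.
- by apply: measurable_funeM; exact: ml.
- by move=> s _; rewrite mule_ge0.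
- by apply: measurable_funeM; exact: ml.
apply: ge0_le_integral => //.
- by move=> s _; rewrite adde_ge0// mule_ge0.
- by apply: emeasurable_funD; apply: measurable_funeM; exact: ml.
- exact: ml.
move=> s; rewrite /= in_itv/= => /andP[s0 s1].
apply: (@brunn_minkowski_line _ _ _ _ _ M) => //; try exact: measurable_level.
- by have [x /ltW] := F1 s s1; exists x.
- by have [x /ltW] := G1 s s1; exists x.
- exact: cF.
- exact: cG.
- by move=> x /= sx; apply: FM; rewrite gt_eqF// (lt_le_trans s0).
- by move=> x /= sx; apply: GM; rewrite gt_eqF// (lt_le_trans s0).
- move=> x y /= sx sy; rewrite /level/= (le_trans _ (FGH x y))// le_min sx sy//.
Qed.

End prekopa_line.

(** * Brunn-Minkowski in all dimensions, by induction on sections *)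

Section brunn_minkowski.
Variable R : realType.
Local Notation leb := (@lebesgue_measure R).

(** Young's inequality for x^a and y^b with the conjugate exponents 1/a and 1/b. *)
Lemma powR_am_gm (x y a b : R) : 0 <= x -> 0 <= y -> 0 < a -> 0 < b -> a + b = 1 ->
  x `^ a * y `^ b <= a * x + b * y.
Proof.
move=> x0 y0 a0 b0 ab.
have := @conjugate_powR R (x `^ a) (y `^ b) a^-1 b^-1.
rewrite -!powRrM !divff ?gt_eqF// !powRr1// !invrK ![_ * a]mulrC ![_ * b]mulrC.
by apply; rewrite ?powR_ge0 ?invr_gt0.
Qed.

Lemma min_le_powR (x y a b : R) : 0 <= x -> 0 <= y -> 0 < a -> 0 < b -> a + b = 1 ->
  Num.min x y <= x `^ a * y `^ b.
Proof.
move=> x0 y0 a0 b0 ab; have m0 : 0 <= Num.min x y by rewrite le_min x0.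
have [m00|mn0] := eqVneq (Num.min x y) 0; first by rewrite m00 mulr_ge0// powR_ge0.
rewrite -[leLHS]powRr1// -ab powRD; last by rewrite ab oner_eq0.
have [a0' b0'] := (ltW a0, ltW b0).
by apply: ler_pM; rewrite ?powR_ge0//; apply: ge0_ler_powR;
  rewrite ?nnegrE ?ge_min ?lexx ?orbT.
Qed.

Lemma vol_set0 n : vol (set0 : set 'rV[R]_n) = 0%E.
Proof. by rewrite vol_leb_tuple ?preimage_set0 ?measure0//; apply: (borel_closed closed0). Qed.

(** By the induction hypothesis the section volumes of A, B and C satisfy the assumptions of
    [prekopa_line] once they are rescaled. C is any set that contains the combinations, because a
    section of the combined body can be larger than the combination of two sections. *)
Theorem brunn_minkowski n (A B C : set 'rV[R]_n) (a b : R) :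
  0 < a -> 0 < b -> a + b = 1 -> compact A -> compact B -> compact C ->
  cvx A -> cvx B -> A !=set0 -> B !=set0 ->
  (forall x y, A x -> B y -> C (a *: x + b *: y)) ->
  fine (vol A) `^ a * fine (vol B) `^ b <= fine (vol C).
Proof.
elim: n A B C a b => [|n IH] A B C a b a0 b0 ab kA kB kC cA cB A0 B0 ABC.
  have vol0 (D : set 'rV[R]_0) : D !=set0 -> vol D = 1%:E.
    by move=> [x Dx]; rewrite /= indicE mem_set// -[0](thinmx0 x).
  rewrite !vol0 ?powR1 ?mulr1//.
  by have [[x Ax] [y By]] := (A0, B0); exists (a *: x + b *: y); exact: ABC.
pose v (D : set 'rV[R]_n.+1) x := fine (vol (section D x)).
have vE (D : set 'rV[R]_n.+1) (x : R) : compact D -> vol (section D x) = (v D x)%:E.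
  by move=> kD; rewrite fineK// vol_fin//; exact: compact_section.
have volE (D : set 'rV[R]_n.+1) : compact D -> vol D = (\int[leb]_x (v D x)%:E)%E.
  by move=> kD; rewrite volS; apply: eq_integral => x _; rewrite vE.
have v0 (D : set 'rV[R]_n.+1) (x : R) : 0 <= v D x by rewrite fine_ge0// vol_ge0.
have mv (D : set 'rV[R]_n.+1) : compact D -> measurable_fun [set: measurableTypeR R] (v D).
  move=> kD; apply/measurable_EFinP.
  rewrite (_ : _ \o _ = (fun x => vol (section D x))).
    by apply: measurable_vol_section; exact: borel_compact.
  by apply/funext => x /=; rewrite vE.
have vn0 (D : set 'rV[R]_n.+1) (x : R) : v D x != 0 -> section D x !=set0.
  by move=> vx; apply/set0P; apply: contra_neq vx => sD0; rewrite /v sD0 vol_set0.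
have vbd (D : set 'rV[R]_n.+1) : compact D -> exists2 M : R, 0 <= M & (forall x, v D x <= M) /\ (forall x, v D x != 0 -> `|x| <= M).
  move=> kD; have [M M0 HM] := compact_rV_bounded kD.
  exists (Num.max M ((M *+ 2) ^+ n)); first by rewrite le_max M0.
  split => x.
    rewrite le_max; apply/orP; right; rewrite -lee_fin -vE//.
    apply: vol_le_box => //; first exact: (borel_section _ (borel_compact kD)).
    by move=> u Du i; rewrite -(cons_rVS x u); apply: HM.
  move=> /vn0[u Du]; rewrite le_max; apply/orP; left.
  by have := HM _ Du ord0; rewrite cons_rV0.
have [MA MA0 [vAM sAM]] := vbd A kA.
have [MB MB0 [vBM sBM]] := vbd B kB.
pose m (D : set 'rV[R]_n.+1) : R := sup (range (v D)).
have hs (D : set 'rV[R]_n.+1) : compact D -> has_sup (range (v D)).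
  move=> kD; have [M _ [HM _]] := vbd D kD.
  by split; [exists (v D 0), 0|exists M => _ [x _ <-]].
have vm (D : set 'rV[R]_n.+1) (x : R) : compact D -> v D x <= m D.
  by move=> kD; apply: ub_le_sup; [case: (hs D kD)|exists x].
have m0 (D : set 'rV[R]_n.+1) : compact D -> 0 <= m D by move=> kD; rewrite (le_trans (v0 D 0))// vm.
have vol0 (D : set 'rV[R]_n.+1) : compact D -> m D = 0 -> fine (vol D) = 0.
  move=> kD mD; rewrite volE// integral0_eq// => x _; congr EFin.
  by apply/le_anti; rewrite v0 andbT -mD vm.
have [mA0|mA0] := eqVneq (m A) 0.
  by rewrite (vol0 A)// powR0 ?gt_eqF// mul0r fine_ge0// vol_ge0.
have [mB0|mB0] := eqVneq (m B) 0.
  by rewrite (vol0 B)// powR0 ?gt_eqF// mulr0 fine_ge0// vol_ge0.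
have mAp : 0 < m A by rewrite lt_neqAle eq_sym mA0 m0.
have mBp : 0 < m B by rewrite lt_neqAle eq_sym mB0 m0.
(* With this constant F^a G^b <= H is the induction hypothesis for sections; at the end it cancels
   the denominators of F and G. *)
pose mm := m A `^ a * m B `^ b.
have mmp : 0 < mm by rewrite mulr_gt0// powR_gt0.
pose F x := v A x / m A; pose G x := v B x / m B; pose H x := v C x / mm.
have F0 x : 0 <= F x by rewrite divr_ge0// ltW.
have G0 x : 0 <= G x by rewrite divr_ge0// ltW.
have vABC x y : v A x `^ a * v B y `^ b <= v C (a * x + b * y).
  have [->|/vn0 Ax0] := eqVneq (v A x) 0; first by rewrite powR0 ?gt_eqF// mul0r.
  have [->|/vn0 By0] := eqVneq (v B y) 0; first by rewrite powR0 ?gt_eqF// mulr0.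
  apply: IH => //; try exact: compact_section; try exact: cvx_section.
  move=> u w Au Bw; have := ABC _ _ Au Bw.
  by rewrite !cons_rVZ cons_rVD.
have FGH x y : Num.min (F x) (G y) <= H (a * x + b * y).
  rewrite (le_trans (min_le_powR (F0 x) (G0 y) a0 b0 ab))//.
  by rewrite /H ler_pdivlMr// /mm mulrACA -!powRM// ?m0// /F /G !divfK.
(* The induction hypothesis for two sections of one body bounds an intermediate section from below
   by the smaller of the two. It asks for positive weights, so the weights 0 and 1 are split off. *)
have conv (D : set 'rV[R]_n.+1) : compact D -> cvx D -> forall s : R, 0 < s -> convex_line (level (fun x => v D x / m D) s).
  move=> kD cD s s0 p q x y p0 q0 pq; rewrite /level/= => sx sy.
  have [p00|pn0] := eqVneq p 0; first by rewrite p00 mul0r add0r (_ : q = 1) ?mul1r//; lra.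
  have [q00|qn0] := eqVneq q 0; first by rewrite q00 mul0r addr0 (_ : p = 1) ?mul1r//; lra.
  have pp : 0 < p by rewrite lt_neqAle eq_sym pn0.
  have qp : 0 < q by rewrite lt_neqAle eq_sym qn0.
  have mD : 0 < m D.
    rewrite lt_neqAle m0// andbT eq_sym; apply: contraTneq sx => ->.
    by rewrite invr0 mulr0 -ltNge.
  move: sx sy; rewrite !ler_pdivlMr// => sx sy.
  have vx : v D x != 0 by rewrite gt_eqF// (lt_le_trans _ sx)// mulr_gt0.
  have vy : v D y != 0 by rewrite gt_eqF// (lt_le_trans _ sy)// mulr_gt0.
  apply: (@le_trans _ _ (Num.min (v D x) (v D y))); first by rewrite le_min sx.
  rewrite (le_trans (min_le_powR (v0 D x) (v0 D y) pp qp pq))//.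
  apply: IH => //; try exact: compact_section; try exact: cvx_section; try exact: vn0.
  move=> u w Au Bw; have := cD p q _ _ p0 q0 pq Au Bw.
  by rewrite !cons_rVZ cons_rVD.
have supr (D : set 'rV[R]_n.+1) : compact D -> 0 < m D -> forall s : R, s < 1 -> exists x, s < v D x / m D.
  move=> kD mD s s1; have e0 : 0 < m D * (1 - s) by rewrite mulr_gt0// subr_gt0.
  have [_ [x _ <-] Hx] := sup_adherent e0 (hs D kD).
  exists x; rewrite ltr_pdivlMr//; apply: le_lt_trans Hx; rewrite -/(m D); lra.
have le1 (D : set 'rV[R]_n.+1) (x : R) : compact D -> 0 < m D -> v D x / m D <= 1.
  by move=> kD mD; rewrite ler_pdivrMr// mul1r vm.
have := @prekopa_line R F G H a b (Num.max MA MB) a0 b0 ab.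
have mdiv (D : set 'rV[R]_n.+1) (c : R) : compact D -> measurable_fun [set: measurableTypeR R] (fun x => v D x / c).
  by move=> kD; apply: measurable_funM => //; exact: mv.
move=> /(_ (mdiv A _ kA) (mdiv B _ kB) (mdiv C _ kC)) PL.
have {}PL : (a%:E * \int[leb]_x (F x)%:E + b%:E * \int[leb]_x (G x)%:E <=
   \int[leb]_x (H x)%:E)%E.
  apply: PL => //.
  - by move=> x; rewrite F0 le1.
  - by move=> x; rewrite G0 le1.
  - by move=> x; rewrite divr_ge0// ltW.
  - exact: supr.
  - exact: supr.
  - exact: conv.
  - exact: conv.
  - by move=> x; rewrite mulf_eq0 negb_or => /andP[/sAM ? _]; rewrite le_max; apply/orP; left.
  - by move=> x; rewrite mulf_eq0 negb_or => /andP[/sBM ? _]; rewrite le_max; apply/orP; right.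
have intE (D : set 'rV[R]_n.+1) (c : R) : 0 <= c -> compact D -> (\int[leb]_x (v D x / c)%:E = (fine (vol D) / c)%:E)%E.
  move=> c0 kD; under eq_integral do rewrite EFinM.
  rewrite ge0_integralZr//; first by rewrite -volE// EFinM fineK// vol_fin.
  - by apply/measurable_EFinP; exact: mv.
  - by move=> x _; rewrite lee_fin.
  - by rewrite lee_fin invr_ge0.
move: PL; rewrite !intE ?(ltW mAp) ?(ltW mBp) ?(ltW mmp)// -!EFinM -EFinD lee_fin.
set p := fine _ / m A; set q := fine _ / m B => PL.
have p0 : 0 <= p by rewrite divr_ge0 ?(ltW mAp)// fine_ge0// vol_ge0.
have q0 : 0 <= q by rewrite divr_ge0 ?(ltW mBp)// fine_ge0// vol_ge0.
(* The arithmetic mean of the normalized volumes dominates the geometric one. *)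
have := le_trans (powR_am_gm p0 q0 a0 b0 ab) PL.
rewrite ler_pdivlMr// /mm mulrACA -!powRM ?m0//.
by rewrite /p /q !divfK.
Qed.

End brunn_minkowski.

(** * Surface area and exponential growth *)

Section log_concave_slopes.
Variable R : realType.

(** The inequality exp x >= 1 + x, at x and at -x, puts the quotient between [rho t] and
    [rho t * expR (t * rho t)]. *)
Lemma slope_expR_cvg (rho : R -> R) (l : R) :
  rho t @[t --> 0^'+] --> l -> (expR (t * rho t) - 1) / t @[t --> 0^'+] --> l.
Proof.
move=> rl.
have tr0 : t * rho t @[t --> 0^'+] --> 0 * l.
  by apply: cvgM => //; apply: cvg_at_right_filter; exact: cvg_id.
have etr : rho t * expR (t * rho t) @[t --> 0^'+] --> l.
  have : expR (t * rho t) @[t --> 0^'+] --> expR (0 * l).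
    by apply: (cvg_comp _ _ tr0); apply: continuous_expR.
  by rewrite mul0r expR0 => /(cvgM rl); rewrite mulr1.
apply: (squeeze_cvgr _ rl etr); near=> t.
have t0 : 0 < t by near: t; exact: nbhs_right_gt.
rewrite ler_pdivlMr// ler_pdivrMr//; apply/andP; split.
  by have := expR_ge1Dx (t * rho t); lra.
have H := expR_ge1Dx (- (t * rho t)).
have e0 := expR_gt0 (t * rho t).
have : expR (t * rho t) * (1 + - (t * rho t)) <= 1.
  by rewrite -[leRHS]expR0 -(subrr (t * rho t)) expRD ler_pM2l.
set E := expR _; set x := rho t; nra.
Unshelve. all: by end_near. Qed.

Lemma ln_powRM (x y a b : R) : 0 < x -> 0 < y ->
  ln (x `^ a * y `^ b) = a * ln x + b * ln y.
Proof. by move=> x0 y0; rewrite lnM ?posrE ?powR_gt0// !ln_powR. Qed.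

Lemma le_ln_powR (x y z a b : R) : 0 < x -> 0 < y -> x `^ a * y `^ b <= z ->
  a * ln x + b * ln y <= ln z.
Proof.
move=> x0 y0 H; rewrite -ln_powRM// ler_ln// posrE ?mulr_gt0 ?powR_gt0//.
by apply: lt_le_trans H; rewrite mulr_gt0 ?powR_gt0.
Qed.

(* V and W stand for the volumes of the outer and inner parallel bodies, and q for
   the difference quotient in the definition of the Minkowski content. *)
Lemma log_concave_slopes (V W q : R -> R) (V0 r : R) :
  0 < V0 -> 0 < r ->
  (forall t : R, 0 < t -> V0 <= V t) ->
  (forall t : R, 0 < t -> t <= r -> 0 < W t) ->
  (forall t : R, 0 < t -> t <= r -> W t <= V0) ->
  (forall s t a b : R, 0 < s -> s < t -> 0 < a -> 0 < b -> a + b = 1 -> s = b * t ->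
     V0 `^ a * V t `^ b <= V s) ->
  (forall s t a b : R, 0 < s -> s < t -> t <= r -> 0 < a -> 0 < b -> a + b = 1 -> s = b * t ->
     V0 `^ a * W t `^ b <= W s) ->
  (forall s t a b : R, 0 < s -> 0 < t -> t <= r -> 0 < a -> 0 < b -> a + b = 1 ->
     a * s = b * t -> V s `^ a * W t `^ b <= V0) ->
  (forall t t' : R, 0 < t -> t < t' -> t' <= r ->
     V t - W t <= q t * (2 * t) <= V t - W t') ->
  exists2 sg : R, q t @[t --> 0^'+] --> sg * V0 & 0 <= sg /\ forall t : R, 0 < t -> V t <= V0 * expR (sg * t).
Proof.
move=> V0p r0 V0V W0 WV0 HV HW HVW Hq.
have Vp (t : R) : 0 < t -> 0 < V t by move=> /V0V; exact: lt_le_trans.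
(* These are the slopes of the logarithm to the right of 0 and, with W placed at negative arguments,
   to the left. Concavity makes [rho] nonincreasing and [ell] nondecreasing in t, with every [rho]
   below every [ell]. *)
pose rho t := (ln (V t) - ln V0) / t.
pose ell t := (ln V0 - ln (W t)) / t.
have rho_noninc (s t : R) : 0 < s -> s < t -> rho t <= rho s.
  move=> s0 st; have t0 : 0 < t by rewrite (lt_trans s0).
  have st1 : s / t < 1 by rewrite ltr_pdivrMr ?mul1r.
  have := HV s t (1 - s / t) (s / t) s0 st; rewrite subrK divfK ?gt_eqF//.
  rewrite subr_gt0 st1 divr_gt0// => /(_ isT isT erefl erefl).
  move/(le_ln_powR V0p (Vp _ t0)) => H.
  rewrite /rho ler_pdivrMr// mulrAC ler_pdivlMr//.
  move: H; set x := ln V0; set y := ln (V t); set z := ln (V s) => H.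
  have : t * ((1 - s / t) * x + s / t * y) <= t * z by rewrite ler_pM2l.
  have -> : t * ((1 - s / t) * x + s / t * y) = (t - s) * x + s * y by field; rewrite gt_eqF.
  lra.
have ell_nondec (s t : R) : 0 < s -> s < t -> t <= r -> ell s <= ell t.
  move=> s0 st tr; have t0 : 0 < t by rewrite (lt_trans s0).
  have st1 : s / t < 1 by rewrite ltr_pdivrMr ?mul1r.
  have := HW s t (1 - s / t) (s / t) s0 st tr; rewrite subrK divfK ?gt_eqF//.
  rewrite subr_gt0 st1 divr_gt0// => /(_ isT isT erefl erefl).
  move/(le_ln_powR V0p (W0 _ t0 tr)) => H.
  rewrite /ell ler_pdivrMr// mulrAC ler_pdivlMr//.
  move: H; set x := ln V0; set y := ln (W t); set z := ln (W s) => H.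
  have : t * ((1 - s / t) * x + s / t * y) <= t * z by rewrite ler_pM2l.
  have -> : t * ((1 - s / t) * x + s / t * y) = (t - s) * x + s * y by field; rewrite gt_eqF.
  lra.
have rho_ell (s t : R) : 0 < s -> 0 < t -> t <= r -> rho s <= ell t.
  move=> s0 t0 tr; have st0 : 0 < s + t by rewrite addr_gt0.
  have := HVW s t (t / (s + t)) (s / (s + t)) s0 t0 tr.
  rewrite !divr_gt0// -mulrDl addrC divff ?gt_eqF// => /(_ isT isT erefl).
  rewrite mulrAC (mulrC t) [in X in _ = X -> _]mulrAC => /(_ erefl).
  move/(le_ln_powR (Vp _ s0) (W0 _ t0 tr)) => H.
  rewrite /ell /rho ler_pdivrMr// mulrAC ler_pdivlMr//.
  move: H; set x := ln V0; set y := ln (W t); set z := ln (V s) => H.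
  have : (s + t) * (t / (s + t) * z + s / (s + t) * y) <= (s + t) * x by rewrite ler_pM2l.
  have -> : (s + t) * (t / (s + t) * z + s / (s + t) * y) = t * z + s * y by field; rewrite gt_eqF.
  lra.
have rho0 (t : R) : 0 < t -> 0 <= rho t.
  by move=> t0; rewrite divr_ge0 ?(ltW t0)// subr_ge0 ler_ln ?posrE ?V0V ?Vp.
have rho_ub : has_ubound (rho @` `]0, +oo[).
  exists (ell r) => _ [t + <-]; rewrite /= in_itv/= andbT => t0.
  exact: rho_ell.
have ell_lb : has_lbound (ell @` `]0, r]).
  exists 0 => _ [t + <-]; rewrite /= in_itv/= => /andP[t0 tr].
  by rewrite (le_trans (rho0 t t0))// rho_ell.
pose lp := sup (rho @` `]0, +oo[); pose lm := inf (ell @` `]0, r]).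
have rhoc : rho t @[t --> 0^'+] --> lp.
  apply: (nonincreasing_at_right_cvgr (b := +oo%O)) => //.
  move=> s t; rewrite !in_itv/= !andbT => s0 t0.
  by rewrite le_eqVlt => /predU1P[->//|st]; exact: rho_noninc.
have ellc : ell t @[t --> 0^'+] --> lm.
  apply: (nondecreasing_at_right_cvgr (b := BRight r)) => //.
  move=> s t; rewrite !in_itv/= => /andP[s0 sr] /andP[t0 tr].
  by rewrite le_eqVlt => /predU1P[->//|st]; exact: ell_nondec.
have lp_ub (t : R) : 0 < t -> rho t <= lp.
  by move=> t0; apply: ub_le_sup => //; exists t => //=; rewrite in_itv/= t0.
have lplm : lp <= lm.
  apply: sup_le_ub; first by exists (rho r), r => //=; rewrite in_itv/= r0.
  move=> _ [s + <-]; rewrite /= in_itv/= andbT => s0.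
  apply: lb_le_inf; first by exists (ell r), r => //=; rewrite in_itv/= r0 lexx.
  move=> _ [t + <-]; rewrite /= in_itv/= => /andP[t0 tr].
  exact: rho_ell.
have lp0 : 0 <= lp by rewrite (le_trans (rho0 r r0))// lp_ub.
(* The content divides the volume gained outside plus the volume lost inside by 2 t, so it averages
   the two rates. The exponential bound follows from [rho t <= lp <= sg]. *)
pose sg := (lp + lm) / 2.
have Vsl : (V t - V0) / t @[t --> 0^'+] --> V0 * lp.
  have H := cvgM (cvg_cst V0) (slope_expR_cvg rhoc); apply: cvg_trans (H _ _).
  apply: near_eq_cvg; near=> t.
  have t0 : 0 < t by near: t; exact: nbhs_right_gt.
  rewrite /= (_ : t * rho t = ln (V t) - ln V0); last by rewrite /rho; field; rewrite gt_eqF.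
  rewrite expRB !lnK ?posrE ?Vp//.
  by field; rewrite !gt_eqF.
have Wsl : (V0 - W t) / t @[t --> 0^'+] --> V0 * lm.
  have H := cvgM (cvg_cst (- V0)) (slope_expR_cvg (cvgN ellc)); rewrite -mulrNN; apply: cvg_trans (H _ _ _).
  apply: near_eq_cvg; near=> t.
  have t0 : 0 < t by near: t; exact: nbhs_right_gt.
  have tr : t <= r by near: t; exact: nbhs_right_le.
  rewrite /= (_ : t * - ell t = ln (W t) - ln V0); last by rewrite /ell; field; rewrite gt_eqF.
  rewrite expRB !lnK ?posrE ?W0//.
  by field; rewrite !gt_eqF.
(* The upper estimate of q asks for an inner radius strictly above t. With t (1 + t) the ratio to t
   tends to 1, so the limit is not affected. *)
have t1t : t * (1 + t) @[t --> 0^'+] --> (0 : R)^'+.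
  have t1 : t * (1 + t) @[t --> 0^'+] --> (0 * (1 + 0) : R).
    by apply: cvg_at_right_filter; apply: cvgM => //; apply: cvgD => //; exact: cvg_cst.
  rewrite mul0r in t1; move=> P HP0.
  have HP : \forall t \near (0 : R)^'+, 0 < t * (1 + t) -> P (t * (1 + t)) by exact: (t1 _ HP0).
  suff : \forall t \near (0 : R)^'+, P (t * (1 + t)) by [].
  near=> t.
  have t0 : 0 < t by near: t; exact: nbhs_right_gt.
  have : 0 < t * (1 + t) by rewrite mulr_gt0// addr_gt0.
  by near: t.
exists sg; last first.
  split; first by rewrite divr_ge0// addr_ge0// (le_trans lp0).
  move=> t t0; rewrite -[V t]lnK ?posrE ?Vp// -[X in X * _]lnK ?posrE//.
  rewrite -expRD ler_expR -lerBlDl -ler_pdivrMr// (le_trans (lp_ub t t0))//.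
  by rewrite /sg; lra.
have lo : (V t - V0) / t / 2 + (V0 - W t) / t / 2 @[t --> 0^'+] --> sg * V0.
  have -> : sg * V0 = V0 * lp / 2 + V0 * lm / 2 by rewrite /sg; ring.
  by apply: cvgD; apply: cvgM => //; exact: cvg_cst.
have hi : (V t - V0) / t / 2 + (1 + t) * ((V0 - W (t * (1 + t))) / (t * (1 + t))) / 2
     @[t --> 0^'+] --> sg * V0.
  have -> : sg * V0 = V0 * lp / 2 + (1 + 0) * (V0 * lm) / 2 by rewrite /sg; ring.
  apply: cvgD; first by apply: cvgM => //; exact: cvg_cst.
  apply: cvgM; last exact: cvg_cst.
  apply: cvgM; last exact: (cvg_comp _ _ t1t Wsl).
  by apply: cvgD; [exact: cvg_cst|apply: cvg_at_right_filter; exact: cvg_id].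
apply: (squeeze_cvgr _ lo hi); near=> t.
have t0 : 0 < t by near: t; exact: nbhs_right_gt.
have tr : t * (1 + t) <= r.
  have t1 : t <= 1 by near: t; apply: nbhs_right_le.
  have t2 : t <= r / 2 by near: t; apply: nbhs_right_le; rewrite divr_gt0.
  by nra.
have tt : t < t * (1 + t) by rewrite ltr_pMr// ltrDl.
have /andP[h1 h2] := Hq t _ t0 tt tr.
have -> : (V t - V0) / t / 2 + (V0 - W t) / t / 2 = (V t - W t) / (2 * t).
  by field; rewrite gt_eqF.
rewrite ler_pdivrMr ?mulr_gt0// h1/=.
have -> : (V t - V0) / t / 2 + (1 + t) * ((V0 - W (t * (1 + t))) / (t * (1 + t))) / 2 =
    (V t - W (t * (1 + t))) / (2 * t).
  by field; rewrite !gt_eqF// addr_gt0.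
by rewrite ler_pdivlMr ?mulr_gt0.
Unshelve. all: by end_near. Qed.

End log_concave_slopes.

(** * Inner and outer parallel bodies *)

Section parallel_bodies.
Variables (R : realType) (n : nat).
Implicit Types (K A : set 'rV[R]_n) (x y z : 'rV[R]_n).

Definition inner_parallel K (t : R) : set 'rV[R]_n :=
  [set x | forall y, enorm (y - x) <= t -> K y].

Lemma inner_parallel_sub K (t : R) : 0 <= t -> inner_parallel K t `<=` K.
Proof. by move=> t0 x; apply; rewrite subrr enorm0. Qed.

Lemma compact_inner_parallel K (t : R) : 0 <= t -> compact K -> compact (inner_parallel K t).
Proof.
move=> t0 kK; apply: (subclosed_compact _ kK); last exact: inner_parallel_sub.
rewrite (_ : inner_parallel K t =
    \bigcap_(w in [set w | enorm w <= t]) [set x | K (x + w)]).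
  by apply: closed_bigI => w _; apply: closed_shift; exact: compact_closedrV.
apply/seteqP; split => x /= H.
  by move=> w wt; apply: H; rewrite addrAC subrr add0r.
by move=> y yt; rewrite -(subrK x y) addrC; exact: H.
Qed.

(** A displacement w of length at most a s + b t is (a s + b t) e with e in the unit ball; it is
    obtained by moving x by s e and y by t e. *)
Lemma cvx_inner_parallel_sum K (s t a b : R) x y : cvx K ->
  0 < a -> 0 < b -> a + b = 1 -> 0 <= s -> 0 <= t ->
  inner_parallel K s x -> inner_parallel K t y ->
  inner_parallel K (a * s + b * t) (a *: x + b *: y).
Proof.
move=> cK a0 b0 ab s0 t0 Kx Ky z.
set w := z - _ => wst.
have [d0|dn0] := eqVneq (a * s + b * t) 0.
  have w0 : w = 0.
    by apply/eqP; rewrite -enorm_eq0 eq_le enorm_ge0 andbT -d0.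
  have -> : z = a *: x + b *: y by apply/eqP; rewrite -subr_eq0 -/w w0.
  by apply: cK; rewrite ?(ltW a0) ?(ltW b0)//; apply: inner_parallel_sub (Kx) || apply: inner_parallel_sub (Ky).
have dp : 0 < a * s + b * t.
  by rewrite lt_neqAle eq_sym dn0 addr_ge0// mulr_ge0// ltW.
pose e : 'rV[R]_n := (a * s + b * t)^-1 *: w.
have e1 : enorm e <= 1.
  by rewrite enormZ ger0_norm ?invr_ge0 ?(ltW dp)// mulrC ler_pdivrMr// mul1r.
have we : (a * s + b * t) *: e = w by rewrite /e scalerA divff// scale1r.
have -> : z = a *: (x + s *: e) + b *: (y + t *: e).
  rewrite !scalerDr addrACA (scalerA a) (scalerA b) -scalerDl we.
  by rewrite /w addrC subrK.
apply: cK; rewrite ?(ltW a0) ?(ltW b0)//.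
  apply: Kx; rewrite addrAC subrr add0r enormZ ger0_norm//.
  by rewrite ler_piMr.
apply: Ky; rewrite addrAC subrr add0r enormZ ger0_norm//.
by rewrite ler_piMr.
Qed.

Lemma cvx_inner_parallel K (t : R) : 0 <= t -> cvx K -> cvx (inner_parallel K t).
Proof.
move=> t0 cK a b x y a0 b0 ab Kx Ky.
have [a00|an0] := eqVneq a 0.
  by rewrite a00 scale0r add0r (_ : b = 1) ?scale1r//; lra.
have [b00|bn0] := eqVneq b 0.
  by rewrite b00 scale0r addr0 (_ : a = 1) ?scale1r//; lra.
rewrite -[t]mul1r -ab mulrDl; apply: cvx_inner_parallel_sum => //.
  by rewrite lt_neqAle eq_sym an0.
by rewrite lt_neqAle eq_sym bn0.
Qed.

Lemma cvx_parallel_sum K (s t a b : R) x y : cvx K ->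
  0 < a -> 0 < b -> a + b = 1 -> 0 <= s -> 0 <= t ->
  parallel_set K s x -> parallel_set K t y ->
  parallel_set K (a * s + b * t) (a *: x + b *: y).
Proof.
move=> cK a0 b0 ab s0 t0 /(parallel_set_enorm _ _ s0)[k1 Kk1 xk1].
move=> /(parallel_set_enorm _ _ t0)[k2 Kk2 yk2].
apply/parallel_set_enorm; first by rewrite addr_ge0// mulr_ge0// ltW.
exists (a *: k1 + b *: k2); first by apply: cK => //; exact: ltW.
rewrite opprD addrACA -!scalerBr (le_trans (enormD _ _))// !enormZ.
by rewrite !gtr0_norm// lerD// ler_wpM2l// ltW.
Qed.

(** The excess x - k of x over K is handed to y with the factor a / b; its length is then at most a
    s / b = t, which y tolerates. This is concavity across radius 0. *)
Lemma cvx_parallel_inner_sum K (s t a b : R) x y : cvx K ->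
  0 < a -> 0 < b -> a + b = 1 -> 0 <= s -> a * s = b * t ->
  parallel_set K s x -> inner_parallel K t y -> K (a *: x + b *: y).
Proof.
move=> cK a0 b0 ab s0 st /(parallel_set_enorm _ _ s0)[k Kk xk] Ky.
have -> : a *: x + b *: y = a *: k + b *: (y + (a / b) *: (x - k)).
  rewrite scalerDr scalerA mulrCA divff ?gt_eqF// mulr1 addrCA -scalerDr.
  by rewrite addrC (addrC k) subrK.
apply: cK => //; [exact: ltW|exact: ltW|apply: Ky].
rewrite addrAC subrr add0r enormZ gtr0_norm ?divr_gt0//.
by rewrite mulrAC ler_pdivrMr// (mulrC t) -st ler_pM2l.
Qed.

(** z is the last point of K on the segment from x to y; it is not interior, since the points just
    after it are outside K. *)
Lemma boundary_crossing K x y : closed K -> K x -> ~ K y ->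
  exists2 z : 'rV[R]_n, boundary K z & enorm (x - z) <= enorm (y - x) /\ enorm (y - z) <= enorm (y - x).
Proof.
move=> clK Kx nKy.
pose f (c : R) : 'rV[R]_n := x + c *: (y - x).
have cf : continuous f.
  by move=> c; apply: cvgD; [exact: cvg_cst|apply: cvgZl; exact: cvg_id].
pose E : set R := [set` `[0, 1]] `&` f @^-1` K.
have kE : compact E.
  apply: compact_closedI; first exact: segment_compact.
  by apply: preimage_closed => // c _; exact: cf.
have E0 : E !=set0.
  by exists 0; split; rewrite /= ?in_itv/= ?lexx ?ler01// /f scale0r addr0.
have cid : {within E, continuous (id : R -> R)}.
  by apply: continuous_subspaceT => c; exact: cvg_id.
have [c /set_mem[c01 Kc] cmax] := @compact_EVT_max R R id E E0 kE cid.
move: c01; rewrite /= in_itv/= => /andP[c0 c1].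
have c1' : c < 1.
  rewrite lt_neqAle c1 andbT; apply/eqP => c11; apply: nKy.
  by move: Kc; rewrite /preimage/= /f c11 scale1r addrC subrK.
exists (f c).
  split; first exact: subset_closure.
  rewrite /interior => /= Kn.
  have Hr : \forall c' \near c^'+, K (f c') by apply: (cvg_at_right_filter (cf c)) Kn.
  have : \forall c' \near c^'+, K (f c') /\ c < c' /\ c' < 1.
    near=> c'; split; last split.
    - by near: c'.
    - by near: c'; exact: nbhs_right_gt.
    - by near: c'; exact: nbhs_right_lt.
  move=> Hex; have [c' [Kc' [cc' c'1]]] := @filter_ex _ _ (at_right_proper_filter c) _ Hex.
  have : E c'.
    split => //=; rewrite in_itv/= (ltW c'1) andbT.
    by rewrite (le_trans c0)// ltW.
  by move=> /mem_set /cmax; rewrite leNgt cc'.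
rewrite /f opprD; split.
  by rewrite addrA subrr add0r enormN enormZ ger0_norm// ler_piMl// enorm_ge0.
rewrite addrA -[X in X - _]scale1r -scalerBl enormZ ger0_norm ?subr_ge0 ?(ltW c1')//.
by rewrite ler_piMl ?enorm_ge0// gerBl.
Unshelve. all: by end_near. Qed.

Lemma compact_boundary K : compact K -> compact (boundary K).
Proof.
move=> kK; have clK := compact_closedrV kK.
rewrite /boundary -(closure_id _).1//; apply: (subclosed_compact _ kK); last exact: subDsetl.
by rewrite setDE; apply: closedI => //; apply: open_closedC; exact: open_interior.
Qed.

(** Within distance t of x there is a point on the other side of the boundary: in K if x is outside,
    outside K if x is in K. *)
Lemma parallel_sub_boundary K (t : R) : compact K -> 0 <= t ->
  parallel_set K t `\` inner_parallel K t `<=` parallel_set (boundary K) t.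
Proof.
move=> kK t0 x [/(parallel_set_enorm _ _ t0)[k Kk xk] nix].
have clK := compact_closedrV kK.
apply/parallel_set_enorm => //.
have [Kx|nKx] := pselect (K x); last first.
  have [z bz [_ zx]] := boundary_crossing clK Kk nKx.
  by exists z => //; exact: le_trans xk.
have /existsNP[y /not_implyP[yx nKy]] := nix.
have [z bz [zx _]] := boundary_crossing clK Kx nKy.
by exists z => //; exact: le_trans yx.
Qed.

Lemma enorm_nbhs K z (e : R) : 0 < e -> (forall y, enorm (y - z) <= e -> K y) -> nbhs z K.
Proof.
move=> e0 H; have : \forall y \near z, enorm (y - z) < e.
  have c : {for z, continuous (fun y : 'rV[R]_n => enorm (y - z))}.
    apply: continuous_comp; last exact: continuous_enorm.
    exact: (cvgB cvg_id (cvg_cst z)).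
  by apply: (cvgr_lt _ c); rewrite subrr enorm0.
by apply: filterS => y /ltW; exact: H.
Qed.

(** If x were in the inner body of radius t', the boundary point z within t of x would have a ball
    of radius t' - t inside K. This is why the radii must differ. *)
Lemma boundary_sub_parallel K (t t' : R) : compact K -> 0 <= t -> t < t' ->
  parallel_set (boundary K) t `<=` parallel_set K t `\` inner_parallel K t'.
Proof.
move=> kK t0 tt' x /(parallel_set_enorm _ _ t0)[z [cz niz] xz].
have clK := compact_closedrV kK.
split.
  by apply/parallel_set_enorm => //; exists z => //; rewrite -((closure_id _).1 clK) in cz.
move=> Hx; apply: niz; rewrite /interior/=; apply: (@enorm_nbhs _ _ (t' - t)).
  by rewrite subr_gt0.
move=> y yz; apply: Hx; rewrite -(subrK z y) -addrA.
rewrite (le_trans (enormD _ _))// -(opprB x z) enormN; lra.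
Qed.

End parallel_bodies.

(** * Surface area as the rate of growth of the volume *)

Section surface_area.
Variables (R : realType).

Lemma vol_ge_box n (A : set 'rV[R]_n) (c : 'rV[R]_n) (d : R) : 0 <= d -> borel A ->
  (forall v : 'rV[R]_n, (forall i, `|v ord0 i - c ord0 i| <= d) -> A v) -> (((d *+ 2) ^+ n)%:E <= vol A)%E.
Proof.
move=> d0; elim: n A c => [|n IH] A c mA HA.
  by rewrite /= expr0 lee_fin indicE mem_set//; apply: HA => -[].
have [x [u cE]] := rV_cons c.
pose e : R := (d *+ 2) ^+ n.
have e0 : 0 <= e by rewrite exprn_ge0// mulrn_wge0.
rewrite volS; apply: (@le_trans _ _ (\int[@lebesgue_measure R]_(y in `[(x - d)%R, (x + d)%R]) e%:E)%E).
  rewrite integral_cst//= lebesgue_measure_itv/= lte_fin.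
  case: ifPn => dd; first by rewrite -EFinB -EFinM lee_fin exprSr -/e; apply: ler_wpM2l => //; lra.
  have -> : d = 0 by lra.
  by rewrite mul0rn expr0n/= mule0.
rewrite [leLHS]integral_mkcond; apply: ge0_le_integral => //.
- by move=> y _; rewrite patchE; case: ifP => // _; rewrite lee_fin.
- by apply/(measurable_restrictT _ _).1.
- exact: measurable_vol_section.
- move=> y _; rewrite patchE; case: ifPn => [|_]; last exact: vol_ge0.
  rewrite inE/= in_itv/= => /andP[y1 y2].
  apply: (IH _ u); first exact: borel_section.
  move=> v Hv; apply: HA => i; rewrite cE.
  case: (unliftP ord0 i) => [j|] ->; rewrite ?cons_rVS ?cons_rV0//.
  by rewrite ler_norml; lra.
Qed.

Lemma le_fine_vol n (A B : set 'rV[R]_n) : compact A -> compact B -> A `<=` B ->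
  fine (vol A) <= fine (vol B).
Proof.
move=> kA kB AB; apply: fine_le; rewrite ?vol_fin//.
by apply: le_vol => //; exact: borel_compact.
Qed.

Lemma fine_vol_gt0 n (A : set 'rV[R]_n) (c : 'rV[R]_n) (d : R) : compact A -> 0 < d ->
  (forall v, enorm (v - c) <= d -> A v) -> 0 < fine (vol A).
Proof.
move=> kA d0 HA.
(* half-side of a cube inscribed in the Euclidean ball of radius d *)
pose e : R := d / (n%:R + 1).
have n0 : (0 : R) < n%:R + 1 by rewrite ltr_wpDl.
have e0 : 0 < e by rewrite divr_gt0.
have : (((e *+ 2) ^+ n)%:E <= vol A)%E.
  apply: (@vol_ge_box n A c) => [||v Hv]; [exact: ltW|exact: borel_compact|].
  apply: HA; rewrite -(@ler_pXn2r _ 2) ?nnegrE ?enorm_ge0 ?(ltW d0)//.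
  rewrite sqr_enorm /dot (@le_trans _ _ (\sum_(i < n) e ^+ 2))//.
    apply: ler_sum => i _; rewrite !mxE -expr2 -real_normK ?num_real//.
    by rewrite ler_pXn2r ?nnegrE// ?(ltW e0)//; have := Hv i; rewrite ?mxE.
  rewrite sumr_const card_ord -mulr_natl /e expr_div_n mulrCA ler_piMr ?sqr_ge0//.
  rewrite ler_pdivrMr ?exprn_gt0// mul1r; have : (0 : R) <= n%:R by []. nra.
rewrite -[vol A]fineK ?vol_fin// lee_fin; apply: lt_le_trans.
by rewrite exprn_gt0// mulrn_wgt0.
Qed.

Lemma surface_area n (K : set 'rV[R]_n) : solid_convex_body K ->
  let V0 := fine (vol K) in
  0 < V0 /\ exists2 sg : R, hypersurface_area (boundary K) = (sg * V0)%:E &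
    0 <= sg /\ forall t, 0 < t -> fine (vol (parallel_set K t)) <= V0 * expR (sg * t).
Proof.
move=> [kK /convex_set_cvx cK [c]].
rewrite /interior/= => /nbhs_ballP[r0 /= r00 Br0]; set V0 := fine (vol K).
pose r := r0 / 2; have rp : 0 < r by rewrite divr_gt0.
have HB y : enorm (y - c) <= r -> K y.
  move=> yc; apply: Br0; split=> // i j; rewrite ord1 /ball/= distrC.
  have := coord_le_enorm (y - c) j; rewrite !mxE => h.
  rewrite (le_lt_trans h)// (le_lt_trans yc)// /r; lra.
have V0p : 0 < V0 by apply: (@fine_vol_gt0 _ _ c r).
split => //.
pose V t := fine (vol (parallel_set K t)).
pose W t := fine (vol (inner_parallel K t)).
pose q t := fine (vol (parallel_set (boundary K) t)) / (2 * t).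
have kp t := @compact_parallel R n K t kK.
have ki t (t0 : 0 <= t) := @compact_inner_parallel R n K t t0 kK.
have kb := compact_boundary kK.
have Kp (t : R) : 0 <= t -> K `<=` parallel_set K t.
  by move=> t0 x Kx; apply/parallel_set_enorm => //; exists x; rewrite // subrr enorm0.
have ic (t : R) : 0 <= t -> t <= r -> inner_parallel K t c.
  by move=> t0 tr y yc; apply: HB; rewrite (le_trans yc).
have cne : K !=set0 by exists c; apply: HB; rewrite subrr enorm0 ltW.
have pne (t : R) : 0 <= t -> parallel_set K t !=set0.
  by move=> t0; have [x Kx] := cne; exists x; exact: Kp.
have [sg sgc [sg0 sgV]] : exists2 sg : R, q t @[t --> 0^'+] --> sg * V0 &
    0 <= sg /\ forall t : R, 0 < t -> V t <= V0 * expR (sg * t).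
  (* For t <= r / 2 each inner body still contains the ball of radius r / 2 about c, which keeps W
     positive. *)
  apply: (@log_concave_slopes R V W q V0 (r / 2)) => //; first by rewrite divr_gt0.
  - by move=> t /ltW t0; apply: le_fine_vol => //; exact: Kp.
  - move=> t t0 tr; apply: (@fine_vol_gt0 _ _ c (r / 2)); [apply: ki; exact: ltW|by rewrite divr_gt0|].
    move=> y yc z zy; apply: HB; rewrite -(subrK y z) -addrA (le_trans (enormD _ _))//; lra.
  - by move=> t t0 tr; apply: le_fine_vol => //; [apply: ki; exact: ltW|apply: inner_parallel_sub; exact: ltW].
  - move=> s t a b s0 st a0 b0 ab ->; have t0 := lt_trans s0 st.
    apply: brunn_minkowski => //; try exact: cvx_parallel; first exact/pne/ltW.
    (* K lies in its own parallel body of radius 0, so the radius b t is read as a 0 + b t. *)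
    move=> x y Kx; rewrite -[b * t]add0r -(mulr0 a).
    by apply: cvx_parallel_sum => //; [exact: ltW|exact: Kp].
  - move=> s t a b s0 st tr a0 b0 ab ->; have t0 := lt_trans s0 st.
    apply: brunn_minkowski => //.
    + exact/ki/ltW.
    + by apply: ki; rewrite mulr_ge0// ltW.
    + by apply: cvx_inner_parallel => //; exact: ltW.
    + by exists c; apply: ic; [exact: ltW|lra].
    move=> x y Kx; rewrite -[b * t]add0r -(mulr0 a).
    apply: cvx_inner_parallel_sum => //; first exact: ltW.
    by move=> z; rewrite le_eqVlt ltNge enorm_ge0 orbF enorm_eq0 subr_eq0 => /eqP ->.
  - move=> s t a b s0 t0 tr a0 b0 ab st.
    apply: brunn_minkowski => //.
    + exact/ki/ltW.
    + exact: cvx_parallel.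
    + by apply: cvx_inner_parallel => //; exact: ltW.
    + exact/pne/ltW.
    + by exists c; apply: ic; [exact: ltW|lra].
    by move=> x y; apply: cvx_parallel_inner_sum => //; exact: ltW.
  - move=> t t' t0 tt' t'r; have t'0 := lt_trans t0 tt'.
    have t20 : 2 * t != 0 by rewrite mulf_neq0// gt_eqF.
    rewrite /q divfK// lerBlDr lerBrDr -!lee_fin !EFinD /V /W.
    have kbt := @compact_parallel R n (boundary K) t kb.
    have kit := ki _ (ltW t0); have kit' := ki _ (ltW t'0).
    rewrite !fineK ?vol_fin//; apply/andP; split.
      rewrite (@volD _ _ (parallel_set K t) (inner_parallel K t)); try exact: borel_compact; last first.
        by move=> x /(inner_parallel_sub (ltW t0)); apply: Kp; exact: ltW.
      rewrite leeD2r// le_vol//; [|exact: borel_compact|exact: parallel_sub_boundary (ltW t0)].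
      by apply: borelD; exact: borel_compact.
    rewrite (@volD _ _ (parallel_set K t) (inner_parallel K t')); try exact: borel_compact; last first.
      by move=> x /(inner_parallel_sub (ltW t'0)); apply: Kp; exact: ltW.
    rewrite leeD2r// le_vol//; [exact: borel_compact| |exact: boundary_sub_parallel (ltW t0) tt'].
    by apply: borelD; exact: borel_compact.
exists sg => //.
rewrite /hypersurface_area; apply: cvg_lim => //.
have : (q t)%:E @[t --> 0^'+] --> (sg * V0)%:E by apply: cvg_EFin; [exact: nearW|].
apply: cvg_trans; apply: near_eq_cvg; near=> t.
by rewrite /q EFinM fineK// vol_fin//; exact: compact_parallel.
Unshelve. all: by end_near. Qed.

End surface_area.

(** * Volumes of sums with zonotopes *)

Section segment_sums.
Variable R : realType.
Local Notation leb := (@lebesgue_measure R).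

Definition scaled n (t : R) (A : set 'rV[R]_n) : set 'rV[R]_n := ( *:%R t) @` A.

Definition segment n (u : 'rV[R]_n) : set 'rV[R]_n := [set s *: u | s in `[-1, 1]].

Definition tail_rV n (v : 'rV[R]_n.+1) : 'rV[R]_n := \row_i v ord0 (lift ord0 i).

Lemma tail_cons_rV n x (v : 'rV[R]_n) : tail_rV (cons_rV x v) = v.
Proof. by apply/rowP => i; rewrite mxE cons_rVS. Qed.

Lemma cons_tail_rV n (v : 'rV[R]_n.+1) : cons_rV (v ord0 ord0) (tail_rV v) = v.
Proof.
apply/rowP => i; case: (unliftP ord0 i) => [j|] ->.
  by rewrite cons_rVS mxE.
by rewrite cons_rV0.
Qed.

Definition continuous_linear m n (f : 'rV[R]_m -> 'rV[R]_n) :=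
  (forall a b x y, f (a *: x + b *: y) = a *: f x + b *: f y) /\ continuous f.

Lemma continuous_tail_rV n : continuous (@tail_rV n).
Proof.
apply: continuous_rV => i.
rewrite (_ : (fun t => _) = (fun v : 'rV[R]_n.+1 => v ord0 (lift ord0 i))).
  exact: coord_continuous.
by apply/funext => v; rewrite mxE.
Qed.

Lemma compact_segment n (u : 'rV[R]_n) : compact (segment u).
Proof.
apply: continuous_compact; last exact: segment_compact.
apply: continuous_subspaceT => s; apply: cvgZl; exact: cvg_id.
Qed.

Lemma cvx_segment n (u : 'rV[R]_n) : cvx (segment u).
Proof.
move=> a b _ _ a0 b0 ab [s + <-] [t + <-]; rewrite /= !in_itv/= => /andP[s1 s2] /andP[t1 t2].
exists (a * s + b * t); last by rewrite scalerDl !scalerA.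
by rewrite /= in_itv/=; apply/andP; split; nra.
Qed.

Lemma compact_interval (A : set R) : compact A -> convex_line A -> A !=set0 ->
  exists a b : R, a <= b /\ A = [set` `[a, b]].
Proof.
move=> kA cA A0.
have cid : {within A, continuous (id : R -> R)}.
  by apply: continuous_subspaceT => c; exact: cvg_id.
have [b /set_mem Ab bmax] := @compact_EVT_max R R id A A0 kA cid.
have [a /set_mem Aa amin] := @compact_EVT_min R R id A A0 kA cid.
exists a, b; have ab : a <= b by apply: amin; exact: mem_set.
split => //; apply/seteqP; split => x.
  by move=> /mem_set Ax; rewrite /= in_itv/= amin// bmax.
rewrite /= in_itv/= => /andP[ax xb].
have [ab0|abn0] := eqVneq a b.
  by have -> : x = a by apply/le_anti; rewrite ax ab0 xb.
have abp : 0 < b - a by rewrite subr_gt0 lt_neqAle abn0.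
have -> : x = (b - x) / (b - a) * a + (x - a) / (b - a) * b by field; rewrite gt_eqF.
by apply: cA => //; rewrite ?divr_ge0 ?subr_ge0//; field; rewrite gt_eqF.
Qed.

(** The first coordinate, integrated last in the definition of [vol], is here integrated first: this
    exposes the fibers that a segment on the first axis lengthens. *)
Lemma vol_fubini n (D : set 'rV[R]_n.+1) : borel D ->
  vol D = (\int[leb_tuple R n]_t leb [set x : measurableTypeR R | D (cons_rV x (row_of_tuple t))])%E.
Proof.
move=> mD; rewrite vol_leb_tuple//= /cons_measure /pushforward.
have mE := measurable_section_pair mD; set E := _ @^-1` _ in mE *.
have := @indic_fubini_tonelli _ _ _ _ R leb (leb_tuple R n) E mE.
rewrite indic_fubini_tonelli_FE// indic_fubini_tonelli_GE// /product_measure1 => ->.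
apply: eq_integral => t _ /=; congr leb.
by apply/seteqP; split => x; rewrite /ysection/= inE /E/= row_of_cons_pair.
Qed.

Lemma measurable_fiber n (D : set 'rV[R]_n.+1) : borel D ->
  measurable_fun setT (fun t => leb [set x : measurableTypeR R | D (cons_rV x (@row_of_tuple R n t))]).
Proof.
move=> mD; have mE := measurable_section_pair mD; set E := _ @^-1` _ in mE.
rewrite (_ : (fun _ => _) = leb \o ysection E); first exact: measurable_fun_ysection.
apply/funext => t /=; congr leb.
by apply/seteqP; split => x; rewrite /ysection/= inE /E/= row_of_cons_pair.
Qed.

(* The fibers of D in the first direction are compact intervals, and the
   nonempty ones grow by 2 |s|. *)
Lemma vol_msum_segment0 n (D : set 'rV[R]_n.+1) (s : R) : compact D -> cvx D ->
  vol (msum D (segment (s *: cons_rV 1 0))) =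
  (vol D + (2 * `|s|)%:E * vol (@tail_rV n @` D))%E.
Proof.
move=> kD cD; set u := s *: _; set D' := msum D _.
have kD' : compact D' by apply: compact_msum => //; exact: compact_segment.
have kT : compact (@tail_rV n @` D) by apply: compact_image => //; exact: continuous_tail_rV.
have mT := borel_compact kT.
rewrite (vol_fubini (borel_compact kD')) (vol_fubini (borel_compact kD)).
have -> : vol (@tail_rV n @` D) =
    (\int[leb_tuple R n]_t (\1_(@row_of_tuple R n @^-1` (@tail_rV n @` D)) t)%:E)%E.
  by rewrite integral_indic ?setIT ?vol_leb_tuple.
rewrite -ge0_integralZl//; last by apply/measurable_EFinP; exact: measurable_indic.
rewrite -ge0_integralD//; last 2 first.
- by apply: measurable_fiber; exact: borel_compact.
- by apply: measurable_funeM; apply/measurable_EFinP; exact: measurable_indic.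
apply: eq_integral => t _.
set v := row_of_tuple t.
pose F (E : set 'rV[R]_n.+1) : set (measurableTypeR R) := [set x | E (cons_rV x v)].
rewrite -/(F D) -/(F D') indicE.
have uE : u = cons_rV s 0 by rewrite /u cons_rVZ mulr1 scaler0.
(* Adding the segment replaces each fiber by its closed |s|-neighbourhood. *)
have F'E : F D' = [set x | exists2 y, F D y & `|x - y| <= `|s|].
  apply/seteqP; split => x.
    move=> [d Dd [_ [r + <-]]]; rewrite /= in_itv/= uE => /andP[r1 r2].
    rewrite -(cons_tail_rV d) cons_rVZ cons_rVD scaler0 addr0 => E.
    have vE : tail_rV d = v by rewrite -[RHS](tail_cons_rV x) -E tail_cons_rV.
    have xE : d ord0 ord0 + r * s = x by rewrite -[RHS](cons_rV0 x v) -E cons_rV0.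
    exists (d ord0 ord0); first by rewrite /F/= -vE cons_tail_rV.
    rewrite -xE addrAC subrr add0r normrM ler_piMl//.
    by rewrite ler_norml r1.
  move=> [y Fy xy]; exists (cons_rV y v) => //.
  exists (((x - y) / s) *: u); last first.
    rewrite uE cons_rVZ cons_rVD scaler0 addr0.
    have [s0|sn0] := eqVneq s 0; last by rewrite divfK// addrC subrK.
    move: xy; rewrite s0 normr0 normr_le0 subr_eq0 => /eqP ->.
    by rewrite mulr0 addr0.
  exists ((x - y) / s) => //; rewrite /= in_itv/= -ler_norml normrM normfV.
  have [s0|sn0] := eqVneq s 0; first by rewrite s0 normr0 invr0 mulr0 ler01.
  by rewrite ler_pdivrMr ?normr_gt0// mul1r.
have cF : convex_line (F D).
  move=> a b x y a0 b0 ab Fx Fy; have := cD a b _ _ a0 b0 ab Fx Fy.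
  by rewrite !cons_rVZ cons_rVD -scalerDl ab scale1r.
have kF : compact (F D).
  have cc : continuous (fun x : R => cons_rV x v).
    by apply: (@continuous_cons_rV R R n id (cst v)) => x; [exact: cvg_id|exact: cvg_cst].
  have clF : closed (F D).
    by apply: (@preimage_closed _ _ (fun x : R => cons_rV x v)) ; [move=> x _; exact: cc|exact: compact_closedrV].
  have [M M0 HM] := compact_rV_bounded kD.
  apply: (subclosed_compact clF (@segment_compact R (- M) M)) => x Fx.
  by have := HM _ Fx ord0; rewrite cons_rV0 ler_norml /= in_itv.
have [F0|/set0P/negP/negPn/eqP F0] := pselect (F D !=set0); last first.
  rewrite F'E F0 (_ : [set x | _] = set0); last by apply/seteqP; split => x // [].
  rewrite memNset ?mule0 ?adde0//= => -[d Dd dv].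
  by have : F D (d ord0 ord0) by [rewrite /F/= /v -dv cons_tail_rV]; rewrite F0.
rewrite mem_set/=; last by have [x Fx] := F0; exists (cons_rV x v); rewrite ?tail_cons_rV.
have [a [b [ab FE]]] := compact_interval kF cF F0.
rewrite F'E FE (_ : [set x | _] = [set` `[a - `|s|, b + `|s|]]); last first.
  apply/seteqP; split => x /=.
    by move=> [y]; rewrite !in_itv/= ler_norml => /andP[? ?] /andP[? ?]; apply/andP; split; lra.
  rewrite in_itv/= => /andP[x1 x2].
  have [xa|ax] := leP x a.
    by exists a; rewrite ?in_itv/= ?lexx// ler_norml; have := normr_ge0 s; lra.
  have [xb|bx] := leP x b.
    by exists x; rewrite ?in_itv/= ?(ltW ax)// subrr normr0.
  by exists b; rewrite ?in_itv/= ?lexx ?ab// ler_norml; have := normr_ge0 s; lra.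
have s0 := normr_ge0 s.
rewrite !lebesgue_measure_itv/= !lte_fin mule1.
case: ltP => h1; case: ltP => h2; rewrite -?EFinB -?EFinD ?add0e; congr EFin; lra.
Qed.

Lemma image_msum m n (f : 'rV[R]_m -> 'rV[R]_n) (A B : set 'rV[R]_m) :
  continuous_linear f -> f @` msum A B = msum (f @` A) (f @` B).
Proof.
move=> [lf _]; have fD x y : f (x + y) = f x + f y.
  by rewrite -[x in LHS]scale1r -[y in LHS]scale1r lf !scale1r.
apply/seteqP; split => z.
  by move=> [_ [x Ax [y By <-]] <-]; rewrite fD; exists (f x); [exists x|exists (f y) => //; exists y].
by move=> [_ [x Ax <-] [_ [y By <-] <-]]; exists (x + y); [exists x => //; exists y|exact: fD].
Qed.

Lemma continuous_linearZ m n (f : 'rV[R]_m -> 'rV[R]_n) a x :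
  continuous_linear f -> f (a *: x) = a *: f x.
Proof. by move=> [lf _]; rewrite -[a *: x]addr0 -(scale0r 0) lf scale0r addr0. Qed.

Lemma image_segment m n (f : 'rV[R]_m -> 'rV[R]_n) (u : 'rV[R]_m) :
  continuous_linear f -> f @` segment u = segment (f u).
Proof.
move=> lf; apply/seteqP; split => z.
  by move=> [_ [s sI <-] <-]; exists s => //; rewrite continuous_linearZ.
by move=> [s sI <-]; exists (s *: u); [exists s|rewrite continuous_linearZ].
Qed.

Lemma image_scaled m n (f : 'rV[R]_m -> 'rV[R]_n) (t : R) (A : set 'rV[R]_m) :
  continuous_linear f -> f @` scaled t A = scaled t (f @` A).
Proof.
move=> lf; apply/seteqP; split => z.
  by move=> [_ [x Ax <-] <-]; exists (f x); [exists x|rewrite continuous_linearZ].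
by move=> [_ [x Ax <-] <-]; exists (t *: x); [exists x|rewrite continuous_linearZ].
Qed.

Lemma cvx_image m n (f : 'rV[R]_m -> 'rV[R]_n) (A : set 'rV[R]_m) :
  continuous_linear f -> cvx A -> cvx (f @` A).
Proof.
move=> [lf _] cA a b _ _ a0 b0 ab [x Ax <-] [y Ay <-].
by exists (a *: x + b *: y); [exact: cA|rewrite lf].
Qed.

Lemma segmentZ n (u : 'rV[R]_n) (t : R) : scaled t (segment u) = segment (t *: u).
Proof.
apply/seteqP; split => z.
  by move=> [_ [s sI <-] <-]; exists s => //; rewrite !scalerA mulrC.
by move=> [s sI <-]; exists (s *: u); [exists s|rewrite !scalerA mulrC].
Qed.

Lemma segment0 n : segment (0 : 'rV[R]_n) = [set 0].
Proof.
apply/seteqP; split => z /=; first by move=> [s _ <-]; rewrite scaler0.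
by move=> ->; exists 0; rewrite ?scaler0//= in_itv/=; lra.
Qed.

Lemma msum0 n (A : set 'rV[R]_n) : msum A [set 0] = A.
Proof.
apply/seteqP; split => z; first by move=> [x Ax [_ -> <-]]; rewrite addr0.
by move=> Az; exists z => //; exists 0 => //; rewrite addr0.
Qed.

Lemma continuous_linear_shear n (w : 'rV[R]_n) :
  continuous_linear (fun v : 'rV[R]_n.+1 => v + v ord0 ord0 *: cons_rV 0 w).
Proof.
split=> [a b x y|v].
  rewrite !mxE !scalerDr scalerDl !scalerA !addrA; congr (_ + _).
  by rewrite -!addrA; congr (_ + _); rewrite addrC.
exact: (cvgD cvg_id (cvgZl (@coord_continuous R 1 n.+1 ord0 ord0 v))).
Qed.

Lemma continuous_linear_tail n : continuous_linear (@tail_rV n).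
Proof.
split; last exact: continuous_tail_rV.
by move=> a b x y; apply/rowP => i; rewrite !mxE.
Qed.

Lemma continuous_linear_comp m n p (f : 'rV[R]_m -> 'rV[R]_n) (g : 'rV[R]_n -> 'rV[R]_p) :
  continuous_linear f -> continuous_linear g -> continuous_linear (g \o f).
Proof.
move=> [lf cf] [lg cg]; split; first by move=> a b x y /=; rewrite lf lg.
by move=> x; apply: continuous_comp; [exact: cf|exact: cg].
Qed.

Lemma vol_shear_image n (w : 'rV[R]_n) (A : set 'rV[R]_n.+1) : compact A ->
  vol ((fun v : 'rV[R]_n.+1 => v + v ord0 ord0 *: cons_rV 0 w) @` A) = vol A.
Proof.
move=> kA; rewrite -[RHS](vol_shear (- w) (compact_closedrV kA)); congr vol.
have cN : cons_rV 0 (- w) = - cons_rV 0 w :> 'rV[R]_n.+1.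
  by rewrite -scaleN1r -[RHS]scaleN1r cons_rVZ mulr0.
have h (y : 'rV[R]_n.+1) (a : R) (z : 'rV[R]_n) : (y + a *: cons_rV 0 z) ord0 ord0 = y ord0 ord0.
  by rewrite mxE [X in _ + X]mxE cons_rV0 mulr0 addr0.
apply/seteqP; split => v /=.
  by move=> [x Ax <-]; rewrite h cN scalerN addrK.
by move=> Av; eexists; first exact: Av; rewrite h cN scalerN subrK.
Qed.

(** A volume-preserving shear S takes u to u0 times the first basis vector, where the fiber
    computation applies. The map f is S followed by dropping the first coordinate, hence a
    projection along u. *)
Lemma vol_msum_segment_neq0 m (u : 'rV[R]_m.+1) : u ord0 ord0 != 0 ->
  exists2 f : 'rV[R]_m.+1 -> 'rV[R]_m, continuous_linear f &
  forall (A : set 'rV[R]_m.+1) (t : R), compact A -> cvx A -> 0 <= t ->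
    vol (msum A (segment (t *: u))) =
    (vol A + (t * (2 * `|u ord0 ord0|))%:E * vol (f @` A))%E.
Proof.
set u0 := u ord0 ord0 => u0n; pose w := - (u0^-1 *: tail_rV u).
pose S := fun v : 'rV[R]_m.+1 => v + v ord0 ord0 *: cons_rV 0 w.
have lS : continuous_linear S by exact: continuous_linear_shear.
exists (@tail_rV m \o S).
  by apply: continuous_linear_comp => //; exact: continuous_linear_tail.
move=> A t kA cA t0.
rewrite -(@vol_shear_image _ w (msum _ _)) -/S; last first.
  by apply: compact_msum => //; exact: compact_segment.
rewrite image_msum// image_segment// (_ : S (t *: u) = (t * u0) *: cons_rV 1 0); last first.
  rewrite (continuous_linearZ _ _ lS) -scalerA; congr (_ *: _).
  rewrite /S -/u0 -[in LHS](cons_tail_rV u) -/u0 !cons_rVZ cons_rVD mulr0 addr0 mulr1.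
  by rewrite scaler0 /w scalerN scalerA divff// scale1r subrr.
rewrite vol_msum_segment0; last 2 first.
- by apply: compact_image => //; exact: lS.2.
- exact: cvx_image.
rewrite vol_shear_image// image_comp normrM (ger0_norm t0); congr (_ + _%:E * _)%E.
by rewrite mulrCA.
Qed.

(* f is a projection along u. *)
Lemma vol_msum_segment m (u : 'rV[R]_m.+1) :
  exists c : R, 0 <= c /\ exists2 f : 'rV[R]_m.+1 -> 'rV[R]_m, continuous_linear f &
  forall (A : set 'rV[R]_m.+1) (t : R), compact A -> cvx A -> 0 <= t ->
    vol (msum A (segment (t *: u))) = (vol A + (t * c)%:E * vol (f @` A))%E.
Proof.
elim: m u => [|m IH] u; have [u00|u0] := eqVneq (u ord0 ord0) 0.
- have -> : u = 0 by apply/rowP => i; rewrite ord1 u00 mxE.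
  exists 0; split => //; exists (@tail_rV 0); first exact: continuous_linear_tail.
  by move=> A t kA cA t0; rewrite scaler0 segment0 msum0 mulr0 mul0e adde0.
- have [f lf Hf] := vol_msum_segment_neq0 u0.
  by exists (2 * `|u ord0 ord0|); split => //; exists f.
(* Here u is parallel to the sections by the first coordinate, so the case of lower dimension is
   applied in each section and integrated; g keeps the first coordinate and acts as f on the
   rest. *)
- have [c [c0 [f lf Hf]]] := IH (tail_rV u).
  pose g (v : 'rV[R]_m.+2) := cons_rV (v ord0 ord0) (f (tail_rV v)).
  have lg : continuous_linear g.
    split=> [a b x y|].
      by rewrite /g (continuous_linear_tail m.+1).1 lf.1 !cons_rVZ cons_rVD !mxE.
    apply: continuous_cons_rV; first exact: coord_continuous.
    exact: (continuous_linear_comp (continuous_linear_tail m.+1) lf).2.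
  exists c; split => //; exists g => // A t kA cA t0.
  have sg x : section (g @` A) x = f @` section A x.
    apply/seteqP; split => v /=.
      move=> [y Ay E]; have E0 : y ord0 ord0 = x by rewrite -[RHS](cons_rV0 x v) -E cons_rV0.
      exists (tail_rV y); first by rewrite /section/= -E0 cons_tail_rV.
      by rewrite -[RHS](tail_cons_rV x) -E tail_cons_rV.
    move=> [y Ay <-]; exists (cons_rV x y) => //.
    by rewrite /g cons_rV0 tail_cons_rV.
  have kg : compact (g @` A) by apply: compact_image => //; exact: lg.2.
  have uE : u = cons_rV 0 (tail_rV u) by rewrite -[LHS]cons_tail_rV u00.
  rewrite !volS -ge0_integralZl ?lee_fin ?mulr_ge0//; last 2 first.
  - by apply: measurable_vol_section; exact: borel_compact.
  - by move=> x _; exact: vol_ge0.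
  rewrite -ge0_integralD//; last 4 first.
  - by move=> x _; exact: vol_ge0.
  - by apply: measurable_vol_section; exact: borel_compact.
  - by move=> x _; rewrite mule_ge0 ?lee_fin ?mulr_ge0// vol_ge0.
  - by apply: measurable_funeM; apply: measurable_vol_section; exact: borel_compact.
  apply: eq_integral => x _; rewrite sg -Hf//; last 2 first.
  - exact: compact_section.
  - exact: cvx_section.
  congr vol; apply/seteqP; split => v.
    move=> [y Ay [_ [s sI <-] E]].
    have E0 : y ord0 ord0 = x.
      by rewrite -[RHS](cons_rV0 x v) -E !mxE u00 !mulr0 addr0.
    exists (tail_rV y); first by rewrite /section/= -E0 cons_tail_rV.
    exists (s *: (t *: tail_rV u)); first by exists s.
    rewrite -[RHS](tail_cons_rV x) -E; apply/rowP => i.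
    by rewrite !mxE.
  move=> [y Ay [_ [s sI <-] <-]]; rewrite /section/=.
  exists (cons_rV x y) => //; exists (s *: (t *: u)); first by exists s.
  by rewrite [in LHS]uE !cons_rVZ cons_rVD !mulr0 addr0.
- have [f lf Hf] := vol_msum_segment_neq0 u0.
  by exists (2 * `|u ord0 ord0|); split => //; exists f.
Qed.

Fixpoint zonotope n (us : seq 'rV[R]_n) : set 'rV[R]_n :=
  if us is u :: us' then msum (segment u) (zonotope us') else [set 0].

Lemma msumA n (A B C : set 'rV[R]_n) : msum A (msum B C) = msum (msum A B) C.
Proof.
apply/seteqP; split => z.
  by move=> [x Ax [_ [y By [w Cw <-]] <-]]; exists (x + y); [exists x => //; exists y|exists w => //; rewrite addrA].
by move=> [_ [x Ax [y By <-]] [w Cw <-]]; exists x => //; exists (y + w); [exists y => //; exists w|rewrite addrA].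
Qed.

Lemma msumC n (A B : set 'rV[R]_n) : msum A B = msum B A.
Proof.
by apply/seteqP; split => _ [x Ax [y By <-]]; exists y => //; exists x => //; rewrite addrC.
Qed.

Lemma compact_zonotope n (us : seq 'rV[R]_n) : compact (zonotope us).
Proof.
elim: us => [|u us IH] /=; first exact: compact_set1.
by apply: compact_msum => //; exact: compact_segment.
Qed.

Lemma cvx_zonotope n (us : seq 'rV[R]_n) : cvx (zonotope us).
Proof.
elim: us => [|u us IH] /=; last by apply: cvx_msum => //; exact: cvx_segment.
by move=> a b x y _ _ _ -> ->; rewrite !scaler0 addr0.
Qed.

Lemma zonotope_neq0 n (us : seq 'rV[R]_n) : zonotope us !=set0.
Proof.
elim: us => [|u us [z Zz]] /=; first by exists 0.
by exists (0 + z); exists 0; [exists 0; rewrite ?scale0r//= in_itv/=; lra|exists z].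
Qed.

Lemma scaled_msum n (t : R) (A B : set 'rV[R]_n) :
  scaled t (msum A B) = msum (scaled t A) (scaled t B).
Proof.
apply/seteqP; split => z.
  by move=> [_ [x Ax [y By <-]] <-]; exists (t *: x); [exists x|exists (t *: y); [exists y|rewrite scalerDr]].
by move=> [_ [x Ax <-] [_ [y By <-] <-]]; exists (x + y); [exists x => //; exists y|rewrite scalerDr].
Qed.

Lemma image_zonotope m n (f : 'rV[R]_m -> 'rV[R]_n) (us : seq 'rV[R]_m) :
  continuous_linear f -> f @` zonotope us = zonotope (map f us).
Proof.
move=> lf; elim: us => [|u us IH] /=; last by rewrite image_msum// image_segment// IH.
by rewrite image_set1 -[X in f X](scale0r 0) continuous_linearZ// scale0r.
Qed.

Definition nonneg_coef (q : {poly R}) := forall i, 0 <= q`_i.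

Lemma msum_rV0 (A B : set 'rV[R]_0) : B !=set0 -> msum A B = A.
Proof.
move=> [b Bb]; apply/seteqP; split => z.
  by move=> [x Ax [y By _]]; rewrite (thinmx0 z) -(thinmx0 x).
by move=> Az; exists z => //; exists b => //; rewrite [LHS]thinmx0 [RHS]thinmx0.
Qed.

(** Removing one segment leaves two terms: a polynomial for fewer segments, and c t times a
    polynomial for the projections, in one dimension less. The induction is on the number of
    segments with n arbitrary because of the second term. *)
Lemma vol_zonotope_poly n (us : seq 'rV[R]_n) (A : set 'rV[R]_n) : compact A -> cvx A ->
  exists2 q : {poly R}, (size q <= n.+1)%N /\ nonneg_coef q &
    forall t : R, 0 <= t -> vol (msum A (scaled t (zonotope us))) = (q.[t])%:E.
Proof.
move sk : (size us) => k; elim: k n us sk A => [|k IH] n us sk A kA cA.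
  exists (fine (vol A))%:P.
    split; first exact: leq_trans (size_polyC_leq1 _) _.
    by move=> i; rewrite coefC; case: ifP => // _; rewrite fine_ge0// vol_ge0.
  move=> t t0; case: us sk => //= _.
  rewrite /scaled image_set1 scaler0 msum0 hornerC fineK//; exact: vol_fin.
case: us sk => [//|u us] [sk]; case: n u us sk A kA cA => [|m] u us sk A kA cA.
  have [q q1 qE] := IH 0%N us sk A kA cA; exists q => // t t0; rewrite -qE//.
  have [z Zz] := zonotope_neq0 us; have [z' Zz'] := zonotope_neq0 (u :: us).
  by rewrite !msum_rV0//; [exists (t *: z); exists z|exists (t *: z'); exists z'].
have [c [c0 [f lf Hf]]] := vol_msum_segment u.
have [q1 [s1 p1] E1] := IH m.+1 us sk A kA cA.
have kf : compact (f @` A) by apply: compact_image => //; exact: lf.2.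
have [q2 [s2 p2] E2] := IH m (map f us) (etrans (size_map _ _) sk) _ kf (cvx_image lf cA).
exists (q1 + c *: ('X * q2)).
  split; last first.
    move=> i; rewrite coefD coefZ coefXM addr_ge0// mulr_ge0//.
    by case: ifP.
  rewrite (leq_trans (size_polyD _ _))// geq_max s1/=.
  rewrite (leq_trans (size_scale_leq _ _))// (leq_trans (size_polyMleq _ _))//.
  by rewrite size_polyX.
move=> t t0; rewrite -[zonotope _]/(msum (segment u) (zonotope us)).
rewrite scaled_msum segmentZ (msumC (segment _)) msumA Hf//; last 2 first.
- apply: compact_msum => //; apply: compact_scale; exact: compact_zonotope.
- apply: cvx_msum => //; apply: cvx_scale; exact: cvx_zonotope.
rewrite image_msum// image_scaled// image_zonotope// E1// E2// -EFinM -EFinD.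
by rewrite hornerD hornerZ hornerM hornerX mulrCA mulrA.
Qed.

End segment_sums.

(** * Zonotopes approximating the ball *)

Section rademacher.
Variable R : realType.
Implicit Types (f g h : R -> R) (l : seq R) (a y : R).

(* [sign_mean l f y] is the mean of [f (y + \sum_i e_i l_i)] over all choices of signs e_i. *)
Definition sym2 a f y : R := (f (y + a) + f (y - a)) / 2.
Definition sign_mean l f : R -> R := foldr sym2 f l.

Lemma sign_mean_cons a l f y : sign_mean (a :: l) f y = sym2 a (sign_mean l f) y.
Proof. by []. Qed.

Lemma sign_mean_cat l1 l2 f : sign_mean (l1 ++ l2) f = sign_mean l1 (sign_mean l2 f).
Proof. exact: foldr_cat. Qed.

Lemma sign_mean_sym2 a l f y : sign_mean l (sym2 a f) y = sym2 a (sign_mean l f) y.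
Proof.
elim: l y => [//|b l IH] y; rewrite sign_mean_cons /sym2 !IH /sym2 !sign_mean_cons /sym2.
by rewrite (addrAC y b a) (addrAC y b (- a)) (addrAC y (- b) a) (addrAC y (- b) (- a)); lra.
Qed.

Lemma sign_meanC l1 l2 f y :
  sign_mean l1 (sign_mean l2 f) y = sign_mean l2 (sign_mean l1 f) y.
Proof.
elim: l1 y => [//|a l IH] y.
by rewrite [RHS](sign_mean_sym2 a l2 (sign_mean l f)) [LHS]/= /sym2 !IH.
Qed.

Lemma le_sign_mean l f g : (forall y, f y <= g y) -> forall y, sign_mean l f y <= sign_mean l g y.
Proof.
move=> fg; elim: l => [//|a l IH] y.
by rewrite !sign_mean_cons /sym2; have := IH (y + a); have := IH (y - a); lra.
Qed.

Lemma sign_mean_dist l f g (d : R) : (forall y, `|f y - g y| <= d) ->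
  forall y, `|sign_mean l f y - sign_mean l g y| <= d.
Proof.
move=> fg; elim: l => [//|a l IH] y; rewrite !sign_mean_cons /sym2.
have := IH (y + a); have := IH (y - a); rewrite !ler_norml; lra.
Qed.

Definition abs_sum l : R := \sum_(a <- l) `|a|.
Definition sqr_sum l : R := \sum_(a <- l) a ^+ 2.

Lemma abs_sum_ge0 l : 0 <= abs_sum l.
Proof. exact: sumr_ge0. Qed.

Lemma sqr_sum_ge0 l : 0 <= sqr_sum l.
Proof. by apply: sumr_ge0 => a _; exact: sqr_ge0. Qed.

Lemma sqr_sum_le l : sqr_sum l <= abs_sum l ^+ 2.
Proof.
elim: l => [|a l IH]; first by rewrite /sqr_sum /abs_sum !big_nil expr0n.
rewrite /sqr_sum /abs_sum !big_cons -/(sqr_sum l) -/(abs_sum l).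
have := abs_sum_ge0 l; have := normr_ge0 a; rewrite -(real_normK (num_real a)); nra.
Qed.

(** g stands for half the second derivative of f. Peeling off a sign a moves g from y + a and y - a
    back to y, at the cost of 3 C |a| times the sum of squares v of the rest. As v <= s^2, with s
    the sum of the absolute values of the rest, this fits into the cross term 3 s^2 |a| of (|a| +
    s)^3. *)
Lemma sign_mean_block (C : R) f g l : 0 <= C ->
  (forall y a, `|a| <= 1 -> `|sym2 a f y - f y - a ^+ 2 * g y| <= C * `|a| ^+ 3) ->
  (forall y a, `|g (y + a) - g y| <= 3 * C * `|a|) ->
  (forall a, a \in l -> `|a| <= 1) ->
  forall y, `|sign_mean l f y - f y - sqr_sum l * g y| <= C * abs_sum l ^+ 3.
Proof.
move=> C0 Hf Hg; elim: l => [|a l IH] l1 y.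
  by rewrite /sqr_sum /abs_sum !big_nil mul0r subr0 subrr normr0 mulr_ge0// exprn_ge0.
have a1 : `|a| <= 1 by apply: l1; rewrite mem_head.
have {}IH := IH (fun b bl => l1 b (mem_behead (s := a :: l) bl)).
rewrite sign_mean_cons /sqr_sum /abs_sum !big_cons -/(sqr_sum l) -/(abs_sum l).
have := Hf y a a1; rewrite /sym2.
have := IH (y + a); have := IH (y - a).
have := Hg y a; have := Hg y (- a); rewrite normrN.
have := sqr_sum_ge0 l; have := sqr_sum_le l; have := abs_sum_ge0 l; have := normr_ge0 a.
move: (`|a|) (abs_sum l) (sqr_sum l) (sign_mean l f (y + a)) (sign_mean l f (y - a)).
move=> A s v P Q A0 s0 vs v0; rewrite !ler_norml.
move=> /andP[g1 g2] /andP[g3 g4] /andP[p1 p2] /andP[q1 q2] /andP[f1 f2].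
have K : C * s ^+ 3 + C * A ^+ 3 + v * (3 * C * A) <= C * (A + s) ^+ 3.
  have : v * (3 * C * A) <= s ^+ 2 * (3 * C * A) by rewrite ler_wpM2r// !mulr_ge0.
  have : 0 <= C * (A ^+ 2 * s) by rewrite !mulr_ge0// exprn_ge0.
  lra.
have := ler_wpM2l v0 g1; have := ler_wpM2l v0 g2.
have := ler_wpM2l v0 g3; have := ler_wpM2l v0 g4.
move=> h1 h2 h3 h4; apply/andP; split; lra.
Qed.

Definition rep N l : seq R := flatten (nseq N l).

(* Lindeberg's replacement: one block l at a time is exchanged for l'. *)
Lemma sign_mean_rep (d : R) f l l' N :
  (forall y, `|sign_mean l f y - sign_mean l' f y| <= d) ->
  forall y, `|sign_mean (rep N l) f y - sign_mean (rep N l') f y| <= N%:R * d.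
Proof.
move=> H; elim: N => [|N IH] y; first by rewrite /rep/= subrr normr0 mul0r.
rewrite /rep/= -!/(rep _ _) !sign_mean_cat.
rewrite -[X in `|X|](subrKA (sign_mean l (sign_mean (rep N l') f) y)).
rewrite -natr1 mulrDl mul1r (le_trans (ler_normD _ _))// lerD//.
  exact: sign_mean_dist.
(* Signs commute, so the exchanged block can be moved next to f, where the hypothesis applies. *)
rewrite (sign_meanC l) (sign_meanC l').
exact: sign_mean_dist.
Qed.

Lemma sqr_sum_rep N l : sqr_sum (rep N l) = N%:R * sqr_sum l.
Proof.
elim: N => [|N IH]; first by rewrite /rep /sqr_sum/= big_nil mul0r.
by rewrite /rep/= -/(rep N l) /sqr_sum big_cat/= -!/(sqr_sum _) IH -natr1 mulrDl mul1r addrC.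
Qed.

Lemma sign_mean_sqr l y : sign_mean l (fun z => z ^+ 2) y = y ^+ 2 + sqr_sum l.
Proof.
elim: l y => [|a l IH] y; first by rewrite /sqr_sum big_nil addr0.
by rewrite sign_mean_cons /sym2 !IH /sqr_sum big_cons -/(sqr_sum l); field.
Qed.

(** The right-hand side is the fourth moment of y plus a centred Gaussian of variance [sqr_sum l];
    each sign a leaves a slack of 2 a^4. *)
Lemma sign_mean_pow4 l y :
  sign_mean l (fun z => z ^+ 4) y <= y ^+ 4 + 6 * sqr_sum l * y ^+ 2 + 3 * sqr_sum l ^+ 2.
Proof.
elim: l y => [|a l IH] y; first by rewrite /sqr_sum big_nil/= mulr0 mul0r expr0n/= mulr0 !addr0.
rewrite sign_mean_cons /sym2 /sqr_sum big_cons -/(sqr_sum l).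
have := IH (y + a); have := IH (y - a).
have : 0 <= a ^+ 4 by rewrite (exprM a 2 2) sqr_ge0.
set v := sqr_sum l; lra.
Qed.

Lemma sign_mean_lin l (c d : R) f g y :
  sign_mean l (fun z => c * f z + d * g z) y = c * sign_mean l f y + d * sign_mean l g y.
Proof.
by elim: l y => [//|a l IH] y; rewrite !sign_mean_cons /sym2 !IH; field.
Qed.

Lemma quartic_le (t : R) : 0 <= t -> t ^+ 2 - t ^+ 4 / 4 <= t.
Proof.
move=> t0; suff : 0 <= t * (1 - t + t ^+ 3 / 4) by lra.
(* 7/6 approximates the minimizer 2/sqrt 3 of 1 - t + t^3/4, and 7/3 cancels the quadratic term. *)
have h : 0 <= (t - 7 / 6) ^+ 2 * (t + 7 / 3) by rewrite mulr_ge0 ?sqr_ge0// addr_ge0.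
by rewrite mulr_ge0//; lra.
Qed.

(* Paley-Zygmund type bound, from [t >= t^2 - t^4 / 4] for t >= 0. *)
Lemma sign_mean_abs_ge l (k : R) : 0 < k -> sqr_sum l = k ^+ 2 ->
  k / 4 <= sign_mean l (fun z => `|z|) 0.
Proof.
move=> k0 lk.
have H z : (2 * k)^-1 * z ^+ 2 + - (4 * (2 * k) ^+ 3)^-1 * z ^+ 4 <= `|z|.
  rewrite -(real_normK (num_real z)) (exprM z 2 2) -(real_normK (num_real z)) -exprM.
  have := normr_ge0 z; move: (`|z|) => w w0 {z}.
  (* At the scale 2 k the second and fourth moments give k/2 - 3k/32 = 13k/32, which exceeds k/4. *)
  pose t : R := w / (2 * k).
  have t0 : 0 <= t by rewrite divr_ge0// mulr_ge0// ltW.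
  have -> : w = 2 * k * t by rewrite /t; field; rewrite gt_eqF.
  have -> : (2 * k)^-1 * (2 * k * t) ^+ 2 + - (4 * (2 * k) ^+ 3)^-1 * (2 * k * t) ^+ (2 * 2) =
      (2 * k) * (t ^+ 2 - t ^+ 4 / 4) by field; rewrite gt_eqF.
  by rewrite ler_pM2l ?mulr_gt0//; exact: quartic_le.
have := le_sign_mean l H 0; rewrite sign_mean_lin sign_mean_sqr.
have := sign_mean_pow4 l 0; rewrite lk !expr0n/= mulr0 !add0r.
set M := sign_mean _ _ 0; set P := sign_mean _ _ 0 => M4; apply: le_trans.
have c0 : 0 < (4 * (2 * k) ^+ 3)^-1 by rewrite invr_gt0 mulr_gt0// exprn_gt0// mulr_gt0.
have : (4 * (2 * k) ^+ 3)^-1 * M <= (4 * (2 * k) ^+ 3)^-1 * (3 * (k ^+ 2) ^+ 2) by rewrite ler_pM2l.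
have -> : (4 * (2 * k) ^+ 3)^-1 * (3 * (k ^+ 2) ^+ 2) = 3 / 32 * k by field; rewrite gt_eqF.
have -> : (2 * k)^-1 * k ^+ 2 = k / 2 by field; rewrite gt_eqF.
lra.
Qed.

End rademacher.

(** * A smooth absolute value and its second-order expansion *)

Section smoothed_abs.
Variable R : realType.
Implicit Types (a y : R).

(* A smooth substitute for the absolute value, at distance at most 1 from it. *)
Definition sabs y : R := Num.sqrt (1 + y ^+ 2).

Lemma sqr_sabs y : sabs y ^+ 2 = 1 + y ^+ 2.
Proof. by rewrite sqr_sqrtr// addr_ge0// sqr_ge0. Qed.

Lemma sabs_ge1 y : 1 <= sabs y.
Proof. by rewrite -[leLHS]sqrtr1 ler_sqrt ?lerDl ?sqr_ge0// addr_ge0// sqr_ge0. Qed.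

Lemma sabs_ge0 y : 0 <= sabs y.
Proof. exact: sqrtr_ge0. Qed.

Lemma abs_le_sabs y : `|y| <= sabs y.
Proof.
rewrite -(@ler_pXn2r _ 2) ?nnegrE ?sabs_ge0// sqr_sabs real_normK ?num_real//.
by rewrite lerDr.
Qed.

Lemma sabs_abs_dist y : `|sabs y - `|y| | <= 1.
Proof.
rewrite ger0_norm ?subr_ge0 ?abs_le_sabs// lerBlDr.
rewrite -(@ler_pXn2r _ 2) ?nnegrE ?sabs_ge0 ?addr_ge0// sqr_sabs sqrrD.
by rewrite real_normK ?num_real// expr1n; have := normr_ge0 y; lra.
Qed.

Lemma sabs_lip y z : `|sabs y - sabs z| <= `|y - z|.
Proof.
have s0 : 0 < sabs y + sabs z by have := sabs_ge1 y; have := sabs_ge1 z; lra.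
rewrite -(ler_pM2r s0) -[X in _ * X](gtr0_norm s0) -normrM -subr_sqr !sqr_sabs.
rewrite (_ : _ - _ = (y - z) * (y + z)); last by ring.
rewrite normrM ler_wpM2l// (le_trans (ler_normD _ _))//.
by rewrite lerD ?abs_le_sabs.
Qed.

(** Half the second derivative of sqrt(1 + y^2) is 1/(2 r^3) with r = [sabs y]. The second
    difference d = p + q - 2 r is handled algebraically: multiplied by (p + q)(p + r)(q + r) it
    becomes a^2 times an expression free of differences of roots. *)
Lemma sabs_taylor y a : `|a| <= 1 ->
  `|sym2 a sabs y - sabs y - a ^+ 2 * (2 * sabs y ^+ 3)^-1| <= 15 * `|a| ^+ 3.
Proof.
move=> a1; rewrite /sym2.
have hp := sabs_lip (y + a) y; have hq := sabs_lip (y - a) y.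
rewrite addrAC subrr add0r in hp; rewrite addrAC subrr add0r normrN in hq.
have p2 := sqr_sabs (y + a); have q2 := sqr_sabs (y - a); have r2 := sqr_sabs y.
have p1 := sabs_ge1 (y + a); have q1 := sabs_ge1 (y - a); have r1 := sabs_ge1 y.
move: (sabs (y + a)) (sabs (y - a)) (sabs y) hp hq p2 q2 r2 p1 q1 r1.
move=> p q r hp hq p2 q2 r2 p1 q1 r1.
set A := `|a| in a1 hp hq *.
have A0 : 0 <= A by exact: normr_ge0.
have aA : a ^+ 2 = A ^+ 2 by rewrite real_normK// num_real.
pose d := p + q - 2 * r.
have d2A : d <= 2 * A by move: hp hq; rewrite !ler_norml /d => /andP[_ ?] /andP[_ ?]; lra.
(* Midpoint convexity, from p q >= 1 + y^2 - a^2. *)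
have d0 : 0 <= d.
  suff : 2 * r <= p + q by rewrite /d; lra.
  rewrite -(@ler_pXn2r _ 2) ?nnegrE ?mulr_ge0 ?addr_ge0 ?(le_trans _ r1) ?(le_trans _ p1) ?(le_trans _ q1)//.
  have pq : (1 + y ^+ 2 - a ^+ 2) <= p * q.
    have [h|h] := leP (1 + y ^+ 2 - a ^+ 2) 0; first by rewrite (le_trans h)// mulr_ge0; lra.
    rewrite -(@ler_pXn2r _ 2) ?nnegrE ?mulr_ge0 ?(ltW h) ?(le_trans _ p1) ?(le_trans _ q1)//.
    rewrite exprMn p2 q2; have := sqr_ge0 a; nra.
  have -> : (p + q) ^+ 2 = p ^+ 2 + q ^+ 2 + 2 * (p * q) by ring.
  rewrite exprMn r2 p2 q2; lra.
have X2 : p + q = 2 * r + d by rewrite /d; ring.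
have YW : (p + r) * (q + r) = (p + q) ^+ 2 / 2 + r * (p + q) - a ^+ 2.
  have -> : (p + r) * (q + r) = ((p + q) ^+ 2 - (p ^+ 2 + q ^+ 2)) / 2 + r * (p + q) + r ^+ 2 by field.
  by rewrite p2 q2 r2; field.
have XYW0 : 2 * r ^+ 3 <= (p + q) * ((p + r) * (q + r)).
  have : r * r <= (p + r) * (q + r) by rewrite ler_pM; lra.
  have : 2 * r <= p + q by rewrite X2 lerDl.
  move=> h1 h2; have -> : 2 * r ^+ 3 = (2 * r) * (r * r) by ring.
  by rewrite ler_pM// mulr_ge0//; lra.
have r0 : 0 < r by lra.
have r30 : 0 < r ^+ 3 by rewrite exprn_gt0.
have dE : d * ((p + q) * ((p + r) * (q + r))) = a ^+ 2 * ((p + q) ^+ 2 + 2 * r * (p + q) - 8 * y ^+ 2).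
  have hpr : (p - r) * (p + r) = 2 * y * a + a ^+ 2 by rewrite -subr_sqr p2 r2; ring.
  have hqr : (q - r) * (q + r) = - 2 * y * a + a ^+ 2 by rewrite -subr_sqr q2 r2; ring.
  have hqp : (q - p) * (p + q) = - 4 * y * a by rewrite (addrC p) -subr_sqr q2 p2; ring.
  have -> : d * ((p + q) * ((p + r) * (q + r))) =
     (p + q) * (((p - r) * (p + r)) * (q + r) + ((q - r) * (q + r)) * (p + r)) by rewrite /d; ring.
  rewrite hpr hqr.
  have -> : (p + q) * ((2 * y * a + a ^+ 2) * (q + r) + (- 2 * y * a + a ^+ 2) * (p + r)) =
     a ^+ 2 * ((p + q) ^+ 2 + 2 * r * (p + q)) + 2 * y * a * ((q - p) * (p + q)) by ring.
  by rewrite hqp; ring.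
have num : `|d - a ^+ 2 / r ^+ 3| <= 30 * A ^+ 3.
  have Z0 : 0 < (p + q) * ((p + r) * (q + r)) by apply: lt_le_trans XYW0; rewrite mulr_gt0.
  set Z := (p + q) * _ in Z0 XYW0 dE.
  pose N := 6 * r ^+ 4 * d + r ^+ 3 * d ^+ 2 - 10 * r ^+ 2 * d - 4 * r * d ^+ 2 - d ^+ 3 / 2 + (2 * r + d) * a ^+ 2.
  have ZE : Z = (2 * r + d) * (4 * r ^+ 2 + 3 * r * d + d ^+ 2 / 2 - a ^+ 2).
    by rewrite /Z YW X2; field.
  have NE : (d - a ^+ 2 / r ^+ 3) * (Z * r ^+ 3) = a ^+ 2 * N.
    have -> : (d - a ^+ 2 / r ^+ 3) * (Z * r ^+ 3) = (d * Z) * r ^+ 3 - a ^+ 2 * Z by field; rewrite gt_eqF.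
    rewrite dE ZE X2 (_ : y ^+ 2 = r ^+ 2 - 1); last by rewrite r2; ring.
    by rewrite /N; field.
  have ZrE : 0 < Z * r ^+ 3 by rewrite mulr_gt0.
  rewrite -(ler_pM2r ZrE) -[X in _ * X <= _](gtr0_norm ZrE) -normrM NE normrM ger0_norm ?sqr_ge0// aA.
  (* Each of the seven monomials of N is a multiple of r^4 A at most, by r >= 1, A <= 1 and d <= 2
     A; in order, 12 + 4 + 20 + 16 + 4 + 2 + 2 = 60. *)
  have N60 : `|N| <= 60 * r ^+ 4 * A.
    have r40 : 0 <= r ^+ 4 by rewrite exprn_ge0// ltW.
    have rk (k : nat) : (k <= 4)%N -> 0 <= r ^+ k /\ r ^+ k <= r ^+ 4.
      by move=> k4; rewrite exprn_ge0 ?(ltW r0)// ler_weXn2l.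
    have [r30' r34] := rk 3%N isT; have [r20' r24] := rk 2%N isT.
    have [r10' r14] := rk 1%N isT; have [_ r04] := rk 0%N isT.
    rewrite expr1 in r10' r14; rewrite expr0 in r04.
    have dd : d ^+ 2 <= 4 * A by rewrite expr2; nra.
    have dd0 : 0 <= d ^+ 2 by exact: sqr_ge0.
    have d2 : d <= 2 by lra.
    have ddd : d ^+ 3 <= 8 * A.
      have -> : 8 * A = 2 * (4 * A) by ring.
      by rewrite exprS; apply: ler_pM.
    have ddd0 : 0 <= d ^+ 3 by rewrite exprn_ge0.
    have AA : A ^+ 2 <= A by rewrite expr2; nra.
    have AA0 : 0 <= A ^+ 2 by exact: sqr_ge0.
    have m (x y' z w : R) : 0 <= x -> 0 <= z -> x <= y' -> z <= w -> 0 <= x * z /\ x * z <= y' * w.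
      by move=> *; split; [rewrite mulr_ge0|rewrite ler_pM].
    have [t1 t1'] := m _ _ _ _ r40 d0 (lexx (r ^+ 4)) d2A.
    have [t2 t2'] := m _ _ _ _ r30' dd0 r34 dd.
    have [t3 t3'] := m _ _ _ _ r20' d0 r24 d2A.
    have [t4 t4'] := m _ _ _ _ r10' dd0 r14 dd.
    have [t5 t5'] := m _ _ _ _ ler01 ddd0 r04 ddd.
    have [t6 t6'] := m _ _ _ _ r10' AA0 r14 AA.
    have [t7 t7'] := m _ _ _ _ d0 AA0 (le_trans d2A (ler_piMr (ler0n _ 2) a1)) AA.
    have [t8 t8'] := m _ _ _ _ ler01 A0 r04 (lexx A).
    rewrite ler_norml /N aA; apply/andP; split; lra.
  apply: (@le_trans _ _ (A ^+ 2 * (60 * r ^+ 4 * A))); first by rewrite ler_wpM2l// exprn_ge0.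
  have -> : A ^+ 2 * (60 * r ^+ 4 * A) = 30 * A ^+ 3 * (2 * r ^+ 4) by ring.
  rewrite ler_wpM2l//; first by rewrite mulr_ge0// exprn_ge0.
  apply: (@le_trans _ _ ((2 * r ^+ 3) * r ^+ 3)); last by rewrite ler_pM2r.
  have -> : 2 * r ^+ 3 * r ^+ 3 = 2 * (r ^+ 4 * r ^+ 2) by ring.
  rewrite ler_pM2l// ler_peMr ?exprn_ge0 ?(ltW r0)//.
  by rewrite expr_ge1// ltW.
have -> : (p + q) / 2 - r - a ^+ 2 / (2 * r ^+ 3) = (d - a ^+ 2 / r ^+ 3) / 2.
  by rewrite /d; field; rewrite gt_eqF.
rewrite normrM (ger0_norm (x := 2^-1))//; lra.
Qed.

(** The constant is written as 3 C with the C = 15 of [sabs_taylor], the form that [sign_mean_block]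
    asks for. *)
Lemma inv_sabs_lip y a :
  `|(2 * sabs (y + a) ^+ 3)^-1 - (2 * sabs y ^+ 3)^-1| <= 3 * 15 * `|a|.
Proof.
have := sabs_lip (y + a) y; rewrite addrAC subrr add0r.
have := sabs_ge1 (y + a); have := sabs_ge1 y.
move: (sabs (y + a)) (sabs y) => p r r1 p1 pr.
have [p0 r0] : 0 < p /\ 0 < r by split; lra.
have -> : (2 * p ^+ 3)^-1 - (2 * r ^+ 3)^-1 =
    - (p - r) * ((p ^+ 2 + p * r + r ^+ 2) / (2 * p ^+ 3 * r ^+ 3)).
  by field; rewrite !gt_eqF.
rewrite normrM normrN mulrC ler_pM//.
have D0 : 0 < 2 * p ^+ 3 * r ^+ 3 by rewrite !mulr_gt0// exprn_gt0.
rewrite ger0_norm; last by rewrite divr_ge0 ?(ltW D0)// !addr_ge0 ?mulr_ge0 ?exprn_ge0// ltW.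
rewrite ler_pdivrMr//.
have ge1 (k : nat) (x : R) : 1 <= x -> 1 <= x ^+ k by move=> ?; rewrite exprn_ege1.
have pr1 : 1 <= p * r by rewrite -[leLHS]mul1r ler_pM.
have h1 : p * r <= p ^+ 3 * r ^+ 3.
  by rewrite -exprMn -[leLHS]expr1 ler_weXn2l.
have h2 : p ^+ 2 <= p ^+ 3 * r ^+ 3.
  rewrite -[leLHS]mulr1 ler_pM ?exprn_ge0 ?(ltW p0)// ?ge1//.
  by rewrite ler_weXn2l.
have h3 : r ^+ 2 <= p ^+ 3 * r ^+ 3.
  rewrite -[leLHS]mul1r ler_pM ?exprn_ge0 ?(ltW r0)// ?ge1//.
  by rewrite ler_weXn2l.
have : 0 < p ^+ 3 * r ^+ 3 by rewrite mulr_gt0// exprn_gt0.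
lra.
Qed.

End smoothed_abs.

(** * Sums of |<x, u>| close to the Euclidean norm *)

Section ball_zonotope.
Variable R : realType.

Fixpoint signed_sums n (ws : seq 'rV[R]_n) : seq 'rV[R]_n :=
  if ws is w :: ws' then
    [seq u + w | u <- signed_sums ws'] ++ [seq u - w | u <- signed_sums ws']
  else [:: 0].

Lemma sum_signed_sums n (ws : seq 'rV[R]_n) (x : 'rV[R]_n) (phi : R -> R) y :
  \sum_(u <- signed_sums ws) phi (y + dot x u) =
  2 ^+ size ws * sign_mean [seq dot x w | w <- ws] phi y.
Proof.
elim: ws y => [|w ws IH] y /=.
  by rewrite big_seq1 -(scale0r 0) dotZr mul0r addr0 expr0 mul1r.
rewrite big_cat !big_map/=.
rewrite (eq_bigr (fun u => phi ((y + dot x w) + dot x u))); last first.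
  by move=> u _; rewrite dotDr; congr phi; ring.
rewrite [X in _ + X](eq_bigr (fun u => phi ((y - dot x w) + dot x u))); last first.
  by move=> u _; rewrite dotDr dotNr; congr phi; ring.
by rewrite !IH /sym2 exprS; field.
Qed.

Lemma map_rep (T : Type) (f : T -> R) N (s : seq T) :
  map f (flatten (nseq N s)) = rep N (map f s).
Proof. by rewrite map_flatten map_nseq. Qed.

Lemma dist_ratio (p q d e : R) : - d <= p - q -> p - q <= d -> q + d <= (1 + e) * (q - d) ->
  (q - d <= p) && (p <= (1 + e) * (q - d)).
Proof. by move=> *; apply/andP; split; lra. Qed.

(** The vectors u are multiples of the signed sums of N copies of eta times the standard basis. For
    a unit vector x, the block of coordinates has sum of squares eta^2 whatever x is, so the mean h
    x varies by at most D over the unit sphere, while it is at least k/4. Homogeneity of h gives the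
    rest. *)
Lemma near_euclidean_norm n (e : R) : 0 < e -> exists us : seq 'rV[R]_n,
  forall x, enorm x <= \sum_(u <- us) `|dot x u| <= (1 + e) * enorm x.
Proof.
move=> e0; case: n => [|n].
  by exists [::] => x; rewrite (thinmx0 x) enorm0 big_nil mulr0 lexx.
(* The 2 pays for passing from the absolute value to [sabs] and back; the rest is N times the two
   block errors 15 (eta (n+1))^3, with N eta^3 = 1. *)
pose D : R := 2 + 30 * n.+1%:R ^+ 3.
have D0 : 0 < D by rewrite ltr_wpDr// mulr_ge0// exprn_ge0.
(* D (2 + e) <= e h(e1) amounts to h(e1) + D <= (1 + e)(h(e1) - D), and h(e1) >= k/4. *)
pose k := (Num.truncn (4 * (D * (2 + e) / e))).+1.
have k0 : (0 : R) < k%:R by rewrite ltr0n.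
have kD : D * (2 + e) / e < k%:R / 4.
  by have := truncnS_gt (4 * (D * (2 + e) / e)); rewrite -/k; lra.
(* N eta^3 = 1 keeps the accumulated error bounded, while the variance N eta^2 = k^2 grows. *)
pose N := (k ^ 6)%N; pose eta : R := k%:R ^- 2.
have k1 : (1 : R) <= k%:R by rewrite ler1n.
have eta0 : 0 < eta by rewrite invr_gt0 exprn_gt0.
have eta1 : eta <= 1 by rewrite invf_le1 ?exprn_gt0// exprn_ege1.
have Neta3 : N%:R * eta ^+ 3 = 1.
  by rewrite /N /eta natrX; field; rewrite gt_eqF.
have Neta2 : N%:R * eta ^+ 2 = k%:R ^+ 2.
  by rewrite /N /eta natrX; field; rewrite gt_eqF.
pose bs : seq 'rV[R]_n.+1 := [seq eta *: delta_mx 0 i | i <- enum 'I_n.+1].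
pose ws := flatten (nseq N bs).
pose b (x : 'rV[R]_n.+1) := [seq eta * x ord0 i | i <- enum 'I_n.+1].
have bE x : map (dot x) bs = b x.
  rewrite /bs -map_comp; apply: eq_map => i /=; rewrite dotZr; congr (_ * _).
  rewrite /dot (bigD1 i)//= mxE !eqxx mulr1 big1 ?addr0// => j ji.
  by rewrite mxE eqxx (negbTE ji) mulr0.
have wsE x : map (dot x) ws = rep N (b x) by rewrite /ws map_rep bE.
have b1 x : enorm x = 1 -> forall a, a \in b x -> `|a| <= 1.
  move=> x1 _ /mapP[i _ ->]; rewrite normrM (gtr0_norm eta0).
  by rewrite -[leRHS]mul1r ler_pM// -?x1 ?coord_le_enorm// ltW.
have bsqr x : enorm x = 1 -> sqr_sum (b x) = eta ^+ 2.
  move=> x1; rewrite /sqr_sum /b big_map big_enum/=.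
  under eq_bigr do rewrite exprMn.
  rewrite -mulr_sumr; have := sqr_enorm x; rewrite x1 expr1n /dot => <-.
  by rewrite mulr1.
have babs x : enorm x = 1 -> abs_sum (b x) <= eta * n.+1%:R.
  move=> x1; rewrite /abs_sum /b big_map big_enum/=.
  under eq_bigr do rewrite normrM (gtr0_norm eta0).
  rewrite -mulr_sumr ler_pM2l// -[n.+1 in leRHS]card_ord -sum1_card natr_sum.
  by apply: ler_sum => i _; rewrite -x1 coord_le_enorm.
pose h (x : 'rV[R]_n.+1) := sign_mean (rep N (b x)) (fun z : R => `|z|) 0.
have hge x : enorm x = 1 -> k%:R / 4 <= h x.
  by move=> x1; apply: sign_mean_abs_ge => //; rewrite sqr_sum_rep bsqr.
have hdist x x' : enorm x = 1 -> enorm x' = 1 -> `|h x - h x'| <= D.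
  move=> x1 x1'.
  pose g y : R := (2 * sabs y ^+ 3)^-1.
  have blk z : enorm z = 1 -> forall y, `|sign_mean (b z) (@sabs R) y - sabs y - eta ^+ 2 * g y| <= 15 * (eta * n.+1%:R) ^+ 3.
    move=> z1 y; rewrite -(bsqr z z1).
    apply: le_trans (_ : 15 * abs_sum (b z) ^+ 3 <= _).
      apply: sign_mean_block => //; first exact: sabs_taylor.
        exact: inv_sabs_lip.
      exact: b1.
    by rewrite ler_pM2l// lerXn2r ?nnegrE ?abs_sum_ge0 ?babs// mulr_ge0// ltW.
  have dd y : `|sign_mean (b x) (@sabs R) y - sign_mean (b x') (@sabs R) y| <= 30 * (eta * n.+1%:R) ^+ 3.
    by have := blk x x1 y; have := blk x' x1' y; rewrite !ler_norml => /andP[? ?] /andP[? ?]; apply/andP; split; lra.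
  have := sign_mean_rep N dd 0.
  have E3 (p q r : R) : p * (30 * (q * r) ^+ 3) = p * q ^+ 3 * (30 * r ^+ 3) by ring.
  rewrite E3 Neta3 mul1r.
  have s1 z := sign_mean_dist (rep N (b z)) (@sabs_abs_dist R) 0.
  have := s1 x; have := s1 x'; rewrite -!/(h _).
  by rewrite /D !ler_norml => /andP[? ?] /andP[? ?] /andP[? ?]; apply/andP; split; lra.
pose e1 : 'rV[R]_n.+1 := delta_mx 0 0.
have e11 : enorm e1 = 1.
  rewrite /enorm /dot (bigD1 ord0)//= mxE eqxx mulr1 big1 ?addr0 ?sqrtr1// => j j0.
  by rewrite mxE eqxx (negbTE j0) mulr0.
(* A lower bound for h on unit vectors; dividing by it puts the values of h into [1, 1 + e]. *)
pose c := h e1 - D.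
have h1 := hge e1 e11.
have De : D < D * (2 + e) / e by rewrite ltr_pdivlMr// ltr_pM2l//; lra.
have c0 : 0 < c by rewrite /c; lra.
have cD : h e1 + D <= (1 + e) * c.
  have : D * (2 + e) <= h e1 * e by rewrite -ler_pdivrMr//; lra.
  by rewrite /c; lra.
pose s : R := (2 ^+ size ws * c)^-1.
have s0 : 0 < s by rewrite invr_gt0 mulr_gt0// exprn_gt0.
exists [seq s *: u | u <- signed_sums ws] => x.
rewrite big_map; under eq_bigr do rewrite dotZr normrM (gtr0_norm s0) -[dot _ _]add0r.
rewrite -mulr_sumr (sum_signed_sums ws x (fun z => `|z|) 0) wsE -/(h x).
have hx : s * (2 ^+ size ws * h x) = h x / c.
  by rewrite /s invfM mulrACA mulVf ?mul1r 1?mulrC// gt_eqF// exprn_gt0.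
rewrite hx.
have [->|x0] := eqVneq x 0.
  rewrite enorm0 mulr0 (_ : h 0 = 0) ?mul0r ?lexx//.
  rewrite /h; have : all (pred1 0) (rep N (b 0)).
    by apply/allP => a; rewrite /rep => /flattenP[l /nseqP[-> _] /mapP[i _ ->]] /=; rewrite mxE mulr0.
  elim: (rep N (b 0)) => [|a l IH] /=; first by rewrite normr0.
  by move=> /andP[/eqP -> /IH]; rewrite /sym2 subr0 addr0 => ->; rewrite addr0 mul0r.
have nx : 0 < enorm x by rewrite lt_neqAle eq_sym enorm_eq0 x0 enorm_ge0.
have hZ (a : R) (y : 'rV[R]_n.+1) : 0 <= a -> h (a *: y) = a * h y.
  move=> a0; rewrite /h; have -> : rep N (b (a *: y)) = map ( *%R a) (rep N (b y)).
    rewrite /rep map_flatten map_nseq; congr (flatten (nseq _ _)); rewrite /b -[RHS]map_comp.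
    by apply: eq_map => i /=; rewrite mxE mulrCA.
  rewrite -[X in sign_mean _ _ X](mulr0 a); move: (rep N (b y)) 0.
  elim=> [|d l IH] z; first by rewrite /= normrM (ger0_norm a0).
  by rewrite /= /sym2 -mulrDr -mulrBr !IH -mulrDr mulrA.
pose u := (enorm x)^-1 *: x.
have u1 : enorm u = 1 by rewrite enormZ gtr0_norm ?invr_gt0// mulVf// gt_eqF.
have xu : x = enorm x *: u by rewrite scalerA divff ?scale1r// gt_eqF.
rewrite [in h x]xu hZ ?enorm_ge0// -mulrA; have := hdist u e1 u1 e11.
rewrite ler_norml => /andP[hu1 hu2].
rewrite ler_pMr// [(1 + e) * _]mulrC ler_pM2l// ler_pdivlMr// ler_pdivrMr// mul1r.
exact: dist_ratio.
Qed.

End ball_zonotope.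

(** * From support functions to inclusions *)

Section zonotope_approximation.
Variable R : realType.

(** Support functions add under Minkowski sums, and on a segment the maximum is reached at the
    coefficient [Num.sg (dot x u)]. *)
Lemma zonotope_support n (us : seq 'rV[R]_n) (x : 'rV[R]_n) :
  (exists2 z, zonotope us z & dot x z = \sum_(u <- us) `|dot x u|) /\
  (forall z, zonotope us z -> dot x z <= \sum_(u <- us) `|dot x u|).
Proof.
elim: us => [|u us [[z Zz zE] Hle]] /=.
  by rewrite big_nil; split=> [|z ->]; [exists 0|]; rewrite // dotC dot0l.
rewrite big_cons; split.
  exists (Num.sg (dot x u) *: u + z); last by rewrite dotDr dotZr zE -normrEsg.
  exists (Num.sg (dot x u) *: u); last by exists z.
  exists (Num.sg (dot x u)) => //; rewrite /= in_itv/=.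
  by case: sgrP => _; lra.
move=> _ [_ [s + <-] [w Zw <-]]; rewrite /= in_itv/= -ler_norml => s1.
rewrite dotDr lerD ?Hle// dotZr (le_trans (ler_norm _))// normrM ler_piMl//.
Qed.

(** With z0 a point of Z nearest to x, the direction x - z0 separates: if z - z0 had a positive
    product with it, moving from z0 towards z would come closer to x. *)
Lemma separation n (Z : set 'rV[R]_n) (x : 'rV[R]_n) : compact Z -> cvx Z -> Z !=set0 ->
  ~ Z x -> exists w, forall z, Z z -> dot w z < dot w x.
Proof.
move=> kZ cZ Z0 nZx.
pose g (z : 'rV[R]_n) : R := dot (z - x) (z - x).
have gE z : g z = dot (x - z) (x - z) by rewrite /g -opprB dotNl dotNr opprK.
have cg : {within Z, continuous g}.
  apply: continuous_subspaceT => z.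
  have c1 : {for z, continuous (fun z : 'rV[R]_n => z - x)} by exact: (cvgB cvg_id (cvg_cst x)).
  exact: (continuous_comp c1 (@continuous_sqr_dot R n (z - x))).
have [z0 /set_mem Zz0 z0min] := @compact_EVT_min _ R g Z Z0 kZ cg.
exists (x - z0) => z Zz.
have w0 : 0 < dot (x - z0) (x - z0).
  rewrite lt_neqAle dot_ge0 andbT eq_sym dot_eq0 subr_eq0.
  by apply/eqP => xz; apply: nZx; rewrite xz.
suff : dot (x - z0) (z - z0) <= 0.
  by move: w0; rewrite !(dotDr (x - z0)) !dotNr; lra.
rewrite leNgt; apply/negP => d0.
set d := dot (x - z0) (z - z0) in d0; pose e := dot (z - z0) (z - z0).
have e0 : 0 <= e by exact: dot_ge0.
(* This step is at most 1 and satisfies t e = d - t d, so the squared distance changes by t^2 e - 2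
   t d = - t d - t^2 d < 0. *)
pose t := d / (d + e).
have de : 0 < d + e by rewrite ltr_pwDl.
have t0 : 0 < t by rewrite divr_gt0.
have t1 : t <= 1 by rewrite ler_pdivrMr// mul1r lerDl.
have Zt : Z ((1 - t) *: z0 + t *: z) by apply: cZ; rewrite ?subr_ge0 ?subrK// ltW.
have := z0min _ (mem_set Zt); rewrite !gE.
have -> : x - ((1 - t) *: z0 + t *: z) = (x - z0) - t *: (z - z0).
  by apply/rowP => i; rewrite !mxE; ring.
have dsub (w v : 'rV[R]_n) (c : R) : dot (w - c *: v) (w - c *: v) =
    dot w w - 2 * (c * dot w v) + c * (c * dot v v).
  by rewrite dotDl !dotDr !dotNl !dotNr !dotZl !dotZr (dotC v); ring.
rewrite dsub -/d -/e.
have te : t * e = d - t * d by rewrite /t; field; rewrite gt_eqF.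
have td : 0 < t * d by rewrite mulr_gt0.
have ttd : 0 < t * (t * d) by apply: mulr_gt0.
by rewrite te mulrBr; lra.
Qed.

(** A point of the ball outside the zonotope would be separated from it by some w, against the
    comparison of support functions at w. *)
Lemma ball_sub_zonotope n (us : seq 'rV[R]_n) :
  (forall x, enorm x <= \sum_(u <- us) `|dot x u|) -> euclidean_ball R n `<=` zonotope us.
Proof.
move=> H x /euclidean_ballE x1; apply: contrapT => nZ.
have [w Hw] := separation (@compact_zonotope R n us) (@cvx_zonotope R n us) (zonotope_neq0 us) nZ.
have [[z Zz zE] _] := zonotope_support us w.
have := Hw _ Zz; rewrite zE ltNge => /negP; apply.
by rewrite (le_trans (dot_le _ _))// (le_trans _ (H w))// ler_piMr// enorm_ge0.
Qed.

(** Testing z against the direction z itself gives |z|^2 <= c |z|. *)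
Lemma zonotope_sub_ball n (us : seq 'rV[R]_n) (c : R) : 0 <= c ->
  (forall x, \sum_(u <- us) `|dot x u| <= c * enorm x) ->
  zonotope us `<=` scaled c (euclidean_ball R n).
Proof.
move=> c0 H z Zz.
have zc : enorm z <= c.
  have [->|z0] := eqVneq z 0; first by rewrite enorm0.
  have nz : 0 < enorm z by rewrite lt_neqAle eq_sym enorm_eq0 z0 enorm_ge0.
  have [_ /(_ _ Zz)] := zonotope_support us z.
  move=> /le_trans/(_ (H z)); rewrite -sqr_enorm expr2 ler_pM2r//.
have := @parallel_set_enorm R n [set 0] c z c0; rewrite parallel_setE => -[_ Hs].
have [|_ -> [y Sy <-]] := Hs; first by exists 0; rewrite ?subr0.
by rewrite add0r.
Qed.

End zonotope_approximation.

(** * Nonnegativity of the coefficients *)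

Section nonneg_coefficients.
Variable R : realType.

Implicit Types (p : {poly R}) (s t : R).

Definition shift_poly (p : {poly R}) : {poly R} := \poly_(i < (size p).-1) p`_i.+1.

Lemma coef_shift_poly p i : (shift_poly p)`_i = p`_i.+1.
Proof.
rewrite coef_poly; case: ifPn => //; rewrite -leqNgt => h.
by rewrite nth_default//; case: (size p) h.
Qed.

Lemma shift_polyE p : p = (p`_0)%:P + shift_poly p * 'X.
Proof.
apply/polyP => i; rewrite coefD coefC coefMX coef_shift_poly.
by case: i => [|i]; rewrite ?addr0 ?add0r.
Qed.

Lemma horner_shift_poly p t : t != 0 -> (shift_poly p).[t] = (p.[t] - p`_0) / t.
Proof.
by move=> t0; rewrite [in p.[t]](shift_polyE p) !hornerE addrAC subrr add0r mulfK.
Qed.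

Lemma nonneg_coef_shift p : nonneg_coef p -> nonneg_coef (shift_poly p).
Proof. by move=> H i; rewrite coef_shift_poly. Qed.

Lemma horner_nonneg_coef p t : nonneg_coef p -> 0 <= t -> 0 <= p.[t].
Proof.
by move=> H t0; rewrite horner_coef sumr_ge0// => i _; rewrite mulr_ge0// exprn_ge0.
Qed.

Lemma nonneg_coef_ge_coef0 p t : nonneg_coef p -> 0 <= t -> p`_0 <= p.[t].
Proof.
move=> H t0; rewrite [in p.[t]](shift_polyE p) !hornerE lerDl mulr_ge0//.
by apply: horner_nonneg_coef => //; exact: nonneg_coef_shift.
Qed.

Lemma le_horner_nonneg_coef p s t : nonneg_coef p -> 0 <= s -> s <= t -> p.[s] <= p.[t].
Proof.
move=> H s0 st; rewrite !horner_coef ler_sum// => i _; rewrite ler_wpM2l//.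
by rewrite lerXn2r// nnegrE// (le_trans s0).
Qed.

(** Together with [nonneg_coef_ge_coef0] this encloses the constant coefficient between expressions
    in the values at t and 2 t, which are under control in the limit. *)
Lemma nonneg_coef_midpoint p t : nonneg_coef p -> 0 <= t -> 2 * p.[t] - p.[2 * t] <= p`_0.
Proof.
move=> H t0; have Hs := nonneg_coef_shift H.
have tt : t <= 2 * t by lra.
have := le_horner_nonneg_coef Hs t0 tt.
rewrite [in p.[t]](shift_polyE p) [in p.[2 * t]](shift_polyE p) !(hornerD, hornerC, hornerM, hornerX).
by move=> /(ler_wpM2r t0); lra.
Qed.

(* Convexity on [0, +oo[ extends the convergence to t = 0, so that constant
   coefficients can be split off one by one. *)
Lemma lim_nonneg_coef (p : {poly R}) (q : nat -> {poly R}) :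
  (forall j, nonneg_coef (q j)) ->
  (forall t : R, 0 < t -> (q j).[t] @[j --> \oo] --> p.[t]) -> nonneg_coef p.
Proof.
move: {2}(size p) (leqnn (size p)) => m; elim: m p q => [|m IH] p q.
  by rewrite leqn0 size_poly_eq0 => /eqP -> _ _ i; rewrite coef0.
move=> sp qn qc.
have q0 : (q j)`_0 @[j --> \oo] --> p`_0.
  apply/cvgrPdist_le => e e0.
  have cp : p.[t] @[t --> 0^'+] --> p`_0.
    rewrite -horner_coef0; apply: cvg_at_right_filter; exact: continuous_horner.
  have cp2 : 2 * p.[t] - p.[2 * t] @[t --> 0^'+] --> p`_0.
    have -> : p`_0 = 2 * p.[0] - p.[2 * 0] by rewrite mulr0 horner_coef0; ring.
    apply: cvgB; first by apply: cvgM; [exact: cvg_cst|apply: cvg_at_right_filter; exact: continuous_horner].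
    have c2t : 2 * t @[t --> 0^'+] --> (2 * 0 : R).
      by apply: cvg_at_right_filter; apply: cvgM; [exact: cvg_cst|exact: cvg_id].
    exact: (cvg_comp _ _ c2t (@continuous_horner R p (2 * 0))).
  have e20 : 0 < e / 2 by rewrite divr_gt0.
  (* First t is fixed so that both enclosing expressions for p are within e / 2 of its constant
     coefficient; then j is taken large for this t. *)
  have : \forall t \near 0^'+, `|p`_0 - p.[t]| <= e / 2 /\ `|p`_0 - (2 * p.[t] - p.[2 * t])| <= e / 2 /\ 0 < t.
    near=> t; split; last split.
    - by near: t; move/cvgrPdist_le: cp; apply.
    - by near: t; move/cvgrPdist_le: cp2; apply.
    - by near: t; exact: nbhs_right_gt.
  move=> Hex; have [t [h1 [h2 t0]]] := @filter_ex _ _ (at_right_proper_filter (0 : R)) _ Hex.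
  have t20 : 0 < 2 * t by rewrite mulr_gt0.
  have c1 := qc t t0.
  have c2 : 2 * (q j).[t] - (q j).[2 * t] @[j --> \oo] --> 2 * p.[t] - p.[2 * t].
    by apply: cvgB; [apply: cvgM; [exact: cvg_cst|]|exact: qc].
  near=> j.
  have d1 : `|p.[t] - (q j).[t]| <= e / 2 by near: j; move/cvgrPdist_le: c1; apply.
  have d2 : `|2 * p.[t] - p.[2 * t] - (2 * (q j).[t] - (q j).[2 * t])| <= e / 2.
    by near: j; move/cvgrPdist_le: c2; apply.
  have l1 := nonneg_coef_ge_coef0 (qn j) (ltW t0).
  have l2 := nonneg_coef_midpoint (qn j) (ltW t0).
  move: h1 h2 d1 d2; rewrite !ler_norml => /andP[? ?] /andP[? ?] /andP[? ?] /andP[? ?].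
  by apply/andP; split; lra.
have p0 : 0 <= p`_0.
  rewrite -(cvg_lim _ q0)//; apply: limr_ge; first by apply/cvg_ex; exists p`_0.
  by near=> j; exact: qn.
suff ps : nonneg_coef (shift_poly p).
  by case=> [//|i]; rewrite -coef_shift_poly.
apply: (IH _ (fun j => shift_poly (q j))).
- by apply: leq_trans (size_poly _ _) _; case: (size p) sp.
- by move=> j; exact: nonneg_coef_shift.
- move=> t t0; have tn : t != 0 by rewrite gt_eqF.
  rewrite horner_shift_poly//; under eq_fun do rewrite horner_shift_poly//.
  by apply: cvgM; [apply: cvgB => //; exact: qc|exact: cvg_cst].
Unshelve. all: by end_near. Qed.

(** A zonotope between B and (1 + 1/(j+1)) B gives a polynomial q with p(t) <= q(t) <= p((1 +
    1/(j+1)) t), so q tends to p pointwise by continuity of p. *)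
Lemma steiner_nonneg_coef n (K : set 'rV[R]_n) (p : {poly R}) : compact K -> cvx K ->
  (forall t : R, 0 < t -> (p.[t])%:E = vol (parallel_set K t)) -> nonneg_coef p.
Proof.
move=> kK cK pE.
have Hq (j : nat) : exists q : {poly R}, nonneg_coef q /\
    forall t : R, 0 < t -> p.[t] <= q.[t] <= p.[(1 + j.+1%:R^-1) * t].
  have e0 : (0 : R) < j.+1%:R^-1 by rewrite invr_gt0.
  have [us Hus] := near_euclidean_norm n e0.
  have [q [_ qn] qE] := vol_zonotope_poly us kK cK.
  exists q; split => // t t0.
  set c := 1 + _; have c0 : 0 < c by rewrite addr_gt0.
  have kz : compact (msum K (scaled t (zonotope us))).
    by apply: compact_msum => //; apply: compact_scale; exact: compact_zonotope.
  have ct0 : 0 < c * t by rewrite mulr_gt0.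
  rewrite -!lee_fin -qE ?(ltW t0)// !pE//; apply/andP; split; apply: le_vol;
    try apply: borel_compact => //; try exact: compact_parallel; rewrite parallel_setE.
    move=> z [x Kx [_ [b Bb <-] <-]]; exists x => //; exists (t *: b) => //; exists b => //.
    by apply: (ball_sub_zonotope _ Bb) => y; case/andP: (Hus y).
  move=> z [x Kx [_ [b Zb <-] <-]]; exists x => //; exists (t *: b) => //.
  have [y By <-] := @zonotope_sub_ball R n us c (ltW c0) (fun y => (andP (Hus y)).2) b Zb.
  by exists y => //; rewrite scalerA mulrC.
have [q Hqj] := choice Hq.
apply: (@lim_nonneg_coef p q) => [j|t t0]; first by have [] := Hqj j.
have ct : p.[(1 + j.+1%:R^-1) * t] @[j --> \oo] --> p.[t].
  have c1 : (1 + j.+1%:R^-1) * t @[j --> \oo] --> (1 + 0) * t.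
    apply: cvgM; last exact: cvg_cst.
    by apply: cvgD; [exact: cvg_cst|exact: cvg_harmonic].
  by have := cvg_comp _ _ c1 (@continuous_horner R p _); rewrite addr0 mul1r.
apply: (squeeze_cvgr _ (cvg_cst p.[t]) ct); near=> j.
by have [_ /(_ t t0)] := Hqj j.
Unshelve. all: by end_near. Qed.

End nonneg_coefficients.

(** * Montel's theorem *)

Section montel.
Variable R : realType.
Local Open Scope complex_scope.

(** All that is retained of a member of the family; neither K nor n occurs in it. *)
Definition exp_dominated (p : {poly R}) :=
  nonneg_coef p /\ forall r : R, 0 < r -> p.[r] <= expR r.

Lemma normcE (z : R[i]) : `|z| = (Normc.normc z)%:C.
Proof. by case: z. Qed.

Lemma normc_ge0 (z : R[i]) : 0 <= Normc.normc z.
Proof. by case: z => a b; exact: sqrtr_ge0. Qed.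

Lemma Re_le_normc (z : R[i]) : `|complex.Re z| <= Normc.normc z.
Proof.
by case: z => a b /=; rewrite -sqrtr_sqr ler_sqrt ?lerDl ?addr_ge0 ?sqr_ge0.
Qed.

Lemma Im_le_normc (z : R[i]) : `|complex.Im z| <= Normc.normc z.
Proof.
by case: z => a b /=; rewrite -sqrtr_sqr ler_sqrt ?lerDr ?addr_ge0 ?sqr_ge0.
Qed.

Lemma normc_le_ReIm (z : R[i]) : Normc.normc z <= `|complex.Re z| + `|complex.Im z|.
Proof.
case: z => a b /=; rewrite -(@ler_pXn2r _ 2) ?nnegrE ?sqrtr_ge0 ?addr_ge0//.
rewrite sqr_sqrtr ?addr_ge0 ?sqr_ge0// sqrrD !real_normK ?num_real//.
by rewrite lerD2r lerDl mulrn_wge0// mulr_ge0.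
Qed.

Lemma normc_complex_eval (q : {poly R}) z N : (size q <= N)%N ->
  Normc.normc (complex_eval q z) <= \sum_(i < N) `|q`_i| * Normc.normc z ^+ i.
Proof.
move=> qN; rewrite -lecR -normcE /complex_eval (@horner_coef_wide _ N); last first.
  by rewrite size_map_poly.
rewrite (le_trans (ler_norm_sum _ _ _))// rmorph_sum/= ler_sum// => i _.
by rewrite coef_map/= normrM normrX !normcE rmorphM rmorphXn/= expr0n/= addr0 sqrtr_sqr.
Qed.

(* Since the coefficients are nonnegative, the tail of p at |z| <= r is at most
   [2 ^- M * p.[2 * r]]. *)
Lemma exp_dominated_dist (p q : {poly R}) (z : R[i]) (r d : R) (M : nat) :
  exp_dominated p -> exp_dominated q -> 0 < r -> Normc.normc z <= r -> 0 <= d ->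
  (forall i, (i < M)%N -> `|p`_i - q`_i| <= d) ->
  Normc.normc (complex_eval p z - complex_eval q z) <=
    d * (\sum_(i < M) r ^+ i) + 2 ^- M * (2 * expR (2 * r)).
Proof.
move=> [p0 pe] [q0 qe] r_gt0 zr d0 pq.
have r0 := ltW r_gt0; have r20 : 0 < 2 * r by rewrite mulr_gt0.
have -> : complex_eval p z - complex_eval q z = complex_eval (p - q) z.
  by rewrite /complex_eval rmorphB/= hornerD hornerN.
pose N := maxn M (maxn (size p) (size q)).
have sN : (size (p - q)%R <= N)%N.
  by rewrite (leq_trans (size_polyD _ _))// size_polyN leq_maxr.
have pN : (size p <= N)%N by rewrite (leq_trans (leq_maxl _ (size q)))// leq_maxr.
have qN : (size q <= N)%N by rewrite (leq_trans (leq_maxr (size p) _))// leq_maxr.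
rewrite (le_trans (normc_complex_eval z sN))//.
have p2M : (0 : R) < 2 ^- M by rewrite invr_gt0 exprn_gt0.
apply: (@le_trans _ _ (\sum_(i < N) ((if (i < M)%N then d * r ^+ i else 0) +
    2 ^- M * (p`_i * (2 * r) ^+ i + q`_i * (2 * r) ^+ i)))).
  apply: ler_sum => i _; rewrite coefB.
  have t0 : 0 <= 2 ^- M * (p`_i * (2 * r) ^+ i + q`_i * (2 * r) ^+ i).
    by rewrite mulr_ge0 ?(ltW p2M)// addr_ge0// mulr_ge0// exprn_ge0// ltW.
  have zri : Normc.normc z ^+ i <= r ^+ i by rewrite lerXn2r ?nnegrE ?normc_ge0.
  case: ifPn => iM; last rewrite add0r.
    apply: (@le_trans _ _ (d * r ^+ i)); last by rewrite lerDl.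
    by rewrite ler_pM ?exprn_ge0 ?normc_ge0// pq.
  rewrite -leqNgt in iM.
  rewrite -mulrDl mulrCA ler_pM ?exprn_ge0 ?normc_ge0//.
    by rewrite (le_trans (ler_normB _ _))// !ger0_norm.
  rewrite (le_trans zri)// exprMn mulrA ler_peMl ?exprn_ge0//.
  by rewrite mulrC ler_pdivlMr ?exprn_gt0// mul1r ler_weXn2l// ler1n.
rewrite big_split/= -mulr_sumr big_split/= -!horner_coef_wide//.
rewrite lerD//.
  rewrite -big_mkcond/= mulr_sumr (big_ord_widen N (fun i => d * r ^+ i))//.
  exact: leq_maxl.
by rewrite ler_pM2l//; have := pe _ r20; have := qe _ r20; lra.
Qed.

Lemma exp_dominated_coef (p : {poly R}) i : exp_dominated p -> 0 <= p`_i <= expR 1.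
Proof.
move=> [p0 pe]; rewrite p0/= (le_trans _ (pe 1 ltr01))//.
have [ip|ip] := ltnP i (size p); last first.
  by rewrite nth_default// horner_nonneg_coef.
rewrite horner_coef (bigD1 (Ordinal ip))//= expr1n mulr1 lerDl sumr_ge0// => j _.
by rewrite mulr_ge0// exprn_ge0.
Qed.

(** a is a cluster point of the coefficient sequences in the product topology, whose neighbourhoods
    restrict finitely many coordinates; hence the bound j. Asking for k beyond any N allows a
    subsequence to be extracted. *)
Lemma coef_cluster (p : nat -> {poly R}) : (forall k, exp_dominated (p k)) ->
  exists a : nat -> R, forall (N j : nat) (e : R), 0 < e ->
    exists2 k, (N < k)%N & forall i, (i <= j)%N -> `|(p k)`_i - a i| < e.
Proof.
move=> pd.
pose A (i : nat) : set R := [set` `[0, expR 1]].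
have kA := @tychonoff nat (fun=> R) A (fun i => @segment_compact R 0 (expR 1)).
have [|a [Aa ca]] := kA ((fun k => (fun i => (p k)`_i)) @ \oo) _.
  exists 0%N => // k _ i; have := exp_dominated_coef i (pd k).
  by rewrite /A/= in_itv.
exists a => N j e e0.
pose U (b : nat -> R) := forall i : 'I_j.+1, `|b i - a i| < e.
have Ui (i : 'I_j.+1) : nbhs (a : prod_topology (fun _ : nat => R))
    (fun b : nat -> R => `|b i - a i| < e).
  have Bi : nbhs (a i) (fun y : R => `|y - a i| < e).
    by apply: filterS (nbhsx_ballx (a i) e e0) => y; rewrite /ball/= distrC.
  exact: (@proj_continuous nat (fun=> R) i a _ Bi).
have Ua : nbhs (a : prod_topology (fun _ : nat => R)) U.
  have FF : Filter (nbhs (a : prod_topology (fun _ : nat => R))) by exact: nbhs_filter.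
  exact: (@filter_forall _ _ _ _ FF Ui).
have [|b [[k Nk bE] Ub]] := ca [set b | exists2 k, (N < k)%N & b = fun i => (p k)`_i] U _ Ua.
  by exists N.+1 => // k /= Nk; exists k.
exists k => // i ij; have := Ub (Ordinal (ij : (i < j.+1)%N)).
by rewrite bE.
Qed.

(** Real and imaginary parts are 1-Lipschitz, so completeness of R gives pointwise limits, and the
    Cauchy bound passes to the limit uniformly on the disk. *)
Lemma locally_uniform_cauchy_cvg (u : nat -> R[i] -> R[i]) :
  (forall r e : R, 0 < r -> 0 < e ->
    exists N, forall j l z, (N <= j)%N -> (N <= l)%N ->
      Normc.normc z <= r -> Normc.normc (u j z - u l z) <= e) ->
  exists f : R[i] -> R[i], forall r e : R, 0 < r -> 0 < e ->
    exists N, forall j z, (N <= j)%N -> Normc.normc z <= r ->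
      Normc.normc (f z - u j z) <= e.
Proof.
move=> uC.
have part_cvg (g : R[i] -> R) : (forall z w, `|g z - g w| <= Normc.normc (z - w)) ->
    exists L : R[i] -> R, forall r e : R, 0 < r -> 0 < e ->
      exists N, forall j z, (N <= j)%N -> Normc.normc z <= r -> `|L z - g (u j z)| <= e.
  move=> g_lip; pose L z : R := lim (g (u j z) @[j --> \oo]).
  have Lc z : g (u j z) @[j --> \oo] --> L z.
    apply: cauchy_cvg; apply: cauchy_exP => e e0.
    have z0 : 0 < Normc.normc z + 1 by rewrite ltr_wpDl// normc_ge0.
    have [|N NP] := uC _ (e / 2) z0; first by rewrite divr_gt0.
    exists (g (u N z)); exists N => // j /= Nj; rewrite /ball/=.
    rewrite (le_lt_trans (g_lip _ _))// (le_lt_trans (NP _ _ _ _ _ _))// ?lerDl//.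
    by rewrite ltr_pdivrMr// ltr_pMr// ltr1n.
  exists L => r e r0 e0; have [N NP] := uC r e r0 e0.
  exists N => j z Nj zr; apply/ler_addgt0Pr => d d0.
  have /cvgrPdist_lt/(_ d d0) Ld := Lc z.
  have [l [Ll Nl]] := @filter_ex _ _ _ _ (filterI Ld (nbhs_infty_ge N)).
  rewrite -(subrKA (g (u l z))) (le_trans (ler_normD _ _))// addrC lerD//.
    by rewrite (le_trans (g_lip _ _))// NP.
  exact: ltW.
have Re_lip (z w : R[i]) : `|complex.Re z - complex.Re w| <= Normc.normc (z - w).
  by rewrite -raddfB Re_le_normc.
have Im_lip (z w : R[i]) : `|complex.Im z - complex.Im w| <= Normc.normc (z - w).
  by rewrite -raddfB Im_le_normc.
have [L1 L1P] := part_cvg _ Re_lip; have [L2 L2P] := part_cvg _ Im_lip.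
exists (fun z => Complex (L1 z) (L2 z)) => r e r0 e0.
have e20 : 0 < e / 2 by rewrite divr_gt0.
have [N1 N1P] := L1P r _ r0 e20; have [N2 N2P] := L2P r _ r0 e20.
exists (maxn N1 N2) => j z; rewrite geq_max => /andP[j1 j2] zr.
rewrite (le_trans (normc_le_ReIm _))// (splitr e).
by rewrite lerD// raddfB; [exact: N1P|exact: N2P].
Qed.

Lemma montel (p : nat -> {poly R}) : (forall k, exp_dominated (p k)) ->
  exists2 phi : nat -> nat, {homo phi : j k / (j < k)%N} &
  exists f : R[i] -> R[i], forall r e : R, 0 < r -> 0 < e ->
    exists N, forall j z, (N <= j)%N -> Normc.normc z <= r ->
      Normc.normc (f z - complex_eval (p (phi j)) z) <= e.
Proof.
move=> pd; have [a ca] := coef_cluster pd.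
have Hg (Nj : nat * nat) : exists k, (Nj.1 < k)%N /\
    forall i, (i <= Nj.2)%N -> `|(p k)`_i - a i| < Nj.2.+1%:R^-1.
  have [|k k1 k2] := ca Nj.1 Nj.2 (Nj.2.+1%:R^-1); first by rewrite invr_gt0.
  by exists k.
have [g Hg'] := choice Hg.
(* The index number j comes after the previous one and has its coefficients of order at most j
   within 1/(j+1) of a. *)
pose phi := fix phi (j : nat) : nat := if j is j'.+1 then g (phi j', j) else g (0, 0)%N.
have phiS j : (phi j < phi j.+1)%N by have [] := Hg' (phi j, j.+1).
have phi_homo : {homo phi : j k / (j < k)%N} by apply: homo_ltn => //; exact: ltn_trans.
have phia j i : (i <= j)%N -> `|(p (phi j))`_i - a i| < j.+1%:R^-1.
  case: j => [|j].
    by have [_ /(_ i)] := Hg' (0, 0)%N.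
  by have [_ /(_ i)] := Hg' (phi j, j.+1).
pose u j := complex_eval (p (phi j)).
have uC (r e : R) : 0 < r -> 0 < e -> exists N, forall j l z, (N <= j)%N -> (N <= l)%N ->
    Normc.normc z <= r -> Normc.normc (u j z - u l z) <= e.
  (* Since 2^M > M, this M makes the tail at most e / 2. *)
  move=> r0 e0; pose M := Num.bound (4 * expR (2 * r) / e).
  pose S := \sum_(i < M) r ^+ i.
  have S0 : 0 <= S by apply: sumr_ge0 => i _; rewrite exprn_ge0// ltW.
  (* Beyond B two coefficients of order below M differ by at most 2/(B+1), which contributes at most
     e / 2; the maximum with M ensures that all these orders are covered. *)
  pose B := Num.bound (4 * S / e); exists (maxn M B) => j l z Nj Nl zr.
  have Nd k : (maxn M B <= k)%N -> k.+1%:R^-1 <= B.+1%:R^-1 :> R.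
    move=> Nk; rewrite lef_pV2 ?posrE// ler_nat ltnS.
    exact: leq_trans (leq_maxr M B) Nk.
  have d0 : (0 : R) <= 2 * B.+1%:R^-1 by rewrite mulr_ge0.
  apply: (le_trans (@exp_dominated_dist _ _ _ r (2 * B.+1%:R^-1) M _ _ r0 zr d0 _)) => //.
    move=> i iM; rewrite -(subrKA (a i)) (le_trans (ler_normD _ _))// (distrC (a i)).
    have iN : (i <= maxn M B)%N by rewrite (leq_trans (ltnW iM))// leq_maxl.
    have pj := le_trans (ltW (phia j i (leq_trans iN Nj))) (Nd j Nj).
    have pl := le_trans (ltW (phia l i (leq_trans iN Nl))) (Nd l Nl).
    by rewrite (le_trans (lerD pj pl))// mulr_natl mulr2n.
  have -> : e = e / 2 + e / 2 by rewrite -splitr.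
  apply: lerD.
    rewrite mulrAC ler_pdivrMr// -/S -ler_pdivrMl ?divr_gt0//.
    have : 4 * S / e < B%:R by apply: archi_boundP; rewrite divr_ge0 ?mulr_ge0// ltW.
    have -> : (e / 2)^-1 * (2 * S) = 4 * S / e by field; rewrite gt_eqF.
    by move=> /ltW/le_trans; apply; rewrite ler_nat.
  rewrite mulrC ler_pdivrMr ?exprn_gt0// -ler_pdivrMl ?divr_gt0//.
  have : 4 * expR (2 * r) / e < M%:R.
    by apply: archi_boundP; rewrite divr_ge0 ?mulr_ge0 ?expR_ge0// ltW.
  have -> : (e / 2)^-1 * (2 * expR (2 * r)) = 4 * expR (2 * r) / e by field; rewrite gt_eqF.
  move=> /ltW/le_trans; apply; rewrite -natrX ler_nat ltnW// ltn_expl//.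
exists phi => //.
exact: locally_uniform_cauchy_cvg.
Qed.

End montel.

(** * Uniform convergence on compact sets from convergence on disks *)

Section family.
Variable C : numClosedFieldType.

(* C need not be archimedean, so the balls of the covering are indexed by C. *)
Lemma compact_norm_bounded (A : set C) : compact A ->
  exists2 r : C, 0 < r & forall z, A z -> `|z| <= r.
Proof.
rewrite compact_cover => kA.
have [||D DA AD] := kA C setT (fun w => ball (0 : C) (`|w| + 1)).
- by move=> w _; exact: ball_open.
- by move=> z _; exists z => //; rewrite /ball/= sub0r normrN ltrDl.
have D0 (E : seq C) : 0 <= \sum_(w <- E) (`|w| + 1).
  by apply: sumr_ge0 => w _; rewrite addr_ge0.
exists (\sum_(w <- finmap.enum_fset D) (`|w| + 1) + 1) => [|z Az]; first by rewrite ltr_wpDl.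
have [w wD] := AD z Az; rewrite /ball/= sub0r normrN => /ltW/le_trans; apply.
by rewrite (finmap.big_fsetD1 w)//= -addrA lerDl addr_ge0.
Qed.

Lemma family_compact_cvg (u : nat -> C -> C) (f : C -> C) :
  (forall r e : C, 0 < r -> 0 < e ->
    exists N, forall j z, (N <= j)%N -> `|z| <= r -> `|f z - u j z| <= e) ->
  {family compact, u @ \oo --> f}.
Proof.
move=> uf; apply/fam_cvgP => A kA P /uniform_nbhs[E [entE EP]].
have [r r0 rA] := compact_norm_bounded kA.
move: entE; rewrite -entourage_ballE => -[e /= e0 eE].
have [|N NP] := uf r (e / 2) r0; first by rewrite divr_gt0.
exists N => // j /= Nj; apply: EP => z Az; apply: eE; rewrite /ball/=.
rewrite (le_lt_trans (NP _ _ Nj (rA _ Az)))//.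
by rewrite ltr_pdivrMr// ltr_pMr// ltr1n.
Qed.

End family.

(** Serves the branch of [xget] in which [steiner_poly] is its default value 0. *)
Lemma exp_dominated0 (R : realType) : exp_dominated (0 : {poly R}).
Proof. by split=> [i|r _]; rewrite ?coef0// horner0 expR_ge0. Qed.

Lemma exp_dominated_steiner (R : realType) n (K : set 'rV[R]_n) :
  solid_convex_body K -> exp_dominated (renormalized_steiner_poly K).
Proof.
move=> Ks; have [kK cK _] := Ks.
rewrite /renormalized_steiner_poly /steiner_poly; case: xgetP => [p _ pE|_]; last first.
  by rewrite comp_poly0 scaler0; exact: exp_dominated0.
have p0 : nonneg_coef p by exact: (steiner_nonneg_coef kK (convex_set_cvx cK) pE).
have [V0 [sg areaE [sg0 sgP]]] := surface_area Ks.
have pP t : 0 < t -> p.[t] <= fine (vol K) * expR (sg * t).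
  by move=> t0; rewrite (le_trans _ (sgP t t0))// -pE.
have -> : shape_factor K = sg by rewrite /shape_factor areaE/= mulfK ?gt_eqF.
have iV0 : 0 <= (fine (vol K))^-1 by rewrite invr_ge0 ltW.
have is0 : 0 <= sg^-1 by rewrite invr_ge0.
split=> [i|r r0].
  rewrite coefZ mulr_ge0//.
  by rewrite comp_polyE coef_sum sumr_ge0// => j _;
    rewrite coefZ exprZn coefZ coefXn !mulr_ge0// exprn_ge0.
rewrite hornerZ horner_comp hornerZ hornerX ler_pdivrMl//.
have [s0|s0] := eqVneq sg 0; last first.
  have := pP (sg^-1 * r); rewrite mulVKf//; apply.
  by rewrite mulr_gt0// invr_gt0 lt_neqAle eq_sym s0.
(* The inverse of 0 is 0, so for sg = 0 the renormalized polynomial is the constant p(0) / Vol(K),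
   and p(0) <= p(1) <= Vol(K). *)
rewrite s0 invr0 mul0r (le_trans (le_horner_nonneg_coef p0 (lexx 0) ler01))//.
rewrite (le_trans (pP 1 ltr01))// s0 mul0r ler_pM2l// ler_expR ltW//.
Qed.

Theorem corollary1p1 (R : realType) :
  normal_family (renormalized_steiner_family R).
Proof.
move=> u uF.
have pP k : exists p : {poly R}, exp_dominated p /\ u k = complex_eval p.
  have [n [K [_ Ks ->]]] := uF k.
  by exists (renormalized_steiner_poly K); split => //; exact: exp_dominated_steiner.
have [p pE] := choice pP.
have [|phi phi_homo [f fP]] := @montel R p; first by move=> k; have [] := pE k.
exists phi => //; exists f; apply: family_compact_cvg => r e r0 e0.
(* Positivity in [R[i]] forces the imaginary part to vanish, so both the radius and the tolerance
   are real. *)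
case: r e r0 e0 => a b [c d].
rewrite !ltcE/= => /andP[/eqP b0 a0] /andP[/eqP d0 c0]; subst b d.
have [N NP] := fP a c a0 c0; exists N => j z Nj.
by rewrite (pE _).2 !normcE !lecR; exact: NP.
Qed.
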